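(* Let $N$ be even, let $w:\mathbb C\to[0,\infty)$ be a weight function with $0<Z^w<\infty$, and let $\ell,m\ge 0$ be integers with $\ell+2m\le N$, not both zero. Then the $(\ell,m)$-correlation function of $\mathcal P^w$ is given by $$R_{\ell,m}(\mathbf x,\mathbf z)=\operatorname{Pf}\begin{bmatrix} K_N(x_j,x_{j'}) & K_N(x_j,z_{k'}) \\ K_N(z_k,x_{j'}) & K_N(z_k,z_{k'}) \end{bmatrix},\qquad j,j'=1,\dots,\ell;\ k,k'=1,\dots,m,$$ for $\mathbf x\in\mathbb R^\ell$, $\mathbf z\in(\mathbb C\setminus\mathbb R)^m$, where the matrix on the right is the $2(\ell+m)\times2(\ell+m)$ matrix composed of the indicated $2\times2$ blocks $K_N(\cdot,\cdot)$.
   Context: Notation: $\mathbb C_*=\mathbb C\setminus\mathbb R$; $\lambda_1,\lambda_2$ are Lebesgue measure on $\mathbb R$ and $\mathbb C$, $\lambda=\lambda_1+\lambda_2$, and $\lambda_L,\lambda_{2M}$ are Lebesgue measure on $\mathbb R^L,\mathbb C^M$. $\Delta(\boldsymbol\alpha,\boldsymbol\beta)$ is the Vandermonde determinant $\det[\gamma_n^{n'-1}]_{n,n'=1}^N$ in the $N=L+2M$ numbers $\alpha_1,\dots,\alpha_L,\beta_1,\overline{\beta_1},\dots,\beta_M,\overline{\beta_M}$, for $\boldsymbol\alpha\in\mathbb R^L,\boldsymbol\beta\in\mathbb C^M$. Pairs $(L,M)$ are always non-negative integers with $L+2M=N$. Put $$\Omega_{L,M}(\boldsymbol\alpha,\boldsymbol\beta)=2^M\Big\{\prod_{j=1}^Lw(\alpha_j)\prod_{k=1}^Mw(\beta_k)\Big\}|\Delta(\boldsymbol\alpha,\boldsymbol\beta)|,\qquad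 Z^w=\sum_{(L,M)}\frac1{L!M!2^M}\int_{\mathbb R^L}\int_{\mathbb C^M}\Omega_{L,M}\,d\lambda_L\,d\lambda_{2M}.$$ $\mathcal P^w$ is the point process of $L$ real points and $M$ complex conjugate pairs of non-real points (with $(L,M)$ random, $L+2M=N$) having these partial joint densities. Its $(\ell,m)$-correlation function is $$R_{\ell,m}(\mathbf x,\mathbf z)=\frac1{Z^w}\sum_{\substack{(L,M) \\ L\ge\ell,\, M\ge m}}\frac1{(L-\ell)!(M-m)!2^{M-m}}\int_{\mathbb R^{L-\ell}}\int_{\mathbb C^{M-m}}\Omega_{L,M}(\mathbf x\vee\boldsymbol\alpha,\mathbf z\vee\boldsymbol\beta)\,d\lambda_{L-\ell}(\boldsymbol\alpha)\,d\lambda_{2(M-m)}(\boldsymbol\beta),$$ where $\vee$ denotes concatenation of vectors. Kernel. For a measure $\nu=\nu_1+\nu_2$ with $\nu_1$ on $\mathbb R$ and $\nu_2$ on $\mathbb C_*$, put $\epsilon_\nu g(\gamma)=\frac12\int_{\mathbb R}g(y)\operatorname{sgn}(y-\gamma)\,d\nu_1(y)$ if $\gamma\in\mathbb R$, and $\epsilon_\nu g(\gamma)=i\,g(\overline\gamma)\operatorname{sgn}(\operatorname{Im}\gamma)$ if $\gamma\in\mathbb C_*$, and $\langle g|h\rangle_\nu=\int_{\mathbb C}\big(g(\gamma)\,\epsilon_\nu h(\gamma)-\epsilon_\nu g(\gamma)\,h(\gamma)\big)\,d\nu(\gamma)$. These are used for $\nu=\lambda$ and for $\nu=w\lambda$ (the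 measure with density $w$ with respect to $\lambda$). Let $q_0,\dots,q_{N-1}\in\mathbb R[\gamma]$ be monic polynomials with $\deg q_n=n$, and let $\widetilde q_n(\gamma)=q_n(\gamma)w(\gamma)$. Let $\mathbf U=[\langle q_n|q_{n'}\rangle_{w\lambda}]_{n,n'=0}^{N-1}$ and let $\mu_{n,n'}$ be the $(n,n')$ entry of $(\mathbf U^{-1})^{\mathsf T}$. Define $$S_N(\gamma,\gamma')=2\sum_{n,n'=0}^{N-1}\mu_{n,n'}\widetilde q_n(\gamma)\,\epsilon_\lambda\widetilde q_{n'}(\gamma'),\quad DS_N(\gamma,\gamma')=2\sum_{n,n'=0}^{N-1}\mu_{n,n'}\widetilde q_n(\gamma)\widetilde q_{n'}(\gamma'),$$ $$IS_N(\gamma,\gamma')=2\sum_{n,n'=0}^{N-1}\mu_{n,n'}\,\epsilon_\lambda\widetilde q_n(\gamma)\,\epsilon_\lambda\widetilde q_{n'}(\gamma'),$$ $\mathcal E(\gamma,\gamma')=\frac12\operatorname{sgn}(\gamma-\gamma')$ if $\gamma,\gamma'\in\mathbb R$ and $0$ otherwise (with $\operatorname{sgn}0=0$), and $$K_N(\gamma,\gamma')=\begin{bmatrix} DS_N(\gamma,\gamma') & S_N(\gamma,\gamma') \\ -S_N(\gamma',\gamma) & IS_N(\gamma,\gamma')+\mathcal E(\gamma,\gamma') \end{bmatrix}.$$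
   Formalization: Off the real line the printed formula counts w twice per pair (false for N=2, w=exp(-|z|²)), so q̃_n = q_n·φ replaces q_n·w, with φ = w on R and φ(z)φ(z̄) = w(z) off R; hence w(z̄) = w(z). For m = 0 general w follows by symmetrizing w. *)

(* Defs.v *)
From mathcomp Require Export all_boot all_order all_algebra all_fingroup.
From mathcomp Require Export all_classical all_reals all_analysis.
From mathcomp Require Export complex.

Set Implicit Arguments.
Unset Strict Implicit.
Unset Printing Implicit Defensive.

Import Order.TTheory GRing.Theory Num.Theory ComplexField.
Import numFieldNormedType.Exports.

Local Open Scope classical_set_scope.
Local Open Scope ring_scope.
Local Open Scope complex_scope.

(* The plane is carried by [R * R], whose product sigma-algebra is the Borel
   one; [toC] is the identification with [R[i]]. *)
Definition toC (R : realType) (p : R * R) : R[i] := p.1 +i* p.2.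

Definition leb1 (R : realType) : set R -> \bar R := @lebesgue_measure R.

Definition leb2 (R : realType) : set (R * R) -> \bar R :=
  (@lebesgue_measure R \x @lebesgue_measure R)%E.

Section TupleMeasure.
Variables (d : measure_display) (T : measurableType d) (R : realType).
Variable mu : set T -> \bar R.

Fixpoint tuple_measure (n : nat) {struct n} : set (n.-tuple T) -> \bar R :=
  match n with
  | 0%N => \d_([tuple] : 0.-tuple T)
  | k.+1 => pushforward (mu \x @tuple_measure k)%E
              (fun p : T * k.-tuple T => [tuple of p.1 :: p.2])
  end.

End TupleMeasure.

Arguments tuple_measure {d T R} mu n _.

Definition density_measure d (T : measurableType d) (R : realType)
    (mu : set T -> \bar R) (f : T -> R) : set T -> \bar R :=
  fun A => (\int[mu]_(t in A) (f t)%:E)%E.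

Definition complex_integral d (T : measurableType d) (R : realType)
    (mu : set T -> \bar R) (D : set T) (f : T -> R[i]) : R[i] :=
  fine (\int[mu]_(t in D) (complex.Re (f t))%:E)%E
    +i* fine (\int[mu]_(t in D) (complex.Im (f t))%:E)%E.

Definition conj_points (R : realType) (a : seq R) (b : seq R[i]) : seq R[i] :=
  [seq t%:C | t <- a] ++ flatten [seq [:: z; z^*] | z <- b].

Definition vandermonde_det (R : realType) (s : seq R[i]) : R[i] :=
  \det (\matrix_(i < size s, j < size s) s`_i ^+ j).

(* [L] and [M] are the lengths of the lists [a] and [b]; lists rather than
   tuples, so that concatenating with [x] and [z] below needs no casts. *)
Definition Omega (R : realType) (w : R[i] -> R) (a : seq R) (b : seq R[i]) : R :=
  2 ^+ size b * ((\prod_(t <- a) w t%:C) * (\prod_(z <- b) w z))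
    * Normc.normc (vandermonde_det (conj_points a b)).

Definition partition_function (R : realType) (N : nat) (w : R[i] -> R) : \bar R :=
  (\sum_(p : 'I_N.+1 * 'I_N.+1 | (p.1 + 2 * p.2 == N)%N)
    ((p.1`! * p.2`! * 2 ^ p.2)%:R^-1)%:E *
    \int[tuple_measure (@leb1 R) p.1]_a
      \int[tuple_measure (@leb2 R) p.2]_b
        (Omega w a [seq toC t | t <- b])%:E)%E.

Definition correlation (R : realType) (N : nat) (w : R[i] -> R) (l m : nat)
    (x : l.-tuple R) (z : m.-tuple R[i]) : \bar R :=
  ((fine (partition_function N w))^-1)%:E *
  (\sum_(p : 'I_N.+1 * 'I_N.+1 |
         [&& (p.1 + 2 * p.2 == N)%N, (l <= p.1)%N & (m <= p.2)%N])
    (((p.1 - l)`! * (p.2 - m)`! * 2 ^ (p.2 - m))%:R^-1)%:E *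
    \int[tuple_measure (@leb1 R) (p.1 - l)]_a
      \int[tuple_measure (@leb2 R) (p.2 - m)]_b
        (Omega w (x ++ a) (z ++ [seq toC t | t <- b]))%:E)%E.

(* A measure [nu = nu1 + nu2] is given by [nu1] on [R] and [nu2] on the plane;
   only the restriction of [nu2] to the complement of the real axis is used. *)
Definition epsilon (R : realType) (nu1 : set R -> \bar R) (g : R[i] -> R[i])
    (c : R[i]) : R[i] :=
  if complex.Im c == 0 then
    2^-1 * complex_integral nu1 setT
             (fun y : R => g y%:C * (Num.sg (y - complex.Re c))%:C)
  else (0 +i* 1) * g c^* * (Num.sg (complex.Im c))%:C.

Definition skew_form (R : realType) (nu1 : set R -> \bar R)
    (nu2 : set (R * R) -> \bar R) (g h : R[i] -> R[i]) : R[i] :=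
  let F c := g c * epsilon nu1 h c - epsilon nu1 g c * h c in
  complex_integral nu1 setT (fun y : R => F y%:C)
  + complex_integral nu2 [set p : R * R | p.2 != 0] (fun p => F (toC p)).

Definition poly_fun (R : realType) (p : {poly R}) (c : R[i]) : R[i] :=
  (map_poly (real_complex R) p).[c].

Definition gram (R : realType) (N : nat) (w : R[i] -> R)
    (q : 'I_N -> {poly R}) : 'M[R[i]]_N :=
  \matrix_(n, n') skew_form
    (density_measure (@leb1 R) (fun t => w t%:C))
    (density_measure (@leb2 R) (fun p => w (toC p)))
    (poly_fun (q n)) (poly_fun (q n')).

(* [phi] is the factor carried by each individual point: the density of the
   process involves [w] once per real point and once per pair [z, z^*], that is,
   [phi] once for each of the [N] points. For the real Ginibre ensemble,
   [phi c = exp(- c^2 / 2) sqrt(erfc(sqrt 2 |Im c|))]; when [w] is invariant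
   under conjugation, one may take [phi z = sqrt(w z)] off the real line. *)
Definition point_factor (R : realType) (w : R[i] -> R) (phi : R[i] -> R[i]) : Prop :=
  (forall t : R, phi t%:C = (w t%:C)%:C) /\
  (forall z : R[i], complex.Im z != 0 -> phi z * phi z^* = (w z)%:C).

Section Kernel.
Variables (R : realType) (N : nat) (w : R[i] -> R) (phi : R[i] -> R[i]).
Variable q : 'I_N -> {poly R}.

Definition qtilde (n : 'I_N) (c : R[i]) : R[i] := poly_fun (q n) c * phi c.

Definition mu_mx : 'M[R[i]]_N := (invmx (gram w q))^T.

Definition S_kernel (c c' : R[i]) : R[i] :=
  2 * \sum_(n < N) \sum_(n' < N)
        mu_mx n n' * qtilde n c * epsilon (@leb1 R) (qtilde n') c'.

Definition DS_kernel (c c' : R[i]) : R[i] :=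
  2 * \sum_(n < N) \sum_(n' < N) mu_mx n n' * qtilde n c * qtilde n' c'.

Definition IS_kernel (c c' : R[i]) : R[i] :=
  2 * \sum_(n < N) \sum_(n' < N)
        mu_mx n n' * epsilon (@leb1 R) (qtilde n) c
                   * epsilon (@leb1 R) (qtilde n') c'.

Definition E_kernel (c c' : R[i]) : R[i] :=
  if (complex.Im c == 0) && (complex.Im c' == 0) then
    2^-1 * (Num.sg (complex.Re c - complex.Re c'))%:C
  else 0.

Definition K_kernel (c c' : R[i]) : 'M[R[i]]_2 :=
  \matrix_(a < 2, b < 2)
    if a == 0 then (if b == 0 then DS_kernel c c' else S_kernel c c')
    else (if b == 0 then - S_kernel c' c else IS_kernel c c' + E_kernel c c').

End Kernel.

Lemma half_ord_subproof n (i : 'I_n.*2) : (i./2 < n)%N.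
Proof. by rewrite ltn_half_double. Qed.

Definition half_ord n (i : 'I_n.*2) : 'I_n := Ordinal (half_ord_subproof i).

Lemma dbl_ord_subproof n (i : 'I_n) (b : bool) : (b + i.*2 < n.*2)%N.
Proof. by rewrite -ltn_half_double half_bit_double. Qed.

Definition dbl_ord n (i : 'I_n) (b : bool) : 'I_n.*2 :=
  Ordinal (dbl_ord_subproof i b).

Definition pfaffian (F : fieldType) n (A : 'M[F]_n.*2) : F :=
  (2 ^ n * n`!)%:R^-1 *
  \sum_(s : {perm 'I_n.*2})
     (-1) ^+ s * \prod_(i < n) A (s (dbl_ord i false)) (s (dbl_ord i true)).

Definition block2_mx (F : fieldType) n (B : 'I_n -> 'I_n -> 'M[F]_2) : 'M[F]_n.*2 :=
  \matrix_(i, j) B (half_ord i) (half_ord j) (inord (odd i)) (inord (odd j)).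

(* Main.v *)
(* Multiplying the Vandermonde determinant [Delta] by the sign [prod sgn (a_j - a_i)]
   of the real points and by [i sgn (Im b)] for each pair gives [|Delta|]; up to
   the weights this is a determinant whose rows are the vectors [qtilde] at the
   points. Integrating out a complex pair inserts an antisymmetric bilinear form
   in two slots of the determinant. The sign factor of the real points is
   alternating; for an odd number of remaining points it expands along one
   point, so integrating out the real points inserts either the form with
   kernel [sgn (y - x)] or the vector [epsilon qtilde].
   Hence the correlation numerators satisfy a recursion on the number of real
   points, whose initial value is the Wick functional
   [sum_h 1/h! det (u_1, .., u_k, B, .., B)] of a matrix [B] with
   [B - B^T = U]. Wick's theorem (the contraction of a determinant with a linear
   form vanishes) makes this functional [Z^w] times the Pfaffian of [U^-1] on the
   [u_j], and the row expansion of the Pfaffian of [K_N] obeys the same recursion.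
   Finiteness of [Z^w] is what makes all the moments in [U] converge. *)

From HB Require Import structures.
Require Import Defs.
From mathcomp Require Import measurable_realfun ring lra zify.
Import Order.TTheory GRing.Theory Num.Theory.
Import numFieldNormedType.Exports.
Set Implicit Arguments.
Unset Strict Implicit.
Unset Printing Implicit Defensive.
Local Open Scope classical_set_scope.
Local Open Scope ring_scope.
Local Open Scope complex_scope.

(** * Signed contractions *)

(** Convergence of the moments is the delicate point. Finiteness of [Z^w] controls only the absolute
    values of whole determinants, whereas [U] needs every entry to be integrable by itself. Two
    terms of [Z^w] suffice, [(N, 0)] for the line and [(0, N/2)] for the plane. As a function of one
    point (or one pair), the determinant is a linear combination of the functions in question, with
    coefficients that depend on the remaining points. The linear independence of the polynomials and
    the nondegeneracy of the determinant exclude a linear relation between these coefficients, and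
    this forces each function to be integrable. If [w] vanishes almost everywhere on the line, or on
    the plane, the corresponding functions are trivially integrable. The constant 2 in the kernel
    comes from the normalization: [2^M] in the density against [1 / 2^(M-m)] in the correlation
    function leaves [2^m], and each contraction in the Pfaffian uses up two vectors and carries one
    factor 2. *)

Section Contraction.
Variables (T : Type) (K : comNzRingType).
Implicit Types (f g : T -> K) (F G : seq T -> K) (us vs ws : seq T).

Definition alternating F :=
  forall us u v vs, F (us ++ u :: v :: vs) = - F (us ++ v :: u :: vs).

(** The interior product of the form [F] with [f], with the sign [(-1)^j] at the [j]-th entry. For a
    Pfaffian it is the expansion along a row, for a determinant the expansion along a column. *)
Fixpoint contract f F us : K :=
  if us is u :: us' then f u * F us' - contract f (fun r => F (u :: r)) us'
  else 0.

(** The unsigned counterpart of [contract]. It appears when two alternating factors are expanded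
    together, because their signs cancel. *)
Fixpoint select_sum (h : T -> seq T -> K) us : K :=
  if us is u :: us' then h u us' + select_sum (fun v r => h v (u :: r)) us'
  else 0.

Lemma eq_contract f g F G us :
  f =1 g -> F =1 G -> contract f F us = contract g G us.
Proof.
move=> fg; elim: us F G => //= u us IH F G FG.
by rewrite fg FG (IH _ (fun r => G (u :: r))).
Qed.

Lemma contractDl f g F us :
  contract (fun u => f u + g u) F us = contract f F us + contract g F us.
Proof. by elim: us F => [|u us IH] F /=; rewrite ?addr0 // IH; ring. Qed.

Lemma contractZl a f F us :
  contract (fun u => a * f u) F us = a * contract f F us.
Proof. by elim: us F => [|u us IH] F /=; rewrite ?mulr0 // IH; ring. Qed.

Lemma contractD f F G us :
  contract f (fun r => F r + G r) us = contract f F us + contract f G us.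
Proof. by elim: us F G => [|u us IH] F G /=; rewrite ?addr0 // IH; ring. Qed.

Lemma contractZ f a F us :
  contract f (fun r => a * F r) us = a * contract f F us.
Proof. by elim: us F => [|u us IH] F /=; rewrite ?mulr0 // IH; ring. Qed.

Lemma contract0 f us : contract f (fun=> 0) us = 0.
Proof. by elim: us => //= u us ->; rewrite mulr0 subr0. Qed.

Lemma contract0l F us : contract (fun=> 0) F us = 0.
Proof. by elim: us F => //= u us IH F; rewrite IH mul0r subr0. Qed.

Lemma contractN f F us : contract f (fun r => - F r) us = - contract f F us.
Proof.
rewrite -mulN1r -contractZ; apply: eq_contract => // r.
by rewrite mulN1r.
Qed.

Lemma contract_sum (I : Type) (r : seq I) f (F : I -> seq T -> K) us :
  contract f (fun s => \sum_(i <- r) F i s) us = \sum_(i <- r) contract f (F i) us.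
Proof.
elim: r => [|i r IH].
  by rewrite big_nil -[RHS](contract0 f us); apply: eq_contract => // s; rewrite big_nil.
rewrite big_cons -IH -contractD; apply: eq_contract => // s.
by rewrite big_cons.
Qed.

Lemma contract_cat f F us vs :
  contract f F (us ++ vs) = contract f (fun r => F (r ++ vs)) us
    + (-1) ^+ size us * contract f (fun r => F (us ++ r)) vs.
Proof.
elim: us F => [|u us IH] F /=; first by rewrite expr0; ring.
by rewrite IH exprS; ring.
Qed.

Lemma eq_select_sum h k us :
  (forall u r, (size us = (size r).+1)%N -> h u r = k u r) -> select_sum h us = select_sum k us.
Proof.
elim: us h k => //= u us IH h k hk; rewrite hk //; congr (_ + _).
by apply: IH => v r e; apply: hk => /=; rewrite e.
Qed.

Lemma select_sum_cat h us vs :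
  select_sum h (us ++ vs) = select_sum (fun u r => h u (r ++ vs)) us
    + select_sum (fun v r => h v (us ++ r)) vs.
Proof.
elim: us h => [|u us IH] h /=; first by rewrite add0r.
by rewrite IH addrA.
Qed.

Lemma select_sumZ a h us :
  select_sum (fun u r => a * h u r) us = a * select_sum h us.
Proof. by elim: us h => [|u us IH] h /=; rewrite ?mulr0 // IH mulrDr. Qed.

Lemma select_sum_sum (I : Type) (s : seq I) (h : I -> T -> seq T -> K) us :
  select_sum (fun u r => \sum_(i <- s) h i u r) us = \sum_(i <- s) select_sum (h i) us.
Proof.
elim: us h => [|u us IH] h /=; first by rewrite big1.
by rewrite IH big_split.
Qed.

(* The sign [(-1)^j] of the [j]-th term of a contraction is absorbed by moving
   the [j]-th argument of an alternating function to a fixed position. *)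
Lemma contract_mul_alternating f F G (h : T -> seq T -> K) us :
  (forall vs u ws, (size us = (size vs + size ws).+1)%N ->
     G (vs ++ u :: ws) = (-1) ^+ size vs * h u (vs ++ ws)) ->
  contract f F us * G us = select_sum (fun u r => f u * F r * h u r) us.
Proof.
elim: us F G h => [|u us IH] F G h Gh /=; first by rewrite mul0r.
rewrite mulrBl {1}(Gh [::] u us) //= mul1r; congr (_ + _).
pose G' r := - G (u :: r).
rewrite -mulrN. rewrite (_ : - G (u :: us) = G' us) // (IH _ G' (fun v r => h v (u :: r))) // /G' => vs v ws e.
by rewrite (Gh (u :: vs)) /= ?exprS; [ring | rewrite e].
Qed.

Section Moves.
Variable F : seq T -> K.
Hypothesis altF : alternating F.

Lemma alternating_cat vs : alternating (fun r => F (vs ++ r)).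
Proof. by move=> us u v ws; rewrite !catA altF. Qed.

Lemma alternating_cons u : alternating (fun r => F (u :: r)).
Proof. exact: (alternating_cat [:: u]). Qed.

Lemma alternating_move us u vs ws :
  F (us ++ u :: vs ++ ws) = (-1) ^+ size vs * F (us ++ vs ++ u :: ws).
Proof.
elim: vs us => [|v vs IH] us /=; first by rewrite mul1r.
by rewrite altF -cat_rcons IH cat_rcons exprS; ring.
Qed.

(** Both entries cross the same block, so the sign is a square. Adjacent pairs therefore commute
    with everything, which makes it harmless that inserted pairs stand at the end of the list. *)
Lemma alternating_move2 us u v vs ws :
  F (us ++ u :: v :: vs ++ ws) = F (us ++ vs ++ u :: v :: ws).
Proof.
rewrite -cat_rcons alternating_move cat_rcons alternating_move mulrA -expr2.
by rewrite sqrr_sign mul1r.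
Qed.

(** The entry [x] crosses [vs], [y] and [ws]; then [y] crosses [ws] and [x]. All signs cancel except
    that of [vs]. *)
Lemma alternating_pull x vs y ws st :
  F (x :: (vs ++ y :: ws) ++ st) = (-1) ^+ size vs * F ((vs ++ ws) ++ x :: y :: st).
Proof.
have := alternating_move [::] x (vs ++ y :: ws) st; rewrite /= => ->.
rewrite -catA /= alternating_move size_cat /=.
have := alternating_move (vs ++ ws) y [:: x] st; rewrite /= => e.
rewrite !catA e expr1 addnS exprS exprD.
have := sqrr_sign K (size ws); rewrite expr2 => q.
transitivity ((-1) ^+ size vs * ((-1) ^+ size ws * (-1) ^+ size ws) * F ((vs ++ ws) ++ [:: x, y & st])); first by ring.
by rewrite q mulr1.
Qed.

(** Terms that keep both entries change sign with [F]; the two terms that remove one of them sit at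
    neighbouring positions and are exchanged with opposite signs. *)
Lemma alternating_contract f : alternating (contract f F).
Proof.
move=> us u v vs; rewrite !contract_cat /=.
have -> : contract f (fun r => F (r ++ [:: u, v & vs])) us =
          - contract f (fun r => F (r ++ [:: v, u & vs])) us.
  by rewrite -contractN; apply: eq_contract => // r; rewrite altF.
have -> : contract f (fun r => F (us ++ [:: u, v & r])) vs =
          - contract f (fun r => F (us ++ [:: v, u & r])) vs.
  by rewrite -contractN; apply: eq_contract => // r; rewrite altF.
by ring.
Qed.

End Moves.
End Contraction.

(** Only vanishing is transported, so the sign of the permutation need not be tracked. An identity
    between alternating functions can thus be checked on sorted arguments. *)
Lemma alternating_perm_eq0 (T : eqType) (K : comNzRingType) (F : seq T -> K) s t :
  alternating F -> perm_eq s t -> F t = 0 -> F s = 0.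
Proof.
move=> altF; suff H us : perm_eq s t -> F (us ++ t) = 0 -> F (us ++ s) = 0.
  exact: (H [::]).
elim: s t us => [|a s IH] t us st.
  by move/perm_size/esym/size0nil: st => ->.
have a_t : a \in t by rewrite -(perm_mem st) inE eqxx.
case/splitPr: a_t st => p1 p2 st F0.
rewrite -(cat_rcons a us s); apply: (IH (p1 ++ p2)).
  by rewrite -(perm_cons a) (perm_trans st) // -[a :: p2]cat1s perm_catCA.
rewrite cat_rcons alternating_move //.
by rewrite F0 mulr0.
Qed.

Section ContractIndex.
Variables (T : Type) (K : comNzRingType) (x0 : T).

Lemma contractE (f : T -> K) (F : seq T -> K) us :
  contract f F us = \sum_(i < size us)
    (-1) ^+ i * (f (nth x0 us i) * F (take i us ++ drop i.+1 us)).
Proof.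
elim: us F => [|u us IH] F /=; first by rewrite big_ord0.
rewrite big_ord_recl /= ?take0 drop0 expr0 mul1r IH -sumrN; congr (_ + _).
by apply: eq_bigr => i _; rewrite /= /bump /= add1n exprS; ring.
Qed.

Lemma nth_take_drop (us : seq T) i j : (i < size us)%N ->
  nth x0 (take i us ++ drop i.+1 us) j = nth x0 us (bump i j).
Proof.
move=> lt_i; rewrite nth_cat size_takel; last exact: ltnW.
rewrite /bump; case: ltnP => [lt_ji|le_ij]; first by rewrite nth_take // leqNgt lt_ji.
by rewrite nth_drop; congr nth; rewrite add1n; lia.
Qed.

Lemma size_take_drop (us : seq T) i : (i < size us)%N ->
  size (take i us ++ drop i.+1 us) = (size us).-1.
Proof. by move=> lt_i; rewrite size_cat size_takel 1?ltnW // size_drop; lia. Qed.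

Lemma contract_eq0 (f : T -> K) (F : seq T -> K) us :
  (forall r, size us = (size r).+1 -> F r = 0) -> contract f F us = 0.
Proof.
elim: us F => //= u us IH F F0; rewrite F0 // mulr0 sub0r IH ?oppr0 //.
by move=> r e; apply: F0; rewrite /= e.
Qed.

End ContractIndex.

Lemma trmx_invmx_skew (K : comUnitRingType) n (U : 'M[K]_n) :
  U^T = - U -> (invmx U)^T = - invmx U.
Proof.
(* For a singular matrix [invmx] returns the matrix itself, which is skew by hypothesis. *)
move=> UT; case uU: (U \in unitmx); last by rewrite /invmx uU UT.
have uN : -1 *: U \in unitmx by rewrite unitmxZ ?unitrN1.
by rewrite trmx_inv UT -(scaleN1r U) (invmxZ uN) invrN1 scaleN1r.
Qed.

(** * Wick expansions of determinants *)

Section Multilinear.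
Variables (K : numFieldType) (N : nat).
Notation V := 'rV[K]_N.
Implicit Types (F : seq V -> K) (us vs : seq V).

Definition multilinear F := forall us a u v vs,
  F (us ++ (a *: u + v) :: vs) = a * F (us ++ u :: vs) + F (us ++ v :: vs).

Definition basis_row (k : 'I_N) : V := delta_mx 0 k.

Section Theory.
Variable F : seq V -> K.
Hypothesis linF : multilinear F.

Lemma multilinear0 us vs : F (us ++ 0 :: vs) = 0.
Proof.
have := linF us (-1) 0 0 vs; rewrite scaler0 addr0 mulN1r => ->.
by rewrite addNr.
Qed.

Lemma multilinearZ us a u vs : F (us ++ a *: u :: vs) = a * F (us ++ u :: vs).
Proof. by rewrite -[a *: u]addr0 linF multilinear0 addr0. Qed.

Lemma multilinearD us u v vs :
  F (us ++ (u + v) :: vs) = F (us ++ u :: vs) + F (us ++ v :: vs).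
Proof. by rewrite -[u]scale1r linF mul1r scale1r. Qed.

Lemma multilinear_sum (I : Type) (r : seq I) (c : I -> K) (u : I -> V) us vs :
  F (us ++ (\sum_(i <- r) c i *: u i) :: vs) = \sum_(i <- r) c i * F (us ++ u i :: vs).
Proof.
elim: r => [|i r IH]; first by rewrite !big_nil multilinear0.
by rewrite !big_cons linF IH.
Qed.

Lemma multilinear_basis us u vs :
  F (us ++ u :: vs) = \sum_k u 0 k * F (us ++ basis_row k :: vs).
Proof. by rewrite {1}(row_sum_delta u) multilinear_sum. Qed.

Lemma multilinear_cat ws : multilinear (fun r => F (ws ++ r)).
Proof. by move=> us a u v vs; rewrite !catA linF. Qed.

Lemma multilinear_alternating :
  (forall us u vs, F (us ++ u :: u :: vs) = 0) -> alternating F.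
Proof.
move=> F0 us u v vs; have := F0 us (u + v) vs.
have D2 x : F (us ++ [:: x, u + v & vs]) = F (us ++ [:: x, u & vs]) + F (us ++ [:: x, v & vs]).
  by rewrite -!(cat_rcons x) multilinearD.
rewrite multilinearD !D2 !F0 add0r addr0.
by move/eqP; rewrite addr_eq0 => /eqP.
Qed.

End Theory.

(** The value 0 away from length [N] makes terms with a wrong number of points vanish, so that later
    sums can range over all numbers of points. *)
Definition det_seq us : K :=
  if size us == N then \det (\matrix_(i < N) nth 0 us i) else 0.

Lemma det_seq_multilinear : multilinear det_seq.
Proof.
move=> us a u v vs; rewrite /det_seq !size_cat /=.
case: eqP => [e|]; last by rewrite mulr0 addr0.
have lt_us : (size us < N)%N by lia.
have nthE x (i : 'I_N) :
    nth 0 (us ++ x :: vs) i = if i == Ordinal lt_us then x else nth 0 (us ++ u :: vs) i.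
  rewrite -val_eqE /= !nth_cat; case: ltngtP => // [lt|->]; last by rewrite subnn.
  by rewrite -(subnSK lt).
rewrite (@determinant_multilinear _ _ _ (\matrix_(i < N) nth 0 (us ++ u :: vs) i)
  (\matrix_(i < N) nth 0 (us ++ v :: vs) i) (Ordinal lt_us) a 1) ?mul1r //.
- by rewrite !rowK scale1r (nthE (_ + _)) (nthE v) eqxx /= nth_cat ltnn subnn.
- apply/matrixP => i j; rewrite !mxE (nthE (_ + _)).
  by rewrite eq_sym (negPf (neq_lift _ _)).
- apply/matrixP => i j; rewrite !mxE (nthE (_ + _)) (nthE v).
  by rewrite eq_sym (negPf (neq_lift _ _)).
Qed.

Lemma det_seq_alternating : alternating det_seq.
Proof.
apply: multilinear_alternating; first exact: det_seq_multilinear.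
move=> us u vs; rewrite /det_seq size_cat /=; case: eqP => // e.
have lt1 : (size us < N)%N by lia.
have lt2 : ((size us).+1 < N)%N by lia.
apply: (@determinant_alternate _ _ _ (Ordinal lt1) (Ordinal lt2)).
  by rewrite -val_eqE /= neq_ltn ltnSn.
move=> j; rewrite !mxE !nth_cat /= ltnn subnn ltnNge leqnSn /=.
by rewrite subSn // subnn.
Qed.

Definition row_form (c : V) (u : V) : K := \sum_k u 0 k * c 0 k.

(** For [N + 1] arguments this is the expansion, along its first column, of the determinant with
    rows [(row_form c u_i, u_i)]. That column is the combination of the others with coefficients
    [c]. For any other number of arguments each summand has the wrong length. *)
Lemma contract_det_seq c us : contract (row_form c) det_seq us = 0.
Proof.
have [e|ne] := eqVneq (size us) N.+1; last first.
  apply: contract_eq0 => r e; rewrite /det_seq ifN //.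
  by apply: contraNN ne => /eqP er; rewrite e er.
pose M : 'M[K]_N.+1 := \matrix_(i, j)
  oapp (fun k => nth 0 us i 0 k) (row_form c (nth 0 us i)) (unlift ord0 j).
have ltS (i : 'I_N.+1) : (i < size us)%N by rewrite e.
have detM : \det M = 0.
  pose d : 'cV[K]_N.+1 := \col_j oapp (fun k => - c 0 k) 1 (unlift ord0 j).
  apply/eqP; rewrite -det_tr; apply/det0P; exists d^T.
    apply/eqP => /(congr1 (fun X : 'rV_N.+1 => X 0 ord0)).
    by rewrite !mxE unlift_none /= => /eqP; rewrite oner_eq0.
  apply: trmx_inj; rewrite -trmx_mul trmxK trmx0.
  apply/colP => i; rewrite !mxE big_ord_recl !mxE unlift_none /= mulr1.
  rewrite /row_form -big_split big1 // => k _.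
  by rewrite !mxE liftK /= mulrN addrN.
apply: etrans detM; rewrite (contractE 0) (expand_det_col M ord0) e.
apply: eq_bigr => i _.
rewrite !mxE unlift_none /= /cofactor addn0 /det_seq size_take_drop // e /= eqxx.
rewrite mulrCA; congr (_ * (_ * \det _)).
apply/matrixP => a b; rewrite !mxE liftK /= nth_take_drop //.
Qed.

(** Multiplication by the 2-form with matrix [B]. On alternating [F] only the antisymmetric part of
    [B] is seen, so [B] itself may be any matrix. *)
Definition insert_pair (B : 'M[K]_N) F us : K :=
  \sum_k \sum_k' B k k' * F (us ++ [:: basis_row k; basis_row k']).

Lemma insert_pair_multilinear B F : multilinear F -> multilinear (insert_pair B F).
Proof.
move=> linF us a u v vs; rewrite /insert_pair mulr_sumr -big_split; apply: eq_bigr => k _.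
rewrite mulr_sumr -big_split; apply: eq_bigr => k' _.
by rewrite -!catA /= linF; ring.
Qed.

Lemma insert_pair_alternating B F : alternating F -> alternating (insert_pair B F).
Proof.
move=> altF us u v vs; rewrite /insert_pair -sumrN; apply: eq_bigr => k _.
rewrite -sumrN; apply: eq_bigr => k' _.
by rewrite -!catA /= altF; ring.
Qed.

Lemma row_form_basis c k : row_form c (basis_row k) = c 0 k.
Proof.
rewrite /row_form (bigD1 k) //= mxE !eqxx mul1r big1 ?addr0 // => i ne.
by rewrite mxE (negPf ne) andbF mul0r.
Qed.

(** The antiderivation rule: the contraction removes an entry of [us] or one of the two inserted
    vectors. In the second case the surviving slot holds [c *m B] or [c *m B^T], with opposite
    signs. *)
Lemma contract_insert_pair B c F us : multilinear F ->
  contract (row_form c) (insert_pair B F) us =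
  insert_pair B (contract (row_form c) F) us
  - (-1) ^+ size us * F (us ++ [:: c *m (B - B^T)]).
Proof.
move=> linF; have -> : F (us ++ [:: c *m (B - B^T)]) =
   \sum_k \sum_k' B k k' * (c 0 k * F (us ++ [:: basis_row k'])
      - c 0 k' * F (us ++ [:: basis_row k])).
  rewrite multilinear_basis //.
  under eq_bigr => k _ do rewrite mulmxBr !mxE mulrBl !mulr_suml.
  rewrite sumrB exchange_big /= -sumrB; apply: eq_bigr => k _.
  rewrite -sumrB; apply: eq_bigr => k' _; rewrite mxE; ring.
rewrite /insert_pair contract_sum mulr_sumr -sumrB; apply: eq_bigr => k _.
rewrite contract_sum mulr_sumr -sumrB; apply: eq_bigr => k' _.
by rewrite contractZ contract_cat /= !row_form_basis; ring.
Qed.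

Section Wick.
Variable B : 'M[K]_N.
Let U := B - B^T.

Definition det_pairs h : seq V -> K := iter h (insert_pair B) det_seq.

Lemma det_pairs_multilinear h : multilinear (det_pairs h).
Proof.
elim: h => [|h IH]; first exact: det_seq_multilinear.
exact: insert_pair_multilinear.
Qed.

Lemma det_pairs_alternating h : alternating (det_pairs h).
Proof.
elim: h => [|h IH]; first exact: det_seq_alternating.
exact: insert_pair_alternating.
Qed.

Lemma det_pairs_size h us : (size us + 2 * h != N)%N -> det_pairs h us = 0.
Proof.
elim: h us => [|h IH] us ne; first by rewrite muln0 addn0 in ne; rewrite /= /det_seq ifN.
rewrite /= /insert_pair big1 // => k _; rewrite big1 // => k' _.
rewrite IH ?mulr0 // size_cat /=; lia.
Qed.

(** The determinant itself contributes nothing, and the [h] inserted pairs contribute equally since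
    pairs commute. At [h = 0] the coefficient kills the term with [h.-1]. *)
Lemma contract_det_pairs c h us :
  contract (row_form c) (det_pairs h) us =
  - ((-1) ^+ size us * h%:R * det_pairs h.-1 (us ++ [:: c *m U])).
Proof.
elim: h us => [|h IH] us; first by rewrite contract_det_seq mulr0 mul0r oppr0.
rewrite [det_pairs _]/= contract_insert_pair; last exact: det_pairs_multilinear.
rewrite -/U /= {1}/insert_pair.
have -> : \sum_k \sum_k' B k k' * contract (row_form c) (det_pairs h)
    (us ++ [:: basis_row k; basis_row k']) =
  - ((-1) ^+ size us * h%:R * det_pairs h (us ++ [:: c *m U])).
  case: h IH => [|h] IH.
    rewrite mulr0 mul0r oppr0 big1 // => k _; rewrite big1 // => k' _.
    by rewrite IH mulr0 mul0r oppr0 mulr0.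
  rewrite [det_pairs h.+1 _]/= /insert_pair mulr_sumr -sumrN; apply: eq_bigr => k _.
  rewrite mulr_sumr -sumrN; apply: eq_bigr => k' _.
  rewrite IH /= size_cat /= addn2 !exprS -!catA /=.
  have := alternating_move2 (@det_pairs_alternating h) us (basis_row k) (basis_row k') [:: c *m U] [::].
  by rewrite /= => ->; ring.
by rewrite -natr1; ring.
Qed.

(** The top-degree coefficient of [u_1 ^ .. ^ u_k ^ exp(B)], with [B] read as a 2-form. For a given
    list at most one [h] contributes; the factorial absorbs the factor [h] of [contract_det_pairs],
    so that contraction leads back to the same functional. *)
Definition wick us : K := \sum_(h < N.+1) (h`!%:R)^-1 * det_pairs h us.

Lemma wick_multilinear : multilinear wick.
Proof.
move=> us a u v vs; rewrite /wick mulr_sumr -big_split; apply: eq_bigr => h _.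
by rewrite det_pairs_multilinear /=; ring.
Qed.

Lemma wick_alternating : alternating wick.
Proof.
move=> us u v vs; rewrite /wick -sumrN; apply: eq_bigr => h _.
by rewrite det_pairs_alternating mulrN.
Qed.

Lemma wickE h us : (size us + 2 * h = N)%N -> wick us = (h`!%:R)^-1 * det_pairs h us.
Proof.
move=> e; have lt_h : (h < N.+1)%N by lia.
rewrite /wick (bigD1 (Ordinal lt_h)) //= big1 ?addr0 // => i ne.
by rewrite det_pairs_size ?mulr0 //; move: ne; rewrite -val_eqE /=; lia.
Qed.

Lemma wick_odd us : ~~ odd N -> odd (size us) -> wick us = 0.
Proof.
move=> evN odd_us; rewrite /wick big1 // => h _; rewrite det_pairs_size ?mulr0 //.
by apply: contraNneq evN => <-; rewrite oddD oddM odd_us.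
Qed.

Lemma contract_wick c us :
  contract (row_form c) wick us = - ((-1) ^+ size us * wick (us ++ [:: c *m U])).
Proof.
rewrite contract_sum mulr_sumr -sumrN big_ord_recl contractZ contract_det_pairs.
rewrite mulr0 mul0r oppr0 mulr0 add0r [RHS]big_ord_recr.
(* After the shift of [h] the term [h = N] is left over on the right; it involves more than [N]
   vectors and vanishes. *)
rewrite (@det_pairs_size ord_max) ?size_cat; last by rewrite /=; lia.
rewrite mulr0 mulr0 oppr0 [RHS]addr0; apply: eq_bigr => h _.
rewrite contractZ contract_det_pairs /= /bump /= add1n factS natrM invfM.
have h0 : (h.+1)%:R != 0 :> K by rewrite pnatr_eq0.
by field; rewrite pnatr_eq0 -lt0n fact_gt0 addrC natr1.
Qed.

(** If [c *m U = 0], contracting a single basis vector with [c] gives [c_k * wick [::] = 0] for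
    every [k]. This is how positivity of the partition function yields invertibility of the Gram
    matrix. *)
Lemma wick_nil_unitmx : wick [::] != 0 -> U \in unitmx.
Proof.
apply: contraNT; rewrite -row_free_unit -kermx_eq0 => /rowV0Pn [c /sub_kermxP cU c0].
have [k ck] : exists k, c 0 k != 0.
  by apply/existsP; apply: contraNT c0 => /existsPn H; apply/eqP/rowP => k;
    rewrite mxE; apply/eqP; move: (H k); rewrite negbK.
have := contract_wick c [:: basis_row k]; rewrite cU (multilinear0 wick_multilinear [:: basis_row k]).
rewrite mulr0 oppr0 /= subr0 row_form_basis => /eqP; rewrite mulf_eq0 (negPf ck) /=.
by [].
Qed.

Definition inv_form (u v : V) : K := (u *m (invmx U)^T *m v^T) 0 0.

(* Wick's theorem as a row expansion: [u] is written as [c *m U], and [c] is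
   then contracted against the other arguments. *)
Lemma wick_cons u us : U \in unitmx ->
  wick (u :: us) = contract (inv_form u) wick us.
Proof.
move=> uU; pose c := u *m invmx U.
have UT : U^T = - U by rewrite /U linearB /= trmxK opprB.
have iUT := trmx_invmx_skew UT.
have -> : contract (inv_form u) wick us = - contract (row_form c) wick us.
  rewrite -mulN1r -contractZl; apply: eq_contract => // v.
  rewrite /inv_form iUT mulmxN mulNmx mxE mulN1r; congr (- _).
  by rewrite mxE; apply: eq_bigr => k _; rewrite [v^T _ _]mxE mulrC.
rewrite contract_wick opprK -[c *m U]mulmxA mulVmx // mulmx1.
have := alternating_move wick_alternating [::] u us [::]; rewrite /= cats0 => ->.
by [].
Qed.

End Wick.

End Multilinear.

Lemma lift_perm_bijl n (i : 'I_n.+1) :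
  bijective (fun p : 'I_n.+1 * 'S_n => lift_perm i p.1 p.2).
Proof.
apply: inj_card_bij; last by rewrite card_prod card_ord !card_Sn factS.
move=> [j s] [j' s'] /= e.
have ej : j = j' by rewrite -(lift_perm_id i j s) e lift_perm_id.
rewrite -ej in e *; congr pair; apply/permP => k.
by apply: (@lift_inj _ j); rewrite -!(lift_perm_lift i j) e.
Qed.

Lemma sum_lift_perm (K : nmodType) n (i : 'I_n.+1) (f : 'S_n.+1 -> K) :
  \sum_s f s = \sum_j \sum_s f (lift_perm i j s).
Proof.
rewrite pair_bigA (reindex (fun p : 'I_n.+1 * 'S_n => lift_perm i p.1 p.2)) //.
exact/onW_bij/lift_perm_bijl.
Qed.

Lemma half_dbl_ord n (i : 'I_n) b : half_ord (dbl_ord i b) = i.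
Proof. by apply: val_inj; rewrite /= half_bit_double. Qed.

Lemma odd_dbl_ord n (i : 'I_n) b : odd (dbl_ord i b) = b.
Proof. by rewrite /= oddD odd_double addbF; case: b. Qed.

Lemma dbl_ordK n (i : 'I_n.*2) : dbl_ord (half_ord i) (odd i) = i.
Proof. by apply: val_inj; rewrite /= odd_double_half. Qed.

Lemma dbl_ord_eq n (i j : 'I_n) b c :
  (dbl_ord i b == dbl_ord j c) = (i == j) && (b == c).
Proof.
apply/eqP/andP => [e|[/eqP -> /eqP ->]] //; split; apply/eqP.
  by rewrite -(half_dbl_ord i b) e half_dbl_ord.
by rewrite -(odd_dbl_ord i b) e odd_dbl_ord.
Qed.

(** * Row expansion of the Pfaffian *)

Section Pfaffian.
Variable F : numFieldType.

Definition pf_term n (A : 'M[F]_n.*2) (s : 'S_n.*2) : F :=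
  (-1) ^+ s * \prod_(i < n) A (s (dbl_ord i false)) (s (dbl_ord i true)).

Lemma pfaffian_perm n (A : 'M[F]_n.*2) (t : 'S_n.*2) :
  pfaffian (\matrix_(i, j) A (t i) (t j)) = (-1) ^+ t * pfaffian A.
Proof.
rewrite /pfaffian mulrCA; congr (_ * _); rewrite mulr_sumr.
rewrite [RHS](reindex_inj (mulIg t)) /=; apply: eq_bigr => s _.
have q : (-1) ^+ t * (-1) ^+ t = 1 :> F by rewrite -signr_addb addbb.
rewrite odd_permM signr_addb mulrA [_ * ((-1) ^+ s * _)]mulrCA q mulr1.
by congr (_ * _); apply: eq_bigr => i _; rewrite mxE !permM.
Qed.

Section Expansion.
Variables (n : nat) (A : 'M[F]_(n.+1.*2)).
Hypothesis antiA : A^T = - A.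

(** Exchanging the two entries of one slot changes the sign of the permutation and the sign of one
    matrix entry. *)
Lemma pf_term_flip i s :
  pf_term A (tperm (dbl_ord i false) (dbl_ord i true) * s)%g = pf_term A s.
Proof.
rewrite /pf_term odd_permM odd_tperm dbl_ord_eq eqxx /= signrN mulNr.
rewrite (bigD1 i) //= [in RHS](bigD1 i) //= !permM tpermL tpermR.
have -> : A (s (dbl_ord i true)) (s (dbl_ord i false)) =
   - A (s (dbl_ord i false)) (s (dbl_ord i true)).
  by have /matrixP /(_ (s (dbl_ord i false)) (s (dbl_ord i true))) := antiA; rewrite !mxE.
rewrite mulNr mulrN opprK; congr (_ * (_ * _)); apply: eq_bigr => j ne.
by rewrite !permM !tpermD // dbl_ord_eq eq_sym (negPf ne).
Qed.

(** Exchanging two slots is a product of two transpositions, hence even, and only permutes the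
    factors. *)
Lemma pf_term_swap i j s : i != j ->
  pf_term A (tperm (dbl_ord i false) (dbl_ord j false) *
             (tperm (dbl_ord i true) (dbl_ord j true) * s))%g = pf_term A s.
Proof.
move=> ne; rewrite /pf_term !odd_permM !odd_tperm !dbl_ord_eq !(negPf ne) /= negbK.
rewrite [in RHS](reindex_inj (@perm_inj _ (tperm i j))) /=; congr (_ * _).
have ft (a b : 'I_n.+1) : dbl_ord a false != dbl_ord b true by rewrite dbl_ord_eq andbF.
have tf (a b : 'I_n.+1) : dbl_ord a true != dbl_ord b false by rewrite eq_sym.
have tE k b : (tperm (dbl_ord i false) (dbl_ord j false) *
      (tperm (dbl_ord i true) (dbl_ord j true) * s))%g (dbl_ord k b) =
    s (dbl_ord (tperm i j k) b).
  rewrite !permM; congr (s _); case: (tpermP i j k) => [->|->|ni nj].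
  - by case: b; [rewrite (tpermD (ft _ _) (ft _ _)) tpermL|rewrite tpermL tpermD].
  - by case: b; [rewrite (tpermD (ft _ _) (ft _ _)) tpermR|rewrite tpermR tpermD].
  - by rewrite !tpermD // dbl_ord_eq negb_and (eq_sym _ k) (introN eqP) //.
by apply: eq_bigr => k _; rewrite !tE.
Qed.

(** By the two symmetries of a matching, the position that carries index 0 can be brought to the
    front: first within its slot, then by exchanging slots. *)
Lemma sum_pf_term_at (p : 'I_n.+1.*2) :
  \sum_(s : 'S_n.+1.*2 | s p == ord0) pf_term A s = \sum_(s : 'S_n.+1.*2 | s ord0 == ord0) pf_term A s.
Proof.
have flip i b : \sum_(s : 'S_n.+1.*2 | s (dbl_ord i b) == ord0) pf_term A s =
    \sum_(s : 'S_n.+1.*2 | s (dbl_ord i false) == ord0) pf_term A s.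
  case: b => //.
  rewrite (reindex_inj (mulgI (tperm (dbl_ord i false) (dbl_ord i true)))) /=.
  by apply: eq_big => s; rewrite ?pf_term_flip // permM tpermR.
have ord0E : ord0 = dbl_ord (ord0 : 'I_n.+1) false by apply: val_inj.
rewrite -(dbl_ordK p) flip; move: (half_ord p) => {p} i.
have [->|ne] := eqVneq i ord0; first by rewrite -ord0E.
rewrite (reindex_inj (mulgI (tperm (dbl_ord i false) (dbl_ord ord0 false)))) /=.
rewrite (reindex_inj (mulgI (tperm (dbl_ord i true) (dbl_ord ord0 true)))) /=.
apply: eq_big => s; last by rewrite pf_term_swap.
by rewrite !permM tpermL tpermD ?dbl_ord_eq ?andbF // {2}ord0E.
Qed.

(** All [2 (n + 1)] positions of index 0 contribute equally, and this factor reduces the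
    normalization [2^(n+1) (n+1)!] to [2^n n!]. With 0 in front, its partner [j] remains to be
    chosen, and the rest is a smaller Pfaffian. *)
Lemma pfaffian_expand :
  pfaffian A = \sum_(j < n.*2.+1) (-1) ^+ j *
    (A ord0 (lift ord0 j) * @pfaffian F n (\matrix_(a, b)
       A (lift ord0 (lift j a)) (lift ord0 (lift j b)))).
Proof.
have dblS (i : 'I_n) b : dbl_ord (lift ord0 i) b = lift ord0 (lift ord0 (dbl_ord i b)).
  by apply: val_inj; rewrite /= /bump /= !add1n doubleS !addnS.
have tot : \sum_s pf_term A s = (n.+1.*2)%:R * \sum_(s : 'S_n.+1.*2 | s ord0 == ord0) pf_term A s.
  rewrite (partition_big (fun s : 'S_n.+1.*2 => (s^-1)%g ord0) predT) //=.
  transitivity (\sum_(p < n.+1.*2) \sum_(s : 'S_n.+1.*2 | s ord0 == ord0) pf_term A s).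
    apply: eq_bigr => p _; rewrite -(sum_pf_term_at p); apply: eq_bigl => s.
    by rewrite -(inj_eq (@perm_inj _ s)) permKV eq_sym.
  by rewrite sumr_const card_ord mulr_natl.
have row0 : \sum_(s : 'S_n.+1.*2 | s ord0 == ord0) pf_term A s =
  \sum_(j < n.*2.+1) \sum_(s : 'S_n.*2) pf_term A (lift_perm ord0 ord0 (lift_perm ord0 j s)).
  rewrite big_mkcond /= (sum_lift_perm (ord0 : 'I_n.*2.+2)) /= big_ord_recl.
  rewrite [X in _ + X]big1 ?addr0; last first.
    by move=> j _; rewrite big1 // => s _; rewrite lift_perm_id.
  rewrite -(sum_lift_perm (ord0 : 'I_n.*2.+1)
     (fun s => pf_term A (lift_perm (ord0 : 'I_n.*2.+2) ord0 s))).
  by apply: eq_bigr => s _; rewrite lift_perm_id eqxx.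
rewrite {1}/pfaffian tot row0 mulrA mulr_sumr; apply: eq_bigr => j _.
rewrite /pfaffian mulr_sumr !mulrA !mulr_sumr; apply: eq_bigr => s _.
have -> : pf_term A (lift_perm ord0 ord0 (lift_perm ord0 j s)) =
  (-1) ^+ j * (-1) ^+ s * (A ord0 (lift ord0 j) *
   \prod_(i < n) (\matrix_(a, b) A (lift ord0 (lift j a)) (lift ord0 (lift j b)))
       (s (dbl_ord i false)) (s (dbl_ord i true))).
  rewrite /pf_term !odd_lift_perm /= signr_addb signr_odd; congr (_ * _).
  rewrite big_ord_recl; congr (_ * _).
    have -> : dbl_ord ord0 false = (ord0 : 'I_n.*2.+2) by apply: val_inj.
    have -> : dbl_ord ord0 true = lift (ord0 : 'I_n.*2.+2) ord0 by apply: val_inj.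
    by rewrite lift_perm_lift !lift_perm_id.
  by apply: eq_bigr => i _; rewrite !dblS !lift_perm_lift !mxE.
have -> : ((2 ^ n.+1 * n.+1`!)%:R : F)^-1 * n.+1.*2%:R = (2 ^ n * n`!)%:R^-1.
  rewrite factS expnS -muln2 !natrM.
  have n1 : n.+1%:R != 0 :> F by rewrite pnatr_eq0.
  have f0 : n`!%:R != 0 :> F by rewrite pnatr_eq0 -lt0n fact_gt0.
  have e0 : (2 ^ n)%:R != 0 :> F by rewrite pnatr_eq0 expn_eq0.
  by field; rewrite e0 f0 addrC natr1 n1.
by move: (\prod_(i < n) _) (A _ _) (_^-1) ((-1) ^+ j) ((-1) ^+ s) => p a c d e; ring.
Qed.

End Expansion.

Section PfaffianSeq.
Variables (T : Type) (x0 : T) (M : T -> T -> F).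
Hypothesis antiM : forall a b, M a b = - M b a.

Definition pf_mx (s : seq T) n : 'M[F]_n.*2 :=
  \matrix_(i, j) M (nth x0 s i) (nth x0 s j).

(** The value 0 on lists of odd length lets the row expansion hold for every length. *)
Definition pf_seq (s : seq T) : F :=
  if odd (size s) then 0 else pfaffian (pf_mx s (size s)./2).

Lemma pf_seqE s n : size s = n.*2 -> pf_seq s = pfaffian (pf_mx s n).
Proof. by move=> e; rewrite /pf_seq e odd_double doubleK. Qed.

Lemma pf_seq_odd s : odd (size s) -> pf_seq s = 0.
Proof. by rewrite /pf_seq => ->. Qed.

Lemma pf_seq_cons a s : pf_seq (a :: s) = contract (M a) pf_seq s.
Proof.
case odd_s: (odd (size s)); last first.
  rewrite pf_seq_odd /= ?odd_s // contract_eq0 // => r e.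
  by rewrite pf_seq_odd //; move: odd_s; rewrite e /= => /negbFE.
have e : size s = (size s)./2.*2.+1 by rewrite -[LHS]odd_double_half odd_s.
set n := (size s)./2 in e.
rewrite (@pf_seqE _ n.+1) /= ?e // pfaffian_expand; last first.
  by apply/matrixP => i j; rewrite !mxE antiM.
rewrite (contractE x0) e; apply: eq_bigr => j _; rewrite !mxE /=.
have lt_j : (j < size s)%N by rewrite e.
rewrite (@pf_seqE _ n) ?size_take_drop // ?e //; do 2!congr (_ * _).
congr pfaffian; apply/matrixP => a' b'; rewrite !mxE.
by rewrite (nth_take_drop x0 a' lt_j) (nth_take_drop x0 b' lt_j).
Qed.

Lemma pf_seq_alternating : alternating pf_seq.
Proof.
move=> us u v vs; case odd_s: (odd (size (us ++ [:: u, v & vs]))).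
  rewrite pf_seq_odd // pf_seq_odd ?oppr0 //.
  by move: odd_s; rewrite !size_cat.
set n := (size (us ++ [:: u, v & vs]))./2.
have e : size (us ++ [:: u, v & vs]) = n.*2 by rewrite -[LHS]odd_double_half odd_s.
have e' : size (us ++ [:: v, u & vs]) = n.*2 by rewrite -e !size_cat.
rewrite !(@pf_seqE _ n) //.
have lt1 : (size us < n.*2)%N by rewrite -e size_cat /=; lia.
have lt2 : ((size us).+1 < n.*2)%N by rewrite -e size_cat /=; lia.
pose t := tperm (Ordinal lt1) (Ordinal lt2).
have -> : pf_mx (us ++ [:: u, v & vs]) n =
   \matrix_(i, j) pf_mx (us ++ [:: v, u & vs]) n (t i) (t j).
  suff H (i : 'I_n.*2) : nth x0 (us ++ [:: u, v & vs]) i = nth x0 (us ++ [:: v, u & vs]) (t i).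
    by apply/matrixP => i j; rewrite !mxE !H.
  rewrite /t; case: tpermP => [->|->|/eqP ne1 /eqP ne2] /=.
  - by rewrite !nth_cat ltnn subnn ltnNge leqnSn /= subSn // subnn.
  - by rewrite !nth_cat ltnn subnn ltnNge leqnSn /= subSn // subnn.
  - rewrite !nth_cat; case: ltnP => // le.
    move: ne1 ne2; rewrite -!val_eqE /= => ne1 ne2.
    case d: (i - size us)%N => [|[|k]] //; [move: ne1 | move: ne2]; lia.
by rewrite pfaffian_perm odd_tperm -val_eqE /= neq_ltn ltnSn /= expr1 mulN1r.
Qed.

End PfaffianSeq.
End Pfaffian.

(** * The sign of the Vandermonde product *)

Section SignVandermonde.
Variable R : realDomainType.
Implicit Types (x y : R) (Y : seq R).

Fixpoint sg_vandermonde Y : R :=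
  if Y is x :: Y' then (\prod_(y <- Y') Num.sg (y - x)) * sg_vandermonde Y' else 1.

Lemma sg_vandermonde_alternating : alternating sg_vandermonde.
Proof.
move=> us u v vs; elim: us => [|x us IH] /=.
  by rewrite !big_cons -(opprB v u) sgrN; ring.
by rewrite IH mulrN !big_cat !big_cons /=; congr (- (_ * _)); ring.
Qed.

Lemma sg_vandermonde_sorted Y : sorted <%R Y -> sg_vandermonde Y = 1.
Proof.
elim: Y => //= x Y IH xY; rewrite IH ?(path_sorted xY) // mulr1 big_seq big1 // => y yY.
by rewrite gtr0_sg // subr_gt0; move/(order_path_min lt_trans)/allP: xY; apply.
Qed.

Lemma contract_sg_sorted x Y : sorted <%R Y ->
  contract (fun y => Num.sg (y - x)) sg_vandermonde Y =
  contract (fun y => Num.sg (y - x)) (fun=> 1) Y.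
Proof.
suff H us : sorted <%R (us ++ Y) ->
    contract (fun y => Num.sg (y - x)) (fun r => sg_vandermonde (us ++ r)) Y =
    contract (fun y => Num.sg (y - x)) (fun=> 1) Y by apply: (H [::]).
elim: Y us => //= y Y IH us sY; congr (_ * _ - _).
  apply: sg_vandermonde_sorted; apply: subseq_sorted sY; first exact: lt_trans.
  by rewrite cat_subseq // subseq_cons.
rewrite -(IH (rcons us y)) ?cat_rcons //.
by apply: eq_contract => // r; rewrite cat_rcons.
Qed.

Lemma contract_sg_gt x Y : all (> x) Y ->
  contract (fun y => Num.sg (y - x)) (fun=> 1) Y = (odd (size Y))%:R.
Proof.
elim: Y => //= y Y IH /andP[xy /IH ->].
by rewrite gtr0_sg ?subr_gt0 // mulr1; case: odd; rewrite /= ?subrr ?subr0.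
Qed.

Lemma prod_sg_gt x Y : all (> x) Y -> \prod_(y <- Y) Num.sg (y - x) = 1.
Proof.
move=> /allP gtY; rewrite big_seq big1 // => y /gtY.
by rewrite -subr_gt0 => /gtr0_sg.
Qed.

(* Both sides alternate in [Y], so [Y] may be sorted; entries below [x] are then
   removed in pairs. *)
Lemma sg_vandermonde_cons x Y : odd (size Y) ->
  sg_vandermonde (x :: Y) = contract (fun y => Num.sg (y - x)) sg_vandermonde Y.
Proof.
pose D (Y : seq R) := sg_vandermonde (x :: Y)
  - contract (fun y => Num.sg (y - x)) sg_vandermonde Y.
have altD : alternating D.
  move=> us u v vs; rewrite /D (alternating_cons sg_vandermonde_alternating).
  by rewrite (alternating_contract sg_vandermonde_alternating); ring.
move=> oddY; apply/eqP; rewrite -subr_eq0 -/(D Y); apply/eqP.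
have pY : perm_eq Y (sort <=%R Y) by rewrite perm_sym perm_sort.
apply: (alternating_perm_eq0 altD pY).
have {pY oddY} : odd (size (sort <=%R Y)) by rewrite size_sort.
have : sorted <=%R (sort <=%R Y) by apply: sort_le_sorted.
move: (sort <=%R Y) => {}Y leY oddY.
(* A repeated entry makes the alternating function [D] vanish, so [Y] may be taken strictly
   increasing. *)
have [uY|/negP nuY] := boolP (uniq Y); last first.
  have [a [s pY]] : exists a s, perm_eq Y (a :: a :: s).
    elim: Y nuY {leY oddY} => [|b Y IH] /=; first by case.
    case bY: (b \in Y) => /= H.
      case/splitPr: bY => p1 p2; exists b, (p1 ++ p2).
      by apply/seq.permP => p; rewrite /= !count_cat /=; lia.
    have [a [s pY]] := IH H; exists a, (b :: s).
    by apply/seq.permP => p; move/seq.permP/(_ p): pY => /= ->; lia.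
  apply: (alternating_perm_eq0 altD pY).
  have /eqP := altD [::] a a s; rewrite -subr_eq0 opprK -mulr2n mulrn_eq0 /=.
  by move=> /eqP.
have ltY : sorted <%R Y by rewrite lt_sorted_uniq_le uY.
rewrite /D /= contract_sg_sorted // sg_vandermonde_sorted // mulr1.
apply/eqP; rewrite subr_eq0; apply/eqP; move: oddY ltY {uY leY}.
have [n] := ubnP (size Y); elim: n Y => // n IH [//|y1 [|y2 Y]] szY oddY ltY.
  by rewrite /= big_cons big_nil; ring.
rewrite !big_cons /=.
have ltY' : sorted <%R Y by move: ltY => /= /andP[_ /path_sorted].
have y12 : y1 < y2 by move: ltY => /= /andP[].
have gtY : all (> y2) Y by move: ltY => /= /andP[_ /(order_path_min lt_trans)].
have oddY' : odd (size Y) by move: oddY => /=; rewrite negbK.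
(* If [y2 < x], both leading signs are -1 and drop out of either side. Otherwise every entry of [Y]
   exceeds [x] and the contraction over [Y] is an alternating sum of an odd number of ones, so both
   sides are explicit. *)
case: (ltgtP y2 x) => [lt2|gt2|e2].
- rewrite -IH //; last by move: szY => /=; lia.
  rewrite !ltr0_sg ?subr_lt0 //; last exact: lt_trans lt2.
  ring.
- have gtx : all (> x) Y by apply: sub_all gtY => y; exact: lt_trans.
  rewrite prod_sg_gt // contract_sg_gt // oddY' /= (gtr0_sg (x := y2 - x)) ?subr_gt0 //.
  ring.
- have gtx : all (> x) Y by rewrite -e2.
  rewrite contract_sg_gt // oddY' /= e2 subrr sgr0 ltr0_sg ?subr_lt0 -?e2 //.
  ring.
Qed.

End SignVandermonde.

(** * Integration over tuples *)

Lemma sigma_finite_product d1 d2 (T1 : measurableType d1) (T2 : measurableType d2)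
    (R : realType) (m1 : {sigma_finite_measure set T1 -> \bar R})
    (m2 : {sigma_finite_measure set T2 -> \bar R}) :
  sigma_finite setT (m1 \x m2)%E.
Proof.
have /sigma_finiteP[F [FT ndF Foo]] := sigma_finiteT m1.
have /sigma_finiteP[G [GT ndG Goo]] := sigma_finiteT m2.
exists (fun i => F i `*` G i).
  apply/seteqP; split => // -[x y] _.
  have [i _ Fi] : (\bigcup_i F i) x by rewrite -FT.
  have [j _ Gj] : (\bigcup_i G i) y by rewrite -GT.
  exists (maxn i j) => //; split.
    exact: (subsetPset _ _ (ndF _ _ (leq_maxl i j))).
  exact: (subsetPset _ _ (ndG _ _ (leq_maxr i j))).
move=> i; have [mF Fi] := Foo i; have [mG Gi] := Goo i; split.
  exact: measurableX.
by rewrite product_measure1E // lte_mul_pinfty // ge0_fin_numE.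
Qed.

Section TupleMeasureTheory.
Context d (T : measurableType d) (R : realType).
Variable mu : {sigma_finite_measure set T -> \bar R}.

Definition tcons n (p : T * n.-tuple T) : n.+1.-tuple T := [tuple of p.1 :: p.2].

Lemma measurable_tcons n : measurable_fun setT (@tcons n).
Proof. exact: measurable_cons. Qed.

Definition tuncons n (t : n.+1.-tuple T) : T * n.-tuple T :=
  (thead t, [tuple of behead t]).

Lemma measurable_tuncons n : measurable_fun setT (@tuncons n).
Proof.
apply/measurable_fun_pairP; split; first exact: measurable_tnth.
exact: measurable_behead.
Qed.

Lemma tconsK n : cancel (@tcons n) (@tuncons n).
Proof. by case=> y t; congr pair; apply: val_inj. Qed.

Section Step.
Variables (n : nat) (m : {sigma_finite_measure set (n.-tuple T) -> \bar R}).

Definition tcons_measure : set (n.+1.-tuple T) -> \bar R :=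
  pushforward (mu \x m)%E (@tcons n).

HB.instance Definition _ := Measure.copy tcons_measure
  (measure_function_pushforward__canonical__measure_function_Measure
    (mu \x m)%E (@measurable_tcons n)).

Let tcons_measure_sigma_finite : sigma_finite setT tcons_measure.
Proof.
have [F FT Foo] := sigma_finite_product mu m.
exists (fun i => @tuncons n @^-1` F i).
  apply/seteqP; split => // t _.
  have : setT (tuncons t) by [].
  by rewrite FT => -[i _ Fi]; exists i.
move=> i; have [mF Fi] := Foo i; split.
  by rewrite -[X in measurable X]setTI; exact: measurable_tuncons.
rewrite /tcons_measure /pushforward (_ : _ @^-1` _ = F i) //.
by apply/funext => p; rewrite /preimage /mkset tconsK.
Qed.

HB.instance Definition _ := Measure_isSigmaFinite.Build _ _ _ tcons_measure
  tcons_measure_sigma_finite.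

End Step.

(* [tuple_measure mu n], bundled with its sigma-finiteness. *)
Fixpoint tmeasure n : {sigma_finite_measure set (n.-tuple T) -> \bar R} :=
  if n is k.+1 then tcons_measure (tmeasure k)
  else \d_([tuple] : 0.-tuple T).

Lemma tmeasureE n : tuple_measure mu n = tmeasure n :> (set _ -> \bar R).
Proof. by elim: n => //= n ->. Qed.

Lemma tonelli_tmeasure n (f : n.+1.-tuple T -> \bar R) :
  measurable_fun [set: n.+1.-tuple T] f -> (forall t, 0 <= f t)%E ->
  (\int[tmeasure n.+1]_t f t = \int[mu]_y \int[tmeasure n]_t f (tcons (y, t)))%E.
Proof.
move=> mf f0; rewrite [LHS]ge0_integral_pushforward //; last exact: measurable_tcons.
rewrite preimage_setT (fubini_tonelli1 (f \o @tcons n)) //.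
  by apply: measurableT_comp => //; exact: measurable_tcons.
by move=> p; exact: f0.
Qed.

Lemma tonelli_tmeasure_swap n (f : n.+1.-tuple T -> \bar R) :
  measurable_fun [set: n.+1.-tuple T] f -> (forall t, 0 <= f t)%E ->
  (\int[tmeasure n.+1]_t f t = \int[tmeasure n]_t \int[mu]_y f (tcons (y, t)))%E.
Proof.
move=> mf f0; rewrite [LHS]ge0_integral_pushforward //; last exact: measurable_tcons.
rewrite preimage_setT (fubini_tonelli2 (f \o @tcons n)) //.
  by apply: measurableT_comp => //; exact: measurable_tcons.
by move=> p; exact: f0.
Qed.

Lemma integral_tmeasure0 (f : 0.-tuple T -> \bar R) :
  (\int[tmeasure 0]_t f t = f [tuple])%E.
Proof.
have mf : measurable_fun [set: 0.-tuple T] f.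
  rewrite (_ : f = cst (f [tuple])) //.
  by apply/funext => t; rewrite tuple0.
by rewrite integral_dirac // diracT mul1e.
Qed.

End TupleMeasureTheory.

(** * Complex-valued integrals *)

Section ComplexParts.
Variable R : rcfType.
Implicit Types z c : R[i].
Lemma Re_add z c : complex.Re (z + c) = complex.Re z + complex.Re c.
Proof. by case: z c => a b []. Qed.
Lemma Im_add z c : complex.Im (z + c) = complex.Im z + complex.Im c.
Proof. by case: z c => a b []. Qed.
Lemma Re_mul z c : complex.Re (z * c) =
  complex.Re z * complex.Re c - complex.Im z * complex.Im c.
Proof. by case: z c => a b []. Qed.
Lemma Im_mul z c : complex.Im (z * c) =
  complex.Re z * complex.Im c + complex.Im z * complex.Re c.
Proof. by case: z c => a b []. Qed.
Lemma Re_Im_inj z c : complex.Re z = complex.Re c -> complex.Im z = complex.Im c -> z = c.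
Proof. by case: z c => a b [a' b'] /= -> ->. Qed.
End ComplexParts.

Section ComplexIntegral.
Context d (T : measurableType d) (R : realType) (mu : {measure set T -> \bar R}).
Implicit Types f g : T -> R[i].

Definition cintegrable f :=
  mu.-integrable setT (fun t => (complex.Re (f t))%:E) /\
  mu.-integrable setT (fun t => (complex.Im (f t))%:E).

Local Notation CI := (complex_integral mu setT).

Let scaleE (a b : R) (u v : T -> R) :
  mu.-integrable setT (EFin \o u) -> mu.-integrable setT (EFin \o v) ->
  mu.-integrable setT (fun t => (a * u t + b * v t)%:E) /\
  fine (\int[mu]_t (a * u t + b * v t)%:E) =
    a * fine (\int[mu]_t (u t)%:E) + b * fine (\int[mu]_t (v t)%:E).
Proof.
move=> iu iv.
have iau : mu.-integrable setT (fun t => a%:E * (u t)%:E)%E by exact: integrableZl.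
have ibv : mu.-integrable setT (fun t => b%:E * (v t)%:E)%E by exact: integrableZl.
split.
  by apply: eq_integrable (integrableD measurableT iau ibv).
under eq_integral => t _ do rewrite EFinD !EFinM.
rewrite integralD // !integralZl //.
by rewrite -(fineK (integrable_fin_num measurableT iu)) -(fineK (integrable_fin_num measurableT iv)).
Qed.

Lemma cintegrable_lin a f g : cintegrable f -> cintegrable g ->
  cintegrable (fun t => a * f t + g t).
Proof.
move=> [rf jf] [rg jg]; split.
- have [h _] := scaleE (complex.Re a) (- complex.Im a) rf jf.
  have [k _] := scaleE 1 1 h rg.
  by apply: eq_integrable k => // t _; rewrite /= Re_add Re_mul; congr EFin; ring.
- have [h _] := scaleE (complex.Re a) (complex.Im a) jf rf.
  have [k _] := scaleE 1 1 h jg.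
  by apply: eq_integrable k => // t _; rewrite /= Im_add Im_mul; congr EFin; ring.
Qed.

Lemma cintegral_lin a f g : cintegrable f -> cintegrable g ->
  CI (fun t => a * f t + g t) = a * CI f + CI g.
Proof.
move=> [rf jf] [rg jg]; apply: Re_Im_inj.
- rewrite Re_add Re_mul /=.
  have [h e] := scaleE (complex.Re a) (- complex.Im a) rf jf.
  have [_ e'] := scaleE 1 1 h rg.
  rewrite -mulNr -e -[X in X + _]mul1r -[X in _ + X]mul1r -e'; congr fine.
  by apply: eq_integral => t _; rewrite Re_add Re_mul; congr EFin; ring.
- rewrite Im_add Im_mul /=.
  have [h e] := scaleE (complex.Re a) (complex.Im a) jf rf.
  have [_ e'] := scaleE 1 1 h jg.
  rewrite -e -[X in X + _]mul1r -[X in _ + X]mul1r -e'; congr fine.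
  by apply: eq_integral => t _; rewrite Im_add Im_mul; congr EFin; ring.
Qed.

Lemma cintegrable0 : cintegrable (fun=> 0).
Proof. by split; exact: integrable0. Qed.

Lemma cintegral0 : CI (fun=> 0) = 0.
Proof. by rewrite /complex_integral /= integral0. Qed.

Lemma cintegrableZ a f : cintegrable f -> cintegrable (fun t => a * f t).
Proof.
move=> jf; rewrite (_ : (fun t => _) = (fun t => a * f t + 0)).
  exact: cintegrable_lin cintegrable0.
by apply/funext => t; rewrite addr0.
Qed.

Lemma cintegralZ a f : cintegrable f -> CI (fun t => a * f t) = a * CI f.
Proof.
move=> jf; rewrite -[RHS]addr0 -cintegral0 -cintegral_lin //; last exact: cintegrable0.
by congr (CI _); apply/funext => t; rewrite addr0.
Qed.

Lemma cintegrableD f g : cintegrable f -> cintegrable g ->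
  cintegrable (fun t => f t + g t).
Proof.
move=> jf jg; rewrite (_ : (fun t => _) = (fun t => 1 * f t + g t)).
  exact: cintegrable_lin.
by apply/funext => t; rewrite mul1r.
Qed.

Lemma cintegralD f g : cintegrable f -> cintegrable g ->
  CI (fun t => f t + g t) = CI f + CI g.
Proof.
move=> jf jg; rewrite -[X in X + _]mul1r -cintegral_lin //.
by congr (CI _); apply/funext => t; rewrite mul1r.
Qed.

Lemma cintegrable_sum (I : Type) (r : seq I) (P : pred I) (f : I -> T -> R[i]) :
  (forall i, P i -> cintegrable (f i)) -> cintegrable (fun t => \sum_(i <- r | P i) f i t).
Proof.
move=> jf; elim: r => [|i r IH].
  rewrite (_ : (fun t => _) = fun=> 0); first exact: cintegrable0.
  by apply/funext => t; rewrite big_nil.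
under eq_fun => t do rewrite big_cons.
by case Pi: (P i) => //; apply: cintegrableD => //; exact: jf.
Qed.

Lemma cintegral_sum (I : Type) (r : seq I) (P : pred I) (f : I -> T -> R[i]) :
  (forall i, P i -> cintegrable (f i)) ->
  CI (fun t => \sum_(i <- r | P i) f i t) = \sum_(i <- r | P i) CI (f i).
Proof.
move=> jf; elim: r => [|i r IH].
  rewrite big_nil (_ : (fun t => _) = fun=> 0) ?cintegral0 //.
  by apply/funext => t; rewrite big_nil.
rewrite big_cons -IH; under eq_fun => t do rewrite big_cons.
by case Pi: (P i) => //; rewrite cintegralD //; [exact: jf|exact: cintegrable_sum].
Qed.

Lemma cintegrable_real (f : T -> R) :
  mu.-integrable setT (EFin \o f) -> cintegrable (fun t => (f t)%:C).
Proof. by move=> jf; split=> //=; exact: integrable0. Qed.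

Lemma cintegrable_realE (f : T -> R) :
  cintegrable (fun t => (f t)%:C) -> mu.-integrable setT (EFin \o f).
Proof. by case. Qed.

Lemma cintegral_real (f : T -> R) : mu.-integrable setT (EFin \o f) ->
  (CI (fun t => (f t)%:C)) = (fine (\int[mu]_t (f t)%:E))%:C.
Proof. by move=> jf; rewrite /complex_integral /= integral0. Qed.

Lemma cintegral_ereal (f : T -> R) : cintegrable (fun t => (f t)%:C) ->
  (\int[mu]_t (f t)%:E = (complex.Re (CI (fun t => (f t)%:C)))%:E)%E.
Proof.
by move=> [jf _]; rewrite /= fineK //; exact: integrable_fin_num.
Qed.

(** Positive and negative parts of the real and imaginary parts reduce a statement linear in [f] to
    nonnegative real functions, where Tonelli applies. *)
Lemma cintegrable_ind (P : (T -> R[i]) -> Prop) :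
  (forall a f g, cintegrable f -> cintegrable g -> P f -> P g ->
     P (fun t => a * f t + g t)) ->
  (forall f : T -> R, (forall t, 0 <= f t) -> mu.-integrable setT (EFin \o f) ->
     P (fun t => (f t)%:C)) ->
  forall f, cintegrable f -> P f.
Proof.
move=> Plin Ppos f [rf jf].
have Preal (u : T -> R) : mu.-integrable setT (EFin \o u) -> P (fun t => (u t)%:C).
  move=> ju.
  have jp : mu.-integrable setT (EFin \o u^\+) by exact: integrable_funrpos.
  have jn : mu.-integrable setT (EFin \o u^\-) by exact: integrable_funrneg.
  rewrite (_ : (fun t => _) = fun t => (-1) * (u^\- t)%:C + (u^\+ t)%:C).
    apply: Plin; [exact: cintegrable_real|exact: cintegrable_real|..].
      by apply: Ppos => // t; exact: funrneg_ge0.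
    by apply: Ppos => // t; exact: funrpos_ge0.
  apply/funext => t; rewrite mulN1r addrC -rmorphB; congr (_%:C).
  by have /(congr1 (fun h => h t)) := funrposBneg u.
rewrite (_ : f = fun t => 'i * (complex.Im (f t))%:C + (complex.Re (f t))%:C).
  by apply: Plin; [exact: cintegrable_real|exact: cintegrable_real|exact: Preal|exact: Preal].
by apply/funext => t; rewrite [LHS]complexE addrC.
Qed.

End ComplexIntegral.

Lemma select_sumE (T : Type) (K : comNzRingType) (x0 : T) (h : T -> seq T -> K) us :
  select_sum h us =
  \sum_(i < size us) h (nth x0 us i) (take i us ++ drop i.+1 us).
Proof.
elim: us h => [|u us IH] h /=; first by rewrite big_ord0.
by rewrite big_ord_recl /= drop0 IH.
Qed.

Section ProductFunctions.
Context d1 d2 d3 (T1 : measurableType d1) (T2 : measurableType d2)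
  (T3 : measurableType d3) (R : realType).
Variables (m1 : {measure set T1 -> \bar R}) (m2 : {measure set T2 -> \bar R})
  (m3 : {measure set T3 -> \bar R}) (p1 : T3 -> T1) (p2 : T3 -> T2).
Hypotheses (mp1 : measurable_fun setT p1) (mp2 : measurable_fun setT p2).
Hypothesis ge0_integral_p12 : forall (g : T1 -> \bar R) (h : T2 -> \bar R),
  measurable_fun setT g -> (forall y, 0 <= g y)%E ->
  measurable_fun setT h -> (forall t, 0 <= h t)%E ->
  (\int[m3]_t (g (p1 t) * h (p2 t)) = (\int[m1]_y g y) * (\int[m2]_t h t))%E.

(** One induction by [cintegrable_ind] for each factor. The space and the two projections stay
    abstract because the lemma serves three times: for a product of two measures, for the removal of
    one coordinate of a tuple, and for the removal of two. *)
Lemma cintegral_product (g : T1 -> R[i]) (h : T2 -> R[i]) :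
  cintegrable m1 g -> cintegrable m2 h ->
  cintegrable m3 (fun t => g (p1 t) * h (p2 t)) /\
  complex_integral m3 setT (fun t => g (p1 t) * h (p2 t)) =
  complex_integral m1 setT g * complex_integral m2 setT h.
Proof.
move=> ig ih; move: g ig h ih.
apply: (@cintegrable_ind _ _ _ _ (fun g => forall h, cintegrable m2 h ->
  cintegrable m3 (fun t => g (p1 t) * h (p2 t)) /\
  complex_integral m3 setT (fun t => g (p1 t) * h (p2 t)) =
  complex_integral m1 setT g * complex_integral m2 setT h)).
  move=> a f g jf jg Pf Pg h jh; have [i1 e1] := Pf h jh; have [i2 e2] := Pg h jh.
  have -> : (fun t => (a * f (p1 t) + g (p1 t)) * h (p2 t)) =
     (fun t => a * (f (p1 t) * h (p2 t)) + g (p1 t) * h (p2 t)).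
    by apply/funext => t; rewrite mulrDl mulrA.
  split; first exact: cintegrable_lin.
  by rewrite !cintegral_lin // e1 e2; ring.
move=> g g0 jg.
apply: (@cintegrable_ind _ _ _ _ (fun h =>
  cintegrable m3 (fun t => (g (p1 t))%:C * h (p2 t)) /\
  complex_integral m3 setT (fun t => (g (p1 t))%:C * h (p2 t)) =
  complex_integral m1 setT (fun y => (g y)%:C) * complex_integral m2 setT h)).
  move=> a f h jf jh [i1 e1] [i2 e2].
  have -> : (fun t => (g (p1 t))%:C * (a * f (p2 t) + h (p2 t))) =
     (fun t => a * ((g (p1 t))%:C * f (p2 t)) + (g (p1 t))%:C * h (p2 t)).
    by apply/funext => t; rewrite mulrDr mulrCA.
  split; first exact: cintegrable_lin.
  by rewrite !cintegral_lin // e1 e2; ring.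
move=> h h0 jh.
have mg := measurable_int _ jg; have mh := measurable_int _ jh.
have E : (\int[m3]_t (g (p1 t) * h (p2 t))%:E =
    (\int[m1]_y (g y)%:E) * (\int[m2]_t (h t)%:E))%E.
  by rewrite -(ge0_integral_p12 mg _ mh).
have jgh : m3.-integrable setT (fun t => (g (p1 t) * h (p2 t))%:E).
  apply/integrableP; split.
    apply/measurable_EFinP; apply: measurable_funM.
      by apply: measurableT_comp => //; exact/measurable_EFinP.
    by apply: measurableT_comp => //; exact/measurable_EFinP.
  under eq_integral => t _ do rewrite gee0_abs ?lee_fin ?mulr_ge0 //.
  by rewrite E ltey_eq fin_numM // integrable_fin_num.
have -> : (fun t => (g (p1 t))%:C * (h (p2 t))%:C) = (fun t => (g (p1 t) * h (p2 t))%:C).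
  by apply/funext => t; rewrite rmorphM.
split; first exact: cintegrable_real.
by rewrite !cintegral_real // E fineM ?integrable_fin_num // rmorphM.
Qed.

End ProductFunctions.

(** * Integrals over tuples with chosen coordinates split off *)

Section TupleDelete.
Context d (T : measurableType d) (R : realType).
Variable mu : {sigma_finite_measure set T -> \bar R}.

Definition tdel n (i : 'I_n.+1) (t : n.+1.-tuple T) : n.-tuple T :=
  [tuple tnth t (lift i j) | j < n].

Lemma measurable_tdel n (i : 'I_n.+1) : measurable_fun [set: n.+1.-tuple T] (tdel i).
Proof.
apply/measurable_fun_tnthP => j.
rewrite (_ : _ \o _ = (fun t : n.+1.-tuple T => tnth t (lift i j))).
  exact: measurable_tnth.
by apply/funext => t /=; rewrite tnth_mktuple.
Qed.

Lemma tdelE n (i : 'I_n.+1) (t : n.+1.-tuple T) :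
  tdel i t = take i t ++ drop i.+1 t :> seq T.
Proof.
have lt_i : (i < size t)%N by rewrite size_tuple.
apply: (@eq_from_nth _ (tnth t i)); first by rewrite size_take_drop // !size_tuple.
move=> j; rewrite size_tuple => lt_j.
move: (tnth t i) => x0.
have -> : nth x0 (tdel i t) j = tnth (tdel i t) (Ordinal lt_j) by rewrite (tnth_nth x0).
by rewrite nth_take_drop // tnth_mktuple (tnth_nth x0).
Qed.

Lemma tdel0 n (y : T) (t : n.-tuple T) : tdel ord0 (tcons (y, t)) = t.
Proof. by apply: val_inj; rewrite /= [LHS]tdelE /= drop0. Qed.

Lemma tdelS n (i : 'I_n.+1) (y : T) (t : n.+1.-tuple T) :
  tdel (lift ord0 i) (tcons (y, t)) = tcons (y, tdel i t).
Proof. by apply: val_inj; rewrite /= [LHS]tdelE /= /bump /= add1n /= tdelE. Qed.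

Lemma tnth_tcons0 n (y : T) (t : n.-tuple T) : tnth (tcons (y, t)) ord0 = y.
Proof. by rewrite (tnth_nth y). Qed.

Lemma tnth_tconsS n (i : 'I_n) (y : T) (t : n.-tuple T) :
  tnth (tcons (y, t)) (lift ord0 i) = tnth t i.
Proof. by rewrite !(tnth_nth y). Qed.

Local Notation tm := (tmeasure mu).

(** Coordinate [i] is reached by peeling off the earlier coordinates one at a time with Tonelli,
    instead of permuting the coordinates. *)
Lemma ge0_integral_tdel n (i : 'I_n.+1) (g : T -> \bar R) (H : n.-tuple T -> \bar R) :
  measurable_fun setT g -> (forall y, 0 <= g y)%E ->
  measurable_fun [set: n.-tuple T] H -> (forall t, 0 <= H t)%E ->
  (\int[tm n.+1]_t (g (tnth t i) * H (tdel i t)) =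
   (\int[mu]_y g y) * (\int[tm n]_t H t))%E.
Proof.
move=> mg g0; elim: n i H => [|n IH] i H mH H0.
  rewrite tonelli_tmeasure //; last 2 first.
  - apply: emeasurable_funM.
      apply: (measurableT_comp mg); exact: measurable_tnth.
    apply: (measurableT_comp mH); exact: measurable_tdel.
  - by move=> t; exact: mule_ge0.
  rewrite ord1 integral_tmeasure0.
  under eq_integral => y _ do rewrite integral_tmeasure0 tnth_tcons0 tdel0.
  by rewrite ge0_integralZr.
have mgH (k : 'I_n.+2) :
    measurable_fun [set: n.+2.-tuple T] (fun t => g (tnth t k) * H (tdel k t))%E.
  apply: emeasurable_funM.
    apply: (measurableT_comp mg); exact: measurable_tnth.
  apply: (measurableT_comp mH); exact: measurable_tdel.
rewrite tonelli_tmeasure //; last by move=> t; exact: mule_ge0.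
case: (unliftP ord0 i) => [j|] ->.
  have mHy y : measurable_fun [set: n.-tuple T] (fun t => H (tcons (y, t))).
    apply: (measurableT_comp mH).
    by apply: (@measurable_cons _ _ _ _ (cst y) _ id); [exact: measurable_cst|exact: measurable_id].
  transitivity (\int[mu]_y ((\int[mu]_y g y) * \int[tm n]_t H (tcons (y, t))))%E.
    apply: eq_integral => y _; rewrite -(IH j) //.
    by apply: eq_integral => t _; rewrite tnth_tconsS tdelS.
  rewrite ge0_integralZl ?tonelli_tmeasure //.
  - apply: (@measurable_fun_fubini_tonelli_F _ _ _ _ _ (tm n) (H \o @tcons _ T n)).
      by apply: (measurableT_comp mH); exact: measurable_tcons.
    by move=> p; exact: H0.
  - by move=> y _; apply: integral_ge0 => t _; exact: H0.
  - by apply: integral_ge0.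
transitivity (\int[mu]_y (g y * \int[tm n.+1]_t H t))%E.
  apply: eq_integral => y _; rewrite -ge0_integralZl //.
  by apply: eq_integral => t _; rewrite tnth_tcons0 tdel0.
by rewrite ge0_integralZr // integral_ge0.
Qed.

Lemma cintegral_tdel n (i : 'I_n.+1) (g : T -> R[i]) (H : n.-tuple T -> R[i]) :
  cintegrable mu g -> cintegrable (tm n) H ->
  cintegrable (tm n.+1) (fun t => g (tnth t i) * H (tdel i t)) /\
  complex_integral (tm n.+1) setT (fun t => g (tnth t i) * H (tdel i t)) =
  complex_integral mu setT g * complex_integral (tm n) setT H.
Proof.
apply: cintegral_product; [exact: measurable_tnth|exact: measurable_tdel|].
by move=> g0 h0 *; exact: ge0_integral_tdel.
Qed.

Lemma cintegral_tcons n (g : T -> R[i]) (H : n.-tuple T -> R[i]) :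
  cintegrable mu g -> cintegrable (tm n) H ->
  cintegrable (tm n.+1) (fun t => g (thead t) * H (tdel ord0 t)) /\
  complex_integral (tm n.+1) setT (fun t => g (thead t) * H (tdel ord0 t)) =
  complex_integral mu setT g * complex_integral (tm n) setT H.
Proof. exact: cintegral_tdel. Qed.

Lemma cintegral_select_sum n (g : T -> R[i]) (H : seq T -> R[i]) :
  cintegrable mu g -> cintegrable (tm n) (fun t => H t) ->
  cintegrable (tm n.+1) (fun t => select_sum (fun y r => g y * H r) t) /\
  complex_integral (tm n.+1) setT (fun t => select_sum (fun y r => g y * H r) t) =
  n.+1%:R * (complex_integral mu setT g * complex_integral (tm n) setT (fun t => H t)).
Proof.
move=> jg jH.
have -> : (fun t : n.+1.-tuple T => select_sum (fun y r => g y * H r) t) =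
   (fun t => \sum_(i < n.+1) g (tnth t i) * H (tdel i t)).
  apply/funext => t; rewrite (select_sumE (thead t)) size_tuple.
  by apply: eq_bigr => i _; rewrite -tnth_nth tdelE.
split.
  by apply: cintegrable_sum => i _; have [] := cintegral_tdel i jg jH.
rewrite cintegral_sum; last by move=> i _; have [] := cintegral_tdel i jg jH.
under eq_bigr => i _ do rewrite (cintegral_tdel i jg jH).2.
by rewrite sumr_const card_ord mulr_natl.
Qed.

Lemma cintegral_tensor (g h : T -> R[i]) : cintegrable mu g -> cintegrable mu h ->
  cintegrable (mu \x mu)%E (fun p : T * T => g p.1 * h p.2).
Proof.
move=> jg jh; have [] // := @cintegral_product _ _ _ _ _ (T * T)%type _ mu mu
  (mu \x mu)%E fst snd measurable_fst measurable_snd _ g h jg jh.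
move=> {jg jh}g {}h mg g0 mh h0.
rewrite (fubini_tonelli1 (fun p => g p.1 * h p.2)%E).
- rewrite /fubini_F /=; under eq_integral => x _ do rewrite ge0_integralZl //.
  by rewrite ge0_integralZr // integral_ge0.
- by apply: emeasurable_funM; apply: measurableT_comp.
- by move=> p; exact: mule_ge0.
Qed.

Definition thead2 n (i : 'I_n.+1) (t : n.+2.-tuple T) : T * T :=
  (thead t, tnth t (lift ord0 i)).

Definition tdel2 n (i : 'I_n.+1) (t : n.+2.-tuple T) : n.-tuple T :=
  tdel i (tdel ord0 t).

Lemma cintegral_tdel2 n (i : 'I_n.+1) (k : T * T -> R[i]) (H : n.-tuple T -> R[i]) :
  cintegrable (mu \x mu)%E k -> cintegrable (tm n) H ->
  cintegrable (tm n.+2) (fun t => k (thead2 i t) * H (tdel2 i t)) /\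
  complex_integral (tm n.+2) setT (fun t => k (thead2 i t) * H (tdel2 i t)) =
  complex_integral (mu \x mu)%E setT k * complex_integral (tm n) setT H.
Proof.
have m1 : measurable_fun setT (@thead2 n i).
  by apply/measurable_fun_pairP; split; exact: measurable_tnth.
have m2 : measurable_fun setT (@tdel2 n i).
  by apply: (measurableT_comp (measurable_tdel i)); exact: measurable_tdel.
apply: cintegral_product => // g h mg g0 mh h0.
rewrite tonelli_tmeasure; last 2 first.
- by apply: emeasurable_funM; exact: measurableT_comp.
- by move=> t; exact: mule_ge0.
rewrite (fubini_tonelli1 g) // /fubini_F -ge0_integralZr //.
- apply: eq_integral => x _.
  rewrite -(ge0_integral_tdel i (g := fun y => g (x, y)) (H := h)) //.
    by apply: eq_integral => t _; rewrite /thead2 /tdel2 tnth_tconsS tdel0 theadE.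
  by apply: (measurableT_comp mg); exact: pair1_measurable.
- exact: measurable_fun_fubini_tonelli_F.
- by move=> x _; apply: integral_ge0.
- by apply: integral_ge0.
Qed.

Lemma cintegral_select_sum2 n (k : T * T -> R[i]) (H : seq T -> R[i]) :
  cintegrable (mu \x mu)%E k -> cintegrable (tm n) (fun t => H t) ->
  cintegrable (tm n.+2)
    (fun t => select_sum (fun y r => k (thead t, y) * H r) (behead t)) /\
  complex_integral (tm n.+2) setT
    (fun t => select_sum (fun y r => k (thead t, y) * H r) (behead t)) =
  n.+1%:R * (complex_integral (mu \x mu)%E setT k *
             complex_integral (tm n) setT (fun t => H t)).
Proof.
move=> jk jH.
have -> : (fun t : n.+2.-tuple T =>
      select_sum (fun y r => k (thead t, y) * H r) (behead t)) =
   (fun t => \sum_(i < n.+1) k (thead2 i t) * H (tdel2 i t)).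
  apply/funext => t; rewrite -[behead t]/(val (behead_tuple t)) /=.
  rewrite (select_sumE (thead t)) size_behead size_tuple /=.
  have e : tdel ord0 t = behead t :> seq T by rewrite tdelE /= take0 drop1.
  apply: eq_bigr => i _; rewrite /tdel2 tdelE e /thead2 nth_behead.
  by rewrite (tnth_nth (thead t) t (lift ord0 i)).
split.
  by apply: cintegrable_sum => i _; have [] := cintegral_tdel2 i jk jH.
rewrite cintegral_sum; last by move=> i _; have [] := cintegral_tdel2 i jk jH.
under eq_bigr => i _ do rewrite (cintegral_tdel2 i jk jH).2.
by rewrite sumr_const card_ord mulr_natl.
Qed.

Let fubini_real (f : T * T -> R) :
  (mu \x mu)%E.-integrable setT (EFin \o f) ->
  (forall x, mu.-integrable setT (fun y => (f (x, y))%:E)) ->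
  mu.-integrable setT (fun x => (fine (\int[mu]_y (f (x, y))%:E))%:E) /\
  (\int[mu \x mu]_p (f p)%:E = \int[mu]_x (fine (\int[mu]_y (f (x, y))%:E))%:E)%E.
Proof.
move=> jf js.
have -> : (fun x => (fine (\int[mu]_y (f (x, y))%:E))%:E) = fubini_F mu (EFin \o f).
  by apply/funext => x; rewrite fineK // integrable_fin_num.
by split; [exact: integrable_fubini_F|rewrite integral12_prod_meas1].
Qed.

(** Integrability is required of every slice, not only of almost every one: the inner integral is
    taken through [fine] and then agrees everywhere with the extended-real one. *)
Lemma cintegral_iterated (k : T * T -> R[i]) : cintegrable (mu \x mu)%E k ->
  (forall x, cintegrable mu (fun y => k (x, y))) ->
  cintegrable mu (fun x => complex_integral mu setT (fun y => k (x, y))) /\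
  complex_integral (mu \x mu)%E setT k =
  complex_integral mu setT (fun x => complex_integral mu setT (fun y => k (x, y))).
Proof.
move=> [jr ji] js.
have [r1 r2] := fubini_real jr (fun x => (js x).1).
have [i1 i2] := fubini_real ji (fun x => (js x).2).
by split; [split|rewrite /complex_integral r2 i2].
Qed.

End TupleDelete.

Lemma eq_contract_size (T : Type) (K : comNzRingType) (f : T -> K) (F G : seq T -> K) us :
  (forall r, size us = (size r).+1 -> F r = G r) -> contract f F us = contract f G us.
Proof.
elim: us F G => //= u us IH F G FG; rewrite FG // (IH _ (fun r => G (u :: r))) //.
by move=> r e; rewrite FG //= e.
Qed.

Lemma contract_map (T T' : Type) (K : comNzRingType) (p : T -> T') (f : T' -> K)
    (F : seq T' -> K) us :
  contract f F (map p us) = contract (f \o p) (F \o map p) us.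
Proof. by elim: us F => //= u us IH F; rewrite IH. Qed.

Section InverseForm.
Variables (K : numFieldType) (N : nat) (B : 'M[K]_N).

Lemma inv_form_anti (u v : 'rV[K]_N) : inv_form B u v = - inv_form B v u.
Proof.
set U := B - B^T; have UT : U^T = - U by rewrite /U linearB /= trmxK opprB.
have iUT := trmx_invmx_skew UT.
transitivity (((u *m (invmx U)^T *m v^T)^T) 0 0); first by rewrite [RHS]mxE.
by rewrite !trmx_mul !trmxK /inv_form -/U iUT mulmxN mulNmx mulmxA [X in - X]mxE opprK.
Qed.

End InverseForm.

(** * The recursion solved by the Pfaffian *)

Section TaggedPfaffian.
Variables (K : numFieldType) (R : realDomainType) (iota : {rmorphism R -> K}).
Variables (N : nat) (B : 'M[K]_N) (v eps : R -> 'rV[K]_N).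
Hypotheses (N_even : ~~ odd N) (unitB : B - B^T \in unitmx).
Notation V := 'rV[K]_N.

(* A tag [Some x] marks a vector that interacts with the other tagged vectors
   through the kernel [sgn (x - y) / 2]. *)
Definition tag_form (a b : option R) : K :=
  if a is Some x then if b is Some y then 2^-1 * iota (Num.sg (x - y)) else 0 else 0.

(** On the vectors attached to the points, the first summand gives the entries [DS], [S] and [IS];
    the second is the term [E], present only between the epsilon vectors of two real points. *)
Definition tagged_form (a b : V * option R) : K :=
  2 * inv_form B a.1 b.1 + tag_form a.2 b.2.

Lemma tagged_form_anti a b : tagged_form a b = - tagged_form b a.
Proof.
rewrite /tagged_form inv_form_anti opprD mulrN; congr (_ + _).
case: a.2 b.2 => [x|] [y|] //=; rewrite ?oppr0 //.
by rewrite -opprB sgrN rmorphN mulrN.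
Qed.

Definition untagged (u : V) : V * option R := (u, None).
Definition real_pair x : seq (V * option R) := [:: untagged (v x); (eps x, Some x)].
Definition real_pairs X := flatten [seq real_pair x | x <- X].

Definition tagged_pf := pf_seq (untagged 0) tagged_form.

Lemma size_real_pairs X : size (real_pairs X) = (size X).*2.
Proof. by elim: X => //= x X IH; rewrite -/(real_pairs X) IH. Qed.

Lemma real_pairs_cat X Y : real_pairs (X ++ Y) = real_pairs X ++ real_pairs Y.
Proof. by rewrite /real_pairs map_cat flatten_cat. Qed.

Lemma tagged_pf_cons a s : tagged_pf (a :: s) = contract (tagged_form a) tagged_pf s.
Proof. exact/pf_seq_cons/tagged_form_anti. Qed.

Lemma tagged_pf_alternating : alternating tagged_pf.
Proof. exact/pf_seq_alternating. Qed.

Lemma tagged_pf_nil : tagged_pf [::] = 1.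
Proof.
rewrite /tagged_pf /pf_seq /pfaffian /=.
have -> : (2 ^ 0 * 0`!)%:R^-1 = 1 :> K by rewrite invr1.
rewrite (eq_bigr (fun=> 1)) => [|s _].
  by rewrite sumr_const card_Sn mulr1n mul1r.
by rewrite big_ord0 mulr1 (_ : s = 1%g) ?odd_perm1 //; apply/permP => -[].
Qed.

(** Without tags the Pfaffian and the Wick functional have the same row expansion, except that each
    Pfaffian entry carries a factor 2; there are [(size st)./2] entries in a term. *)
Lemma tagged_pf_untagged st :
  2 ^+ (size st)./2 * wick B st = wick B [::] * tagged_pf (map untagged st).
Proof.
have [n] := ubnP (size st); elim: n st => // n IH [_|u us].
  by rewrite tagged_pf_nil mulr1 expr0 mul1r.
rewrite ltnS => lt_n; case odd_us: (odd (size us)); last first.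
  rewrite wick_odd //= ?odd_us // /tagged_pf pf_seq_odd ?mulr0 //.
  by rewrite /= size_map odd_us.
rewrite tagged_pf_cons wick_cons // contract_map -!contractZ.
transitivity (contract (fun w => 2 * inv_form B u w)
    (fun r => 2 ^+ (size r)./2 * wick B r) us).
  rewrite contractZl -contractZ; apply: eq_contract_size => r e.
  move: odd_us; rewrite /= e /= => /negbTE odd_r.
  by rewrite exprS mulrA.
transitivity (contract (tagged_form (untagged u) \o untagged)
    (fun r => 2 ^+ (size r)./2 * wick B r) us).
  by apply: eq_contract => // w; rewrite /tagged_form /= addr0.
apply: eq_contract_size => r e; apply: IH; move: lt_n; rewrite /= e; exact: ltnW.
Qed.

(** Since [f] kills untagged vectors, only a tagged entry can be removed. It stands second in its
    pair, hence the minus sign, and leaves its partner [v y] behind, untagged. *)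
Lemma contract_real_pairs (f : V * option R -> K) F h X st :
  (forall u, f (untagged u) = 0) ->
  (forall us y ws, size X = (size us + size ws).+1 ->
    F (real_pairs us ++ untagged (v y) :: real_pairs ws ++ map untagged st)
    = h y (us ++ ws)) ->
  contract f F (real_pairs X ++ map untagged st) =
  - select_sum (fun y r => f (eps y, Some y) * h y r) X.
Proof.
move=> f0; elim: X F h => [|x X IH] F h Fh.
  rewrite oppr0 /= contract_map (eq_contract (g := fun=> 0) (G := F \o map untagged)) //.
  by rewrite contract0l.
rewrite /= -/(real_pairs X) f0 mul0r sub0r opprB (Fh [::] x X) //=.
rewrite (IH _ (fun y r => h y (x :: r))); first by ring.
move=> us y ws e; have := Fh (x :: us) y ws; rewrite /= e; exact.
Qed.

Lemma tagged_pf_pull x us y ws st :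
  tagged_pf (untagged (v x) :: real_pairs us ++ untagged (v y) :: real_pairs ws ++ map untagged st)
  = tagged_pf (real_pairs (us ++ ws) ++ map untagged [:: v x, v y & st]).
Proof.
have := alternating_pull tagged_pf_alternating (untagged (v x)) (real_pairs us)
  (untagged (v y)) (real_pairs ws) (map untagged st).
rewrite -!catA /= size_real_pairs -signr_odd odd_double mul1r => ->.
by rewrite real_pairs_cat -!catA.
Qed.

(** Expansion along the row of the tagged vector of [x]. The part with [inv_form] reassembles to the
    Pfaffian in which that vector has lost its tag; the part with the sign kernel matches [x] with
    another real point [y] and frees both [v x] and [v y]. *)
Lemma tagged_pf_real_pairs_cons x X st :
  tagged_pf (real_pairs (x :: X) ++ map untagged st) =
  tagged_pf (real_pairs X ++ map untagged [:: v x, eps x & st]) +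
  select_sum (fun y r => (2^-1 * iota (Num.sg (y - x))) *
    tagged_pf (real_pairs r ++ map untagged [:: v x, v y & st])) X.
Proof.
rewrite /= -/(real_pairs X); set rest := real_pairs X ++ _.
have swap a b : tagged_pf [:: a, b & rest] = - tagged_pf [:: b, a & rest].
  exact: (tagged_pf_alternating [::]).
rewrite swap tagged_pf_cons /tagged_form contractDl opprD; congr (_ + _).
  have -> : contract (fun b : V * option R => 2 * inv_form B (eps x, Some x).1 b.1) tagged_pf
      (untagged (v x) :: rest) = tagged_pf [:: untagged (eps x), untagged (v x) & rest].
    rewrite tagged_pf_cons; apply: eq_contract => // b.
    by rewrite /tagged_form /= addr0.
  rewrite -swap /rest.
  exact: (alternating_move2 tagged_pf_alternating [::]).
rewrite /= mul0r sub0r opprK /rest.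
rewrite (contract_real_pairs (h := fun y r =>
  tagged_pf (real_pairs r ++ map untagged [:: v x, v y & st]))) //; last first.
  by move=> us y ws _; rewrite tagged_pf_pull.
rewrite -mulN1r -select_sumZ; apply: eq_select_sum => y r _ /=.
by rewrite -opprB sgrN rmorphN; ring.
Qed.

Variable S : seq R -> seq V -> K.
Hypothesis S_nil : forall st, ~~ odd (size st) -> S [::] st = wick B st.
Hypothesis S_cons : forall x X st, ~~ odd (size st) ->
  S (x :: X) st =
  select_sum (fun y r => iota (Num.sg (y - x)) * S r [:: v x, v y & st]) X
  + 2 * S X [:: v x, eps x & st].

(** Two more vectors in [st] raise the power of 2 by one. This accounts for the 2 before the [eps]
    term of [S_cons], and it turns the coefficient 1 of the sign there into the [2^-1] of
    [tag_form]. *)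
Lemma correlation_tagged_pf X st : ~~ odd (size st) ->
  2 ^+ (size st)./2 * S X st =
  wick B [::] * tagged_pf (real_pairs X ++ map untagged st).
Proof.
have [n] := ubnP (size X); elim: n X st => // n IH [|x X] st.
  by move=> _ ev; rewrite S_nil // tagged_pf_untagged.
rewrite ltnS => lt_n ev; rewrite S_cons // tagged_pf_real_pairs_cons.
have ev2 u w : ~~ odd (size [:: u, w & st]) by rewrite /= negbK.
rewrite !mulrDr addrC -(IH X [:: v x, eps x & st]) //.
rewrite [(size [:: v x, eps x & st])./2]/= exprS; congr (_ + _); first by ring.
rewrite -!select_sumZ; apply: eq_select_sum => y r e.
rewrite mulrCA (mulrCA (wick _ _)) -(IH r [:: v x, v y & st]) //; last by rewrite -ltnS -e; exact: leq_trans lt_n _.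
rewrite [(size [:: v x, v y & st])./2]/= exprS.
by field.
Qed.

End TaggedPfaffian.

(** * Integrating out the real points *)

Lemma cintegrableM_bounded d (T : measurableType d) (R : realType)
    (mu : {measure set T -> \bar R}) (f : T -> R[i]) (h : T -> R) :
  cintegrable mu f -> measurable_fun setT h -> (forall t, `|h t| <= 1) ->
  cintegrable mu (fun t => f t * (h t)%:C).
Proof.
move=> [jr ji] mh h1.
have H (u : T -> R) : mu.-integrable setT (fun t => (u t)%:E) ->
    mu.-integrable setT (fun t => (u t * h t)%:E).
  move=> ju; apply: (le_integrable measurableT _ _ ju) => //.
    apply/measurable_EFinP; apply: measurable_funM => //.
    by apply/measurable_EFinP; exact: (measurable_int _ ju).
  by move=> t _; rewrite /= lee_fin normrM ler_piMr.
split.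
- by under eq_fun => t do rewrite Re_mul /= mulr0 subr0; exact: H.
- by under eq_fun => t do rewrite Im_mul /= mulr0 add0r; exact: H.
Qed.

Lemma measurable_sg (R : realType) : measurable_fun setT (@Num.sg R).
Proof.
rewrite (_ : Num.sg = fun x : R => if 0 < x then 1 else if x < 0 then -1 else 0).
  by apply: measurable_fun_ifT => //; [|apply: measurable_fun_ifT => //]; exact: measurable_fun_ltr.
by apply/funext => x; case: sgrP.
Qed.

Lemma normr_sg_le1 (R : realType) (x : R) : `|Num.sg x| <= 1.
Proof. by rewrite normr_sg; case: (x != 0). Qed.

Lemma contract_rmorph (T : Type) (K L : comNzRingType) (phi : {rmorphism K -> L})
    (f : T -> K) (G : seq T -> K) Y :
  phi (contract f G Y) = contract (phi \o f) (phi \o G) Y.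
Proof.
elim: Y G => /= [|y Y IH] G; first exact: rmorph0.
by rewrite rmorphB rmorphM /= IH.
Qed.

Section SelectSumIntegral.
Context d (T : measurableType d) (R : realType) (mu : {measure set T -> \bar R}).

Lemma cintegral_select_sum_fun (I : Type) (h : I -> seq I -> T -> R[i]) X :
  (forall y r, size X = (size r).+1 -> cintegrable mu (h y r)) ->
  cintegrable mu (fun t => select_sum (fun y r => h y r t) X) /\
  complex_integral mu setT (fun t => select_sum (fun y r => h y r t) X) =
  select_sum (fun y r => complex_integral mu setT (h y r)) X.
Proof.
elim: X h => [|x X IH] h jh /=; first by split; [exact: cintegrable0|exact: cintegral0].
have [i e] := IH (fun y r => h y (x :: r)) (fun y r e => jh y (x :: r) (congr1 S e)).
split; first by apply: cintegrableD i; exact: jh.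
by rewrite cintegralD // ?e //; exact: jh.
Qed.

End SelectSumIntegral.

Lemma cintegrable_tuple0 d (T : measurableType d) (R : realType)
    (mu : {sigma_finite_measure set T -> \bar R}) (f : 0.-tuple T -> R[i]) :
  cintegrable (tmeasure mu 0) f.
Proof.
have H (u : 0.-tuple T -> R) : (tmeasure mu 0).-integrable setT (fun t => (u t)%:E).
  rewrite (_ : (fun t => _) = (fun=> (u [tuple])%:E)).
    by apply: finite_measure_integrable_cst.
  by apply/funext => t; rewrite tuple0.
by split; exact: H.
Qed.

Section RealIntegration.
Variables (R : realType) (mu : {sigma_finite_measure set R -> \bar R}) (N : nat).
Notation C := R[i].
Notation V := 'rV[C]_N.
Local Notation tm := (tmeasure mu).
Local Notation CI m := (complex_integral m setT).
Variable v : R -> V.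
Hypothesis v_int : forall k, cintegrable mu (fun y => v y 0 k).

Lemma v_sg_int k x : cintegrable mu (fun y => v y 0 k * (Num.sg (y - x))%:C).
Proof.
apply: cintegrableM_bounded => //; last by move=> t; exact: normr_sg_le1.
by apply: (measurableT_comp (@measurable_sg R)); exact: measurable_funB.
Qed.

Definition sg_transform x : V :=
  \row_k (2^-1 * CI mu (fun y => v y 0 k * (Num.sg (y - x))%:C)).

(** The factor 2 undoes the half in [sg_transform]: this is the double integral of
    [v_j(x) v_k(y) sgn(y - x)], written in iterated form. *)
Definition sg_gram : 'M[C]_N :=
  \matrix_(j, k) CI mu (fun x => v x 0 j * (2 * sg_transform x 0 k)).

Let kappa j k (p : R * R) : C := v p.1 0 j * v p.2 0 k * (Num.sg (p.2 - p.1))%:C.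

Let kappa_int j k : cintegrable (mu \x mu)%E (kappa j k).
Proof.
apply: cintegrableM_bounded.
- by apply: (cintegral_tensor (v_int j) (v_int k)).
- apply: (measurableT_comp (@measurable_sg R)).
  by apply: measurable_funB; [exact: measurable_snd|exact: measurable_fst].
- by move=> t; exact: normr_sg_le1.
Qed.

Let kappa_iterated j k :
  cintegrable mu (fun x => v x 0 j * (2 * sg_transform x 0 k)) /\
  CI (mu \x mu)%E (kappa j k) = sg_gram j k.
Proof.
have js x : cintegrable mu (fun y => kappa j k (x, y)).
  rewrite /kappa /=; under eq_fun => y do rewrite -mulrA.
  exact/cintegrableZ/v_sg_int.
have e : (fun x => CI mu (fun y => kappa j k (x, y))) =
    fun x => v x 0 j * (2 * sg_transform x 0 k).
  apply/funext => x; rewrite mxE mulVKf ?pnatr_eq0 // -cintegralZ; last exact: v_sg_int.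
  by congr (CI _ _); apply/funext => y; rewrite /kappa mulrA.
have [] := cintegral_iterated (kappa_int j k) js; rewrite e mxE.
by [].
Qed.

Let kappaE j k : CI (mu \x mu)%E (kappa j k) = sg_gram j k.
Proof. exact: (kappa_iterated j k).2. Qed.

Lemma sg_transform_integrable j k : cintegrable mu (fun x => v x 0 j * sg_transform x 0 k).
Proof.
have := cintegrableZ 2^-1 (kappa_iterated j k).1; congr cintegrable.
by apply/funext => x; rewrite mulrCA mulKf ?pnatr_eq0.
Qed.

Lemma sg_gramE j k :
  sg_gram j k = 2 * CI mu (fun x => v x 0 j * sg_transform x 0 k).
Proof.
rewrite mxE -cintegralZ; last exact: sg_transform_integrable.
by congr (CI _ _); apply/funext => x; rewrite mulrCA.
Qed.

Section Integrand.
Variable F : seq V -> C.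
Hypotheses (F_lin : multilinear F) (F_alt : alternating F)
  (F_odd : forall us, odd (size us) -> F us = 0).

Definition sg_integrand (X : seq R) (st : seq V) (t : seq R) : C :=
  (sg_vandermonde (X ++ t))%:C * F (map v (X ++ t) ++ st).

(** For odd [size Y] the sign factor expands along [x], and the signs of this expansion are absorbed
    by moving [v y] next to [v x] inside [F]. For even [size Y] both sides vanish, because [F] then
    receives an odd number of vectors. *)
Lemma sg_integrand_expand x Y st : ~~ odd (size st) ->
  (sg_vandermonde (x :: Y))%:C * F (v x :: map v Y ++ st) =
  select_sum (fun y r => (Num.sg (y - x))%:C *
    ((sg_vandermonde r)%:C * F (map v r ++ [:: v x, v y & st]))) Y.
Proof.
move=> ev_st; case odd_Y: (odd (size Y)); last first.
  rewrite F_odd ?mulr0; last by rewrite /= size_cat size_map oddD odd_Y (negPf ev_st).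
  elim/last_ind: Y odd_Y => // Y y _; rewrite size_rcons /= => /negbFE odd_Y.
  rewrite (@eq_select_sum _ _ _ (fun _ _ => 0 * 0)); first by rewrite select_sumZ mul0r.
  move=> u r; rewrite size_rcons => -[e].
  by rewrite F_odd ?mulr0 // size_cat size_map -e /= oddD odd_Y /= negbK (negPf ev_st).
rewrite sg_vandermonde_cons // [_%:C](contract_rmorph (real_complex R)).
rewrite (@contract_mul_alternating _ _ _ _ (fun Y => F (v x :: map v Y ++ st))
  (fun u r => F (map v r ++ [:: v x, v u & st]))); last first.
  by move=> vs u ws _; rewrite !map_cat /= alternating_pull // size_map.
by apply: eq_select_sum => y r _; rewrite mulrA.
Qed.

Lemma basis_expand2 us u w st : F (us ++ [:: u, w & st]) =
  \sum_k w 0 k * F (us ++ [:: u, basis_row C k & st]).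
Proof.
rewrite -cat_rcons multilinear_basis //.
by apply: eq_bigr => k _; rewrite cat_rcons.
Qed.

Lemma sg_integrand_basis X u w st t : sg_integrand X [:: u, w & st] t =
  \sum_k w 0 k * sg_integrand X [:: u, basis_row C k & st] t.
Proof.
rewrite /sg_integrand basis_expand2 mulr_sumr.
by apply: eq_bigr => k _; rewrite mulrCA.
Qed.

(** The partner of [x] is either a fixed point of [X], which leaves a sign, or one of the [n]
    integrated points. The latter contribute equally, and integrating the partner out turns [v y]
    into twice the transform at [x]. *)
Lemma cintegral_sg_cons n x X st : ~~ odd (size st) ->
  (forall y r, size X = (size r).+1 ->
    cintegrable (tm n) (fun t => sg_integrand r [:: v x, v y & st] t)) ->
  (forall k, (0 < n)%N ->
    cintegrable (tm n.-1) (fun t => sg_integrand X [:: v x, basis_row C k & st] t)) ->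
  cintegrable (tm n) (fun t => sg_integrand (x :: X) st t) /\
  CI (tm n) (fun t => sg_integrand (x :: X) st t) =
  select_sum (fun y r => (Num.sg (y - x))%:C *
    CI (tm n) (fun t => sg_integrand r [:: v x, v y & st] t)) X +
  n%:R * (2 * CI (tm n.-1) (fun t => sg_integrand X [:: v x, sg_transform x & st] t)).
Proof.
move=> ev jX jn.
pose A (t : seq R) := select_sum (fun y r => (Num.sg (y - x))%:C *
   sg_integrand r [:: v x, v y & st] t) X.
pose D (t : seq R) := \sum_k select_sum (fun y r => (v y 0 k * (Num.sg (y - x))%:C) *
   sg_integrand X [:: v x, basis_row C k & st] r) t.
have -> : (fun t : n.-tuple R => sg_integrand (x :: X) st t) = (fun t => A t + D t).
  apply/funext => t; rewrite [LHS](sg_integrand_expand x (X ++ t) ev) select_sum_cat.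
  congr (_ + _); rewrite /D -select_sum_sum; apply: eq_select_sum => y r _.
  rewrite basis_expand2 !mulr_sumr; apply: eq_bigr => k _.
  by rewrite /sg_integrand; ring.
have [iA eA] := @cintegral_select_sum_fun _ _ _ (tm n) _
  (fun y r t => (Num.sg (y - x))%:C * sg_integrand r [:: v x, v y & st] t) X
  (fun y r e => cintegrableZ _ (jX y r e)).
have [iD eD] : cintegrable (tm n) (fun t => D t) /\ CI (tm n) (fun t => D t) =
    n%:R * (2 * CI (tm n.-1) (fun t => sg_integrand X [:: v x, sg_transform x & st] t)).
  (* With no integrated point the sum over partners is empty, in agreement with the coefficient
     [n]. *)
  case: n jX jn {A iA eA} => [|n] jX jn.
    have D0 : (fun t : 0.-tuple R => D t) = (fun=> 0).
      by apply/funext => t; rewrite tuple0 /D big1.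
    by rewrite D0 mul0r; split; [exact: cintegrable0|exact: cintegral0].
  have j k := cintegral_select_sum (v_sg_int k x) (jn k isT).
  split; first by apply: cintegrable_sum => k _; exact: (j k).1.
  rewrite cintegral_sum; last by move=> k _; exact: (j k).1.
  have -> : (fun t : n.-tuple R => sg_integrand X [:: v x, sg_transform x & st] t) =
      (fun t => \sum_k sg_transform x 0 k * sg_integrand X [:: v x, basis_row C k & st] t).
    by apply/funext => t; exact: sg_integrand_basis.
  rewrite cintegral_sum; last by move=> k _; apply/cintegrableZ/jn.
  rewrite !mulr_sumr; apply: eq_bigr => k _; rewrite (j k).2 cintegralZ; last exact: jn.
  by rewrite mxE /=; field.
split; first exact: cintegrableD.
rewrite cintegralD // eD eA; congr (_ + _); apply: eq_select_sum => y r e.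
by rewrite cintegralZ //; exact: jX.
Qed.

(** Without fixed points the first integrated point takes the role of [x]. It has [n + 1] possible
    partners, and integrating the matched pair produces the entries of [sg_gram]. *)
Lemma cintegral_sg_nil n st : ~~ odd (size st) ->
  (forall j k, cintegrable (tm n)
    (fun t => sg_integrand [::] [:: basis_row C j, basis_row C k & st] t)) ->
  cintegrable (tm n.+2) (fun t => sg_integrand [::] st t) /\
  CI (tm n.+2) (fun t => sg_integrand [::] st t) =
  n.+1%:R * \sum_j \sum_k sg_gram j k *
    CI (tm n) (fun t => sg_integrand [::] [:: basis_row C j, basis_row C k & st] t).
Proof.
move=> ev jn.
have j a b := cintegral_select_sum2 (kappa_int a b) (jn a b).
have -> : (fun t : n.+2.-tuple R => sg_integrand [::] st t) =
  (fun t => \sum_a \sum_b select_sum (fun y r => kappa a b (thead t, y) *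
     sg_integrand [::] [:: basis_row C a, basis_row C b & st] r) (behead t)).
  apply/funext => t; case: (tupleP t) => x t'; rewrite theadE /=.
  rewrite [LHS](sg_integrand_expand x t' ev).
  under [RHS]eq_bigr => a _ do rewrite -select_sum_sum.
  rewrite -select_sum_sum; apply: eq_select_sum => y r _.
  rewrite multilinear_basis // !mulr_sumr; apply: eq_bigr => a _.
  rewrite basis_expand2 !mulr_sumr; apply: eq_bigr => b _.
  by rewrite /sg_integrand /kappa /=; ring.
have ja a : cintegrable (tm n.+2) (fun t => \sum_b select_sum (fun y r => kappa a b (thead t, y) *
     sg_integrand [::] [:: basis_row C a, basis_row C b & st] r) (behead t)).
  by apply: cintegrable_sum => b _; exact: (j a b).1.
split; first by apply: cintegrable_sum.
rewrite cintegral_sum // mulr_sumr; apply: eq_bigr => a _.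
rewrite cintegral_sum; last by move=> b _; exact: (j a b).1.
rewrite mulr_sumr; apply: eq_bigr => b _.
by rewrite (j a b).2 kappaE.
Qed.

(** The two preceding recursions also transfer integrability, and both lower [size X + n]. The
    single remaining case, one integrated point and no fixed one, has zero integrand by parity. *)
Lemma cintegrable_sg_integrand n X st : ~~ odd (size st) ->
  cintegrable (tm n) (fun t => sg_integrand X st t).
Proof.
have [m] := ubnP (size X + n); elim: m n X st => // m IH n [|x X] st le_m ev.
  case: n le_m => [|[|n]] le_m; first exact: cintegrable_tuple0.
    have -> : (fun t : 1.-tuple R => sg_integrand [::] st t) = fun=> 0.
      apply/funext => t; rewrite /sg_integrand F_odd ?mulr0 //.
      by rewrite size_cat size_map size_tuple /= (negPf ev).
    exact: cintegrable0.
  have [] // := @cintegral_sg_nil n st ev _.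
  by move=> j k; apply: IH; rewrite /= ?negbK //; move: le_m; rewrite /=; lia.
have [] // := @cintegral_sg_cons n x X st ev _ _.
  by move=> y r e; apply: IH; rewrite /= ?negbK //; move: le_m; rewrite /= e; lia.
by move=> k n0; apply: IH; rewrite /= ?negbK //; move: le_m; rewrite /=; lia.
Qed.

End Integrand.
End RealIntegration.

(** * The sum over all numbers of integrated points *)

Section CorrelationSum.
Variables (R : realType) (mu : {sigma_finite_measure set R -> \bar R}) (N : nat).
Notation C := R[i].
Notation V := 'rV[C]_N.
Local Notation tm := (tmeasure mu).
Local Notation CI m := (complex_integral m setT).
Variables (v : R -> V) (Bc : 'M[C]_N).
Hypothesis v_int : forall k, cintegrable mu (fun y => v y 0 k).
Hypothesis N_even : ~~ odd N.

Let F p := det_pairs Bc p.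

Let F_odd p us : odd (size us) -> F p us = 0.
Proof.
move=> odd_us; apply: det_pairs_size; apply: contraNneq N_even => <-.
by rewrite oddD oddM odd_us.
Qed.

Definition sg_integral n p X st : C := CI (tm n) (fun t => sg_integrand v (F p) X st t).

(** Here [n] and [p] stand for [L - l] and [M - m]. The constraint [L + 2 M = N] is left out because
    terms that violate it vanish, and the powers of 2 have been pulled out of the sum. *)
Definition corr_sum X st : C :=
  \sum_(n < N.+1) \sum_(p < N.+1) ((n`! * p`!)%:R)^-1 * sg_integral n p X st.

Lemma sg_integral_size n p X st : (size X + n + size st + 2 * p != N)%N ->
  sg_integral n p X st = 0.
Proof.
move=> ne; rewrite /sg_integral (_ : (fun t => _) = fun=> 0) ?cintegral0 //.
apply/funext => t; rewrite /sg_integrand /F det_pairs_size ?mulr0 //.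
by rewrite size_cat size_map size_cat size_tuple.
Qed.

Let sg_int n p X st : ~~ odd (size st) ->
  cintegrable (tm n) (fun t => sg_integrand v (F p) X st t).
Proof.
apply: cintegrable_sg_integrand => //.
- exact: det_pairs_multilinear.
- exact: det_pairs_alternating.
- exact: F_odd.
Qed.

Lemma sg_integral_cons n p x X st : ~~ odd (size st) ->
  sg_integral n p (x :: X) st =
  select_sum (fun y r => (Num.sg (y - x))%:C * sg_integral n p r [:: v x, v y & st]) X +
  n%:R * (2 * sg_integral n.-1 p X [:: v x, sg_transform mu v x & st]).
Proof.
move=> ev; have [] // := @cintegral_sg_cons _ mu _ v v_int (F p) (@det_pairs_multilinear _ _ _ _)
  (@det_pairs_alternating _ _ _ _) (@F_odd p) n x X st ev.
- by move=> y r _; apply: sg_int; rewrite /= negbK.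
- by move=> k _; apply: sg_int; rewrite /= negbK.
Qed.

Lemma sg_integral_nil n p st : ~~ odd (size st) ->
  sg_integral n.+2 p [::] st = n.+1%:R * \sum_j \sum_k sg_gram mu v j k *
    sg_integral n p [::] [:: basis_row C j, basis_row C k & st].
Proof.
move=> ev; have [] // := @cintegral_sg_nil _ mu _ v v_int (F p) (@det_pairs_multilinear _ _ _ _)
  (@det_pairs_alternating _ _ _ _) (@F_odd p) n st ev.
by move=> j k; apply: sg_int; rewrite /= negbK.
Qed.

Lemma sg_integral_pair n p st : ~~ odd (size st) ->
  sg_integral n p.+1 [::] st = \sum_j \sum_k Bc j k *
    sg_integral n p [::] [:: basis_row C j, basis_row C k & st].
Proof.
move=> ev; rewrite /sg_integral.
have i j k : cintegrable (tm n) (fun t => Bc j k *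
    sg_integrand v (F p) [::] [:: basis_row C j, basis_row C k & st] t).
  by apply: cintegrableZ; apply: sg_int; rewrite /= negbK.
transitivity (CI (tm n) (fun t : n.-tuple R => \sum_j \sum_k Bc j k *
    sg_integrand v (F p) [::] [:: basis_row C j, basis_row C k & st] t)).
  congr (CI _ _); apply/funext => t; rewrite /sg_integrand /F /= /insert_pair mulr_sumr.
  apply: eq_bigr => j _; rewrite mulr_sumr; apply: eq_bigr => k _.
  have := alternating_move2 (@det_pairs_alternating _ _ Bc p) (map v t)
    (basis_row C j) (basis_row C k) st [::].
  by rewrite !cats0 catA => <-; ring.
rewrite cintegral_sum; last by move=> j _; apply: cintegrable_sum.
apply: eq_bigr => j _; rewrite cintegral_sum //; apply: eq_bigr => k _.
by rewrite cintegralZ //; apply: sg_int; rewrite /= negbK.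
Qed.

Lemma corr_sum_cons x X st : ~~ odd (size st) ->
  corr_sum (x :: X) st =
  select_sum (fun y r => (Num.sg (y - x))%:C * corr_sum r [:: v x, v y & st]) X +
  2 * corr_sum X [:: v x, sg_transform mu v x & st].
Proof.
move=> ev; rewrite /corr_sum.
transitivity (\sum_(n < N.+1) \sum_(p < N.+1)
  (select_sum (fun y r => (Num.sg (y - x))%:C *
     (((n`! * p`!)%:R)^-1 * sg_integral n p r [:: v x, v y & st])) X +
   ((n`! * p`!)%:R)^-1 * (n%:R * (2 * sg_integral n.-1 p X [:: v x, sg_transform mu v x & st])))).
  apply: eq_bigr => n _; apply: eq_bigr => p _.
  rewrite sg_integral_cons // mulrDr -select_sumZ; congr (_ + _).
  by apply: eq_select_sum => y r _; ring.
under eq_bigr => n _ do rewrite big_split -select_sum_sum /=.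
rewrite big_split -select_sum_sum /=; congr (_ + _).
  apply: eq_select_sum => y r _; rewrite mulr_sumr; apply: eq_bigr => n _.
  by rewrite mulr_sumr.
rewrite big_ord_recl [X in X + _]big1 ?add0r => [|p _]; last by rewrite mul0r mulr0.
set st' := [:: v x, _ & st].
(* The list [st'] already holds two vectors, so the term [n = N] would exceed [N] vectors in all. *)
have -> : \sum_(n < N.+1) \sum_(p < N.+1) ((n`! * p`!)%:R)^-1 * sg_integral n p X st' =
    \sum_(n < N) \sum_(p < N.+1) ((n`! * p`!)%:R)^-1 * sg_integral n p X st'.
  rewrite big_ord_recr /= [X in _ + X]big1 ?addr0 // => p _.
  by rewrite sg_integral_size ?mulr0 //=; lia.
rewrite mulr_sumr; apply: eq_bigr => n _; rewrite mulr_sumr; apply: eq_bigr => p _.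
rewrite lift0 /= factS !natrM.
have n1 : n.+1%:R != 0 :> C by rewrite pnatr_eq0.
have f0 : n`!%:R != 0 :> C by rewrite pnatr_eq0 -lt0n fact_gt0.
have p0 : p`!%:R != 0 :> C by rewrite pnatr_eq0 -lt0n fact_gt0.
by move: (sg_integral _ _ _ _) => s; rewrite !invfM; field; rewrite f0 p0 addrC natr1 n1.
Qed.

(** The half arises because [n] real points form only [n / 2] pairs, while the weight is [1 / n!].
    The antisymmetrization of this matrix is the Gram matrix, see [gramE]. *)
Definition pair_mx : 'M[C]_N := 2^-1 *: sg_gram mu v + Bc.

Let sum_shift n (a : nat -> C) : a 0%N = 0 -> (forall i, (n <= i)%N -> a i = 0) ->
  \sum_(i < n) a i = \sum_(i < n) a i.+1.
Proof.
move=> a0 an; transitivity (\sum_(i < n.+1) a i).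
  by rewrite big_ord_recr /= an // addr0.
by rewrite big_ord_recl a0 add0r.
Qed.

(* Every term with [n + 2 p = 2 h] satisfies [h = n / 2 + p]; the two summands
   are lowered by integrating out one real pair, respectively one complex pair. *)
Lemma corr_sum_nil_rec st h : ~~ odd (size st) -> (size st + 2 * h = N)%N ->
  h%:R * corr_sum [::] st = \sum_j \sum_k pair_mx j k *
    corr_sum [::] [:: basis_row C j, basis_row C k & st].
Proof.
move=> ev e.
pose G n p := sg_integral n p [::] st.
pose D (M : 'M[C]_N) n p := \sum_j \sum_k M j k *
  sg_integral n p [::] [:: basis_row C j, basis_row C k & st].
have G0 n p : (size st + n + 2 * p != N)%N -> G n p = 0.
  by move=> ne; apply: sg_integral_size; rewrite add0n [(n + _)%N]addnC.
have hG n p : h%:R * G n p = 2^-1 * n%:R * G n p + p%:R * G n p.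
  have [e'|ne] := eqVneq (size st + n + 2 * p)%N N; last by rewrite G0 ?mulr0 ?addr0.
  have -> : h%:R = 2^-1 * n%:R + p%:R :> C; last by rewrite mulrDl.
  have -> : n = (2 * (h - p))%N by lia.
  by rewrite natrM mulrA mulVf ?pnatr_eq0 // mul1r natrB ?subrK //; lia.
have fact0 n : n`!%:R != 0 :> C by rewrite pnatr_eq0 -lt0n fact_gt0.
have succ0 n : 1 + n%:R != 0 :> C by rewrite addrC natr1 pnatr_eq0.
transitivity (\sum_(n < N.+1) \sum_(p < N.+1) ((n`! * p`!)%:R)^-1 * (2^-1 * n%:R * G n p)
   + \sum_(n < N.+1) \sum_(p < N.+1) ((n`! * p`!)%:R)^-1 * (p%:R * G n p)).
  rewrite /corr_sum mulr_sumr -big_split; apply: eq_bigr => n _.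
  rewrite mulr_sumr -big_split; apply: eq_bigr => p _.
  by rewrite mulrCA hG mulrDr.
have -> : \sum_(n < N.+1) \sum_(p < N.+1) ((n`! * p`!)%:R)^-1 * (2^-1 * n%:R * G n p) =
    \sum_(n < N.+1) \sum_(p < N.+1) ((n`! * p`!)%:R)^-1 * (2^-1 * D (sg_gram mu v) n p).
  pose a n := \sum_(p < N.+1) ((n`! * p`!)%:R)^-1 * (2^-1 * n%:R * G n p).
  rewrite (@sum_shift _ a); last 2 first.
  - by rewrite /a big1 // => p _; rewrite mulr0 mul0r mulr0.
  - by move=> n lt_n; rewrite /a big1 // => p _; rewrite G0 ?mulr0 //; lia.
  (* A pair of real points is removed at a time, so [n] is shifted twice; the second shift needs the
     term [n = 1] to vanish, which holds by parity. *)
  rewrite (@sum_shift _ (fun n => a n.+1)); last 2 first.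
  - rewrite /a big1 // => p _; rewrite G0 ?mulr0 //.
    by apply: contraNneq N_even => <-; rewrite oddD oddD oddM (negPf ev).
  - by move=> n lt_n; rewrite /a big1 // => p _; rewrite G0 ?mulr0 //; lia.
  apply: eq_bigr => n _; apply: eq_bigr => p _.
  rewrite /G sg_integral_nil // -/(D _ _ _) !factS !natrM -!natr1.
  by move: (D _ _ _) => d; field; rewrite !fact0 /= !natr1 !pnatr_eq0.
have -> : \sum_(n < N.+1) \sum_(p < N.+1) ((n`! * p`!)%:R)^-1 * (p%:R * G n p) =
    \sum_(n < N.+1) \sum_(p < N.+1) ((n`! * p`!)%:R)^-1 * D Bc n p.
  apply: eq_bigr => n _.
  rewrite (@sum_shift _ (fun p => ((n`! * p`!)%:R)^-1 * (p%:R * G n p))); last 2 first.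
  - by rewrite mul0r mulr0.
  - by move=> p lt_p; rewrite G0 ?mulr0 //; lia.
  apply: eq_bigr => p _; rewrite /G sg_integral_pair // -/(D _ _ _) !factS !natrM -!natr1.
  by move: (D _ _ _) => d; field; rewrite !fact0 addrC succ0.
rewrite -big_split /=.
transitivity (\sum_(n < N.+1) \sum_(p < N.+1) ((n`! * p`!)%:R)^-1 * D pair_mx n p).
  apply: eq_bigr => n _; rewrite -big_split; apply: eq_bigr => p _ /=.
  rewrite -mulrDr; congr (_ * _); rewrite /D mulr_sumr -big_split; apply: eq_bigr => j _ /=.
  rewrite mulr_sumr -big_split; apply: eq_bigr => k _ /=.
  by rewrite /pair_mx !mxE; ring.
have exch (X : 'I_N.+1 -> 'I_N.+1 -> 'I_N -> 'I_N -> C) :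
    \sum_n \sum_p \sum_j \sum_k X n p j k = \sum_j \sum_k \sum_n \sum_p X n p j k.
  transitivity (\sum_n \sum_j \sum_p \sum_k X n p j k).
    by apply: eq_bigr => n _; rewrite exchange_big.
  rewrite exchange_big; apply: eq_bigr => j _ /=.
  transitivity (\sum_n \sum_k \sum_p X n p j k).
    by apply: eq_bigr => n _; rewrite exchange_big.
  by rewrite exchange_big.
rewrite /D; transitivity (\sum_(n < N.+1) \sum_(p < N.+1) \sum_j \sum_k
   ((n`! * p`!)%:R)^-1 * (pair_mx j k *
     sg_integral n p [::] [:: basis_row C j, basis_row C k & st])).
  apply: eq_bigr => n _; apply: eq_bigr => p _; rewrite mulr_sumr.
  by apply: eq_bigr => j _; rewrite mulr_sumr.
rewrite exch; apply: eq_bigr => j _; apply: eq_bigr => k _.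
rewrite /corr_sum mulr_sumr; apply: eq_bigr => n _.
by rewrite mulr_sumr; apply: eq_bigr => p _; rewrite mulrCA.
Qed.

Lemma corr_sum_nil st : ~~ odd (size st) -> corr_sum [::] st = wick pair_mx st.
Proof.
move=> ev; have [le_N|lt_N] := leqP (size st) N; last first.
  rewrite /wick big1 => [|h _]; last by rewrite det_pairs_size ?mulr0 // gtn_eqF // ltn_addr.
  rewrite /corr_sum big1 // => n _; rewrite big1 // => p _.
  by rewrite sg_integral_size ?mulr0 //=; lia.
have [h e] : exists h, (size st + 2 * h = N)%N.
  exists (N - size st)./2; rewrite mul2n -[RHS](subnKC le_N); congr (_ + _)%N.
  by rewrite -[RHS]odd_double_half oddB // (negPf N_even) (negPf ev).
elim: h st ev e {le_N} => [|h IH] st ev e.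
  rewrite (wickE _ e) /= fact0 invr1 mul1r /corr_sum.
  rewrite big_ord_recl big_ord_recl /= !big1 ?addr0; last 2 first.
  - move=> n _; rewrite big1 // => p _; rewrite sg_integral_size ?mulr0 //= /bump /=; move: (size st) e => s; lia.
  - by move=> p _; rewrite sg_integral_size ?mulr0 //= /bump /=; move: (size st) e => s; lia.
  rewrite mul1n invr1 mul1r /sg_integral.
  rewrite /complex_integral !integral_tmeasure0 /= /sg_integrand /= mul1r.
  by case: (det_seq st).
have h0 : h.+1%:R != 0 :> C by rewrite pnatr_eq0.
apply: (mulfI h0); rewrite (corr_sum_nil_rec ev e) (wickE _ e) factS natrM invfM.
rewrite !mulrA divff // mul1r /= /insert_pair mulr_sumr; apply: eq_bigr => j _.
rewrite mulr_sumr; apply: eq_bigr => k _.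
have e2 : (size [:: basis_row C j, basis_row C k & st] + 2 * h = N)%N by apply: etrans e; rewrite /= mulnS addnCA.
rewrite IH ?e2 //; last by rewrite /= negbK.
rewrite (wickE _ e2) mulrCA; congr (_ * (_ * _)).
have := alternating_move2 (@det_pairs_alternating _ _ pair_mx h) [::]
    (basis_row C j) (basis_row C k) st [::].
by rewrite !cats0.
Qed.

End CorrelationSum.

(** * Integrability from one finite multilinear integral *)

(** As [H] is only a predicate, a basis is replaced by a square matrix of maximal rank among those
    with rows in [H]. Adjoining a vector of [H] cannot raise this rank, so the row space contains
    [H]; a kernel vector of the transpose annihilates it. *)
Lemma subspace_dual (F : fieldType) K (H : 'rV[F]_K -> Prop) :
  H 0 -> (forall a x y, H x -> H y -> H (a *: x + y)) ->
  (forall x, H x) \/ exists2 u : 'rV[F]_K, u != 0 & forall x, H x -> x *m u^T = 0.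
Proof.
move=> H0 Hlin.
have Hspan m (M : 'M[F]_(m, K)) (y : 'rV_K) : (forall i, H (row i M)) -> (y <= M)%MS -> H y.
  move=> HM /submxP[D ->]; rewrite mulmx_sum_row.
  by elim/big_ind: _ => [//|x z Hx Hz|i _]; [rewrite -[x]scale1r; exact: Hlin|
     rewrite -[_ *: _]addr0; exact: Hlin].
pose P r := `[< exists2 M : 'M[F]_K, (forall i, H (row i M)) & \rank M = r >].
have exP : exists r, P r.
  exists 0%N; apply/asboolP; exists 0; last exact: mxrank0.
  by move=> i; rewrite row0.
have Pb r : P r -> (r <= K)%N by move=> /asboolP[M _ <-]; exact: rank_leq_row.
case: (ex_maxnP exP Pb) => r /asboolP[M HM rM] maxr.
have [full|nfull] := boolP (row_full M).
  by left => x; apply: (Hspan _ M) => //; exact: submx_full.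
right; have : kermx M^T != 0.
  rewrite kermx_eq0 /row_free mxrank_tr; apply: contraNneq nfull => e.
  by rewrite /row_full e.
case/rowV0Pn => u /sub_kermxP uM u0; exists u => // x Hx.
have le_xM : (x <= M)%MS.
  have HMx : forall i, H (row i (M + x)%MS).
    move=> i; apply: (Hspan _ (col_mx M x)); last by rewrite (submx_trans (row_sub i _)) // addsmxE.
    move=> k; case: (splitP k) => k' ek.
      have -> : k = lshift 1 k' by apply: val_inj.
      by rewrite -row_usubmx col_mxKu.
    have -> : k = rshift K k' by apply: val_inj.
    by rewrite -row_dsubmx col_mxKd row_id.
  have : (\rank (M + x) <= r)%N by apply: maxr; apply/asboolP; exists (M + x)%MS.
  rewrite -rM => le_r; apply: submx_trans (addsmxSr M x) _.
  by rewrite -(geq_leqif (mxrank_leqif_sup (addsmxSl M x))).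
case/submxP: le_xM => D ->.
by rewrite -mulmxA -[M]trmxK -trmx_mul uM trmx0 mulmx0.
Qed.

Section ComplexMeasurable.
Context d (T : measurableType d) (R : realType).
Implicit Types f g : T -> R[i].

Definition cmeasurable f := measurable_fun setT (fun t => complex.Re (f t)) /\
  measurable_fun setT (fun t => complex.Im (f t)).

Lemma cmeasurable_cst c : cmeasurable (fun=> c).
Proof. by split; exact: measurable_cst. Qed.

Lemma cmeasurableD f g : cmeasurable f -> cmeasurable g -> cmeasurable (fun t => f t + g t).
Proof.
move=> [rf jf] [rg jg]; split.
- by under eq_fun => t do rewrite Re_add; exact: measurable_funD.
- by under eq_fun => t do rewrite Im_add; exact: measurable_funD.
Qed.

Lemma cmeasurableM f g : cmeasurable f -> cmeasurable g -> cmeasurable (fun t => f t * g t).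
Proof.
move=> [rf jf] [rg jg]; split.
- under eq_fun => t do rewrite Re_mul; apply: measurable_funB; exact: measurable_funM.
- under eq_fun => t do rewrite Im_mul; apply: measurable_funD; exact: measurable_funM.
Qed.

Lemma cmeasurable_sum (I : Type) (r : seq I) (f : I -> T -> R[i]) :
  (forall i, cmeasurable (f i)) -> cmeasurable (fun t => \sum_(i <- r) f i t).
Proof.
move=> mf; elim: r => [|i r IH].
  by under eq_fun => t do rewrite big_nil; exact: cmeasurable_cst.
by under eq_fun => t do rewrite big_cons; exact: cmeasurableD.
Qed.

Lemma cmeasurable_real (u : T -> R) : measurable_fun setT u -> cmeasurable (fun t => (u t)%:C).
Proof. by move=> mu; split => //=; exact: measurable_cst. Qed.

Lemma measurable_normc f : cmeasurable f -> measurable_fun setT (fun t => Normc.normc (f t)).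
Proof.
move=> [rf jf].
rewrite (_ : (fun t => _) = (@Num.sqrt R) \o
    (fun t => complex.Re (f t) ^+ 2 + complex.Im (f t) ^+ 2)); last first.
  by apply/funext => t /=; case: (f t).
apply: (@measurableT_comp _ _ _ _ _ _ (@Num.sqrt R)).
  by apply: continuous_measurable_fun; exact: sqrt_continuous.
by apply: measurable_funD; exact: measurable_funX.
Qed.

Lemma normc_ge0 (z : R[i]) : 0 <= Normc.normc z.
Proof. by case: z => a b; exact: sqrtr_ge0. Qed.

Lemma normc_ge_ReIm (z : R[i]) :
  `|complex.Re z| <= Normc.normc z /\ `|complex.Im z| <= Normc.normc z.
Proof.
by case: z => a b /=; rewrite -!sqrtr_sqr !ler_sqrt ?addr_ge0 ?sqr_ge0 // lerDl lerDr !sqr_ge0.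
Qed.

Lemma cintegrable_normc (mu : {measure set T -> \bar R}) f : cmeasurable f ->
  (\int[mu]_t (Normc.normc (f t))%:E < +oo)%E -> cintegrable mu f.
Proof.
move=> mf foo.
have jn : mu.-integrable setT (fun t => (Normc.normc (f t))%:E).
  apply/integrableP; split; first exact/measurable_EFinP/measurable_normc.
  by under eq_integral => t _ do rewrite gee0_abs ?lee_fin ?normc_ge0 //.
case: mf => rf jf; split; apply: (le_integrable measurableT _ _ jn).
- exact/measurable_EFinP.
- move=> t _ /=; rewrite lee_fin (ger0_norm (normc_ge0 _)).
  exact: (normc_ge_ReIm _).1.
- exact/measurable_EFinP.
- move=> t _ /=; rewrite lee_fin (ger0_norm (normc_ge0 _)).
  exact: (normc_ge_ReIm _).2.
Qed.

End ComplexMeasurable.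

Lemma cmeasurable_comp d d' (T : measurableType d) (T' : measurableType d') (R : realType)
    (f : T' -> R[i]) (p : T -> T') :
  cmeasurable f -> measurable_fun setT p -> cmeasurable (fun t => f (p t)).
Proof. by move=> [rf jf] mp; split; [exact: measurableT_comp rf mp|exact: measurableT_comp jf mp]. Qed.

Lemma subspace_dual_fun (F : fieldType) (I : finType) (H : (I -> F) -> Prop) :
  H (fun=> 0) -> (forall a x y, H x -> H y -> H (fun i => a * x i + y i)) ->
  (forall x, H x) \/
  exists u : I -> F, (exists i, u i != 0) /\ forall x, H x -> \sum_i x i * u i = 0.
Proof.
move=> H0 Hlin; pose to_row (x : I -> F) : 'rV_#|I| := \row_i x (enum_val i).
pose of_row (x : 'rV[F]_#|I|) i := x 0 (enum_rank i).
have rowK x : of_row (to_row x) = x.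
  by apply/funext => i; rewrite /of_row mxE enum_rankK.
have [] := @subspace_dual F _ (fun x => H (of_row x)).
- by rewrite (_ : of_row 0 = fun=> 0) //; apply/funext => i; rewrite /of_row mxE.
- move=> a x y Hx Hy; rewrite (_ : of_row _ = fun i => a * of_row x i + of_row y i).
    exact: Hlin.
  by apply/funext => i; rewrite /of_row !mxE.
- by move=> HT; left => x; rewrite -(rowK x).
move=> [u u0 Hu]; right; exists (of_row u); split.
  have [k uk] : exists k, u 0 k != 0.
    apply/existsP; apply: contraNT u0 => /existsPn uk; apply/eqP/rowP => k.
    by apply/eqP; move: (uk k); rewrite negbK mxE.
  by exists (enum_val k); rewrite /of_row enum_valK.
move=> x Hx; have := Hu (to_row x); rewrite rowK => /(_ Hx) /matrixP /(_ 0 0).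
rewrite !mxE => e; apply: etrans e; rewrite [RHS](reindex (@enum_rank I)) /=; last first.
  exact/onW_bij/enum_rank_bij.
by apply: eq_bigr => i _; rewrite !mxE enum_rankK.
Qed.

Section FiniteIntegrals.
Context d1 d2 (T : measurableType d1) (Y : measurableType d2) (R : realType).
Variables (mu : {sigma_finite_measure set T -> \bar R}).
Variables (nu : {sigma_finite_measure set Y -> \bar R}).
Notation C := R[i].

(* The [c] for which [sum_i c_i phi_i] is integrable form a subspace, which contains
   almost every slice [(g_i y)_i]; if it is proper, a functional vanishing on it
   gives a linear relation between the [g_i]. *)
Lemma cintegrable_or_dependent (I : finType) (phi : I -> T -> C) (g : I -> Y -> C) :
  (forall i, cmeasurable (phi i)) -> (forall i, cmeasurable (g i)) ->
  (\int[nu]_y \int[mu]_t (Normc.normc (\sum_i phi i t * g i y))%:E < +oo)%E ->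
  (forall i, cintegrable mu (phi i)) \/
  exists u : I -> C, (exists i, u i != 0) /\
    {ae nu, forall y, \sum_i g i y * u i = 0}.
Proof.
move=> mphi mg fin.
have [] := @subspace_dual_fun _ I (fun c => cintegrable mu (fun t => \sum_i phi i t * c i)).
- rewrite (_ : (fun t => _) = fun=> 0); first exact: cintegrable0.
  by apply/funext => t; rewrite big1 // => i _; rewrite mulr0.
- move=> a x y jx jy; have := cintegrable_lin a jx jy; congr cintegrable.
  apply/funext => t; rewrite mulr_sumr -big_split; apply: eq_bigr => i _ /=.
  by ring.
- move=> H; left => i; have := H (fun j => (j == i)%:R); congr cintegrable.
  apply/funext => t; rewrite (bigD1 i) //= eqxx mulr1 big1 ?addr0 // => j ne.
  by rewrite (negPf ne) mulr0.
move=> [u [u0 uH]]; right; exists u; split=> //.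
pose f (p : Y * T) := (Normc.normc (\sum_i phi i p.2 * g i p.1))%:E.
have mf : measurable_fun setT f.
  apply/measurable_EFinP/measurable_normc; apply: cmeasurable_sum => i.
  by apply: cmeasurableM; [apply: cmeasurable_comp (mphi i) _|apply: cmeasurable_comp (mg i) _].
have f0 p : (0 <= f p)%E by rewrite lee_fin normc_ge0.
have jJ : nu.-integrable setT (fun y => \int[mu]_t f (y, t))%E.
  apply/integrableP; split.
    exact: (@measurable_fun_fubini_tonelli_F _ _ _ _ _ mu f).
  under eq_integral => y _ do rewrite gee0_abs ?integral_ge0 //.
  exact: fin.
have := integrable_ae measurableT jJ; apply: filterS => y /(_ Logic.I) finy.
apply: uH; apply: cintegrable_normc; last by rewrite ltey_eq finy.
apply: cmeasurable_sum => i; apply: cmeasurableM => //; exact: cmeasurable_cst.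
Qed.

End FiniteIntegrals.

Section MultilinearEvaluation.
Context d (T : measurableType d) (R : realType).
Variables (mu : {sigma_finite_measure set T -> \bar R}).
Notation C := R[i].
Local Notation tm := (tmeasure mu).
Variables (I : finType) (phi : I -> T -> C).
Hypothesis mphi : forall i, cmeasurable (phi i).

(** The multilinear form with coefficient tensor [B], evaluated at the vectors [(phi_i y)_i] for [y]
    in [t]. A tensor of any order is encoded as a function of index lists. *)
Fixpoint multi_eval (B : seq I -> C) (t : seq T) : C :=
  if t is y :: t' then \sum_i phi i y * multi_eval (fun s => B (i :: s)) t' else B [::].

Lemma multi_eval_sum (u : I -> C) (B : I -> seq I -> C) t :
  multi_eval (fun s => \sum_i u i * B i s) t = \sum_i u i * multi_eval (B i) t.
Proof.
elim: t B => //= y t IH B.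
under eq_bigr => i _ do rewrite (IH (fun j s => B j (i :: s))) mulr_sumr.
rewrite exchange_big; apply: eq_bigr => j _ /=.
by rewrite mulr_sumr; apply: eq_bigr => i _; rewrite mulrCA.
Qed.

Lemma cmeasurable_multi_eval n B : cmeasurable (fun t : n.-tuple T => multi_eval B t).
Proof.
elim: n B => [|n IH] B.
  rewrite (_ : (fun t => _) = fun=> B [::]); first exact: cmeasurable_cst.
  by apply/funext => t; rewrite tuple0.
rewrite (_ : (fun t => _) = fun t : n.+1.-tuple T => \sum_i phi i (thead t) *
    multi_eval (fun s => B (i :: s)) [tuple of behead t]); last first.
  by apply/funext => t; case: (tupleP t) => y t'; rewrite theadE /=.
apply: cmeasurable_sum => i; apply: cmeasurableM.
  apply: (cmeasurable_comp (mphi i)); exact: measurable_tnth.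
apply: (cmeasurable_comp (IH _)); exact: measurable_behead.
Qed.

Hypothesis phi_free : forall c : I -> C,
  {ae mu, forall t, \sum_i phi i t * c i = 0} -> forall i, c i = 0.

(** Tonelli, with the first point as inner variable: for almost every choice of the others the form
    vanishes almost everywhere in the first point, and freeness makes each partial evaluation
    vanish. The passage between null functions and null integrals goes through the norm. *)
Lemma multi_eval_ae0 n B : {ae tm n, forall t : n.-tuple T, multi_eval B t = 0} ->
  forall s, size s = n -> B s = 0.
Proof.
have norm0 d' (T' : measurableType d') (m : {measure set T' -> \bar R}) (f : T' -> C) :
    cmeasurable f ->
    (\int[m]_t (Normc.normc (f t))%:E = 0)%E <-> {ae m, forall t, f t = 0}.
  move=> mf; have mn := measurable_normc mf.
  have [h k] := ae_eq_integral_abs m measurableT ((measurable_EFinP _ _).2 mn).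
  have nE : (\int[m]_t (Normc.normc (f t))%:E = \int[m]_t `|(Normc.normc (f t))%:E|)%E.
    by apply: eq_integral => t _; rewrite gee0_abs ?lee_fin ?normc_ge0.
  rewrite nE; split => [/h|H].
    by apply: filterS => t /(_ Logic.I) [] /eqP; rewrite -(rwP eqP) => /Normc.eq0_normc.
  by apply: k; move: H; apply: filterS => t ft _ /=; rewrite ft Normc.normc0.
elim: n B => [|n IH] B /(norm0 _ _ _ _ (cmeasurable_multi_eval _ B)) e s; last first.
  case: s => // i s [es]; apply: (IH (fun s => B (i :: s)) _ s es).
  move: e; rewrite tonelli_tmeasure_swap; last 2 first.
  - exact/measurable_EFinP/measurable_normc/cmeasurable_multi_eval.
  - by move=> t; rewrite lee_fin normc_ge0.
  pose f (p : T * n.-tuple T) := (Normc.normc (multi_eval B (tcons p)))%:E.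
  have mf : measurable_fun setT f.
    apply/measurable_EFinP/measurable_normc.
    apply: (cmeasurable_comp (cmeasurable_multi_eval _ B)); exact: measurable_tcons.
  have f0 p : (0 <= f p)%E by rewrite lee_fin normc_ge0.
  have mJ := @measurable_fun_fubini_tonelli_G _ _ _ _ _ mu f mf f0.
  move=> e; have [+ _] := ae_eq_integral_abs (tm n) measurableT mJ.
  have -> : (\int[tm n]_t `|fubini_G mu f t| = 0)%E.
    by rewrite -[RHS]e; apply: eq_integral => t _; rewrite gee0_abs ?integral_ge0.
  move=> /(_ erefl); apply: filterS => t /(_ Logic.I) Jt.
  apply: (phi_free (c := fun i => multi_eval (fun s => B (i :: s)) t)).
  apply/norm0; last exact: Jt.
  apply: cmeasurable_sum => j; apply: cmeasurableM => //; exact: cmeasurable_cst.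
move: e; rewrite integral_tmeasure0 => -[] /Normc.eq0_normc B0 /eqP.
by rewrite size_eq0 => /eqP ->.
Qed.

End MultilinearEvaluation.

(** * The absolute value of the Vandermonde determinant *)

Section ConjPoints.
Import ComplexField.
Variable R : realType.
Notation C := R[i].

Fixpoint diff_prod (K : comNzRingType) (s : seq K) : K :=
  if s is x :: s' then (\prod_(y <- s') (y - x)) * diff_prod s' else 1.

Lemma vandermonde_detE (s : seq C) : vandermonde_det s = diff_prod s.
Proof.
transitivity (\prod_(i < size s) \prod_(j < size s | (i < j)%N) (s`_j - s`_i)).
  pose a : 'rV_(size s) := \row_j s`_j.
  rewrite /vandermonde_det -det_tr; have := det_Vandermonde a.
  rewrite (_ : Vandermonde _ a = (\matrix_(i, j) s`_i ^+ j)^T).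
    by move=> ->; apply: eq_bigr => i _; apply: eq_bigr => j _; rewrite !mxE.
  by apply/matrixP => i j; rewrite !mxE.
elim: s => [|x s IH]; first by rewrite big_ord0.
rewrite /= big_ord_recl /=; congr (_ * _).
  rewrite big_mkcond big_ord_recl /= mul1r (big_nth 0) big_mkord.
  by apply: eq_bigr => j _.
rewrite -IH; apply: eq_bigr => i _.
rewrite big_mkcond big_ord_recl /= mul1r [RHS]big_mkcond /=.
by apply: eq_bigr => j _; rewrite /bump /= !add1n ltnS.
Qed.

Definition pair_sign (z : C) : C := 'i * (Num.sg (complex.Im z))%:C.

Let norm_real_diff (x y : R) : `|y%:C - x%:C| = (Num.sg (y - x))%:C * (y%:C - x%:C) :> C.
Proof.
rewrite -rmorphB -rmorphM -normrEsg normc_def /= expr0n /= addr0 sqrtr_sqr.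
by [].
Qed.

Let ge0_mul_conj (u z : C) : `|(z - u) * (conjc z - conjc u)| = (z - u) * (conjc z - conjc u).
Proof. by rewrite -rmorphB ger0_norm // mulcJ_ge0. Qed.

Let norm_conj_diff (z : C) : `|conjc z - z| = pair_sign z * (conjc z - z).
Proof.
case: z => a b; rewrite /pair_sign normc_def /=.
apply/eqP; rewrite eq_complex /=; apply/andP; split; apply/eqP; last by ring.
rewrite subrr expr0n /= add0r sqrtr_sqr -opprD normrN -mulr2n normrMn.
by rewrite [`|b|]normrEsg; ring.
Qed.

(** Differences between a real point and a pair, or between two pairs, occur in complex conjugate
    couples with nonnegative product. Only the real differences and the difference inside each pair
    contribute a phase. *)
Lemma diff_prod_conj_points (a : seq R) (b : seq C) :
  `|diff_prod (conj_points a b)| =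
  (sg_vandermonde a)%:C * (\prod_(z <- b) pair_sign z) * diff_prod (conj_points a b).
Proof.
elim: a => [|x a IH] /=.
  rewrite mul1r /conj_points /=; elim: b => [|z b IH] /=.
    by rewrite big_nil mul1r normr1.
  rewrite !big_cons !normrM IH norm_conj_diff /=.
  have E : `|\prod_(y <- flatten [seq [:: z; conjc z] | z <- b]) (y - z)| *
     `|\prod_(y <- flatten [seq [:: z; conjc z] | z <- b]) (y - conjc z)| =
     (\prod_(y <- flatten [seq [:: z; conjc z] | z <- b]) (y - z)) *
     \prod_(y <- flatten [seq [:: z; conjc z] | z <- b]) (y - conjc z).
    elim: b {IH} => [|u b IH] /=; first by rewrite !big_nil normr1 mulr1.
    rewrite !big_cons !normrM; move: IH.
    set p := \prod_(_ <- _) _; set p' := \prod_(_ <- _) _ => IH.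
    have := ge0_mul_conj z u; have := ge0_mul_conj (conjc z) u; rewrite !normrM conjcK => e1 e2.
    transitivity ((`|u - z| * `|conjc u - conjc z|) * (`|u - conjc z| * `|conjc u - z|) * (`|p| * `|p'|)).
      by ring.
    by rewrite e1 e2 IH; ring.
  set p := \prod_(y <- flatten _) (y - z) in E *.
  set p' := \prod_(y <- flatten _) (y - conjc z) in E *.
  set e := diff_prod _; set f := \prod_(z <- b) _.
  transitivity (pair_sign z * (conjc z - z) * (`|p| * `|p'|) * (1%:C * f * e)); first by ring.
  by rewrite E; ring.
rewrite -/(conj_points a b) normrM IH rmorphM.
have -> : `|\prod_(y <- conj_points a b) (y - x%:C)| =
   (\prod_(y <- a) Num.sg (y - x))%:C * \prod_(y <- conj_points a b) (y - x%:C).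
  rewrite /conj_points !big_cat normrM /= mulrA; congr (_ * _).
    rewrite big_map normr_prod rmorph_prod -big_split /=.
    by apply: eq_bigr => y _; rewrite norm_real_diff.
  elim: b {IH} => [|u b IH] /=; first by rewrite !big_nil normr1.
  rewrite !big_cons !mulrA normrM IH; congr (_ * _).
  by have := ge0_mul_conj x%:C u; rewrite conjc_real.
by ring.
Qed.

Lemma normc_conj_points (a : seq R) (b : seq C) :
  (Normc.normc (vandermonde_det (conj_points a b)))%:C =
  (sg_vandermonde a)%:C * (\prod_(z <- b) pair_sign z) * vandermonde_det (conj_points a b).
Proof. by rewrite vandermonde_detE; exact: diff_prod_conj_points. Qed.

End ConjPoints.

Lemma multi_eval_multilinear d (T : measurableType d) (R : realType) N (v : T -> 'rV[R[i]]_N)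
    (F : seq 'rV[R[i]]_N -> R[i]) st (t : seq T) : multilinear F ->
  F (map v t ++ st) =
  multi_eval (fun k y => v y 0 k) (fun s => F (map (@basis_row R[i] N) s ++ st)) t.
Proof.
elim: t F => //= y t IH F linF; rewrite -[v y :: _]cat0s multilinear_basis //.
apply: eq_bigr => k _; rewrite (IH (fun us => F (basis_row R[i] k :: us))) //.
exact: (multilinear_cat linF [:: basis_row R[i] k]).
Qed.

(** * Nondegeneracy of the determinant on basis vectors *)

Section BasisDeterminant.
Variables (K : numFieldType) (N : nat).
Notation e := (@basis_row K N).

Lemma det_seq_basis_uniq (s : seq 'I_N) : size s = N -> uniq s -> det_seq (map e s) != 0.
Proof.
move=> es us; rewrite /det_seq size_map es eqxx.
case: N s es us => [|n] s es us; first by rewrite det_mx00 oner_eq0.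
have inj_s : injective (fun i : 'I_n.+1 => nth ord0 s i).
  move=> i j /eqP; rewrite nth_uniq ?es // => /eqP; exact: val_inj.
rewrite (_ : \matrix_(i < n.+1) _ = perm_mx (perm inj_s)).
  by rewrite det_perm signr_eq0.
apply/matrixP => i j; rewrite !mxE (nth_map ord0) ?es // mxE permE /=.
by rewrite eq_sym.
Qed.

Lemma alternating_dup (F : seq 'rV[K]_N -> K) us vs ws u :
  alternating F -> F (us ++ u :: vs ++ u :: ws) = 0.
Proof.
move=> altF; suff H vs' : F (us ++ u :: u :: vs') = 0.
  have := alternating_move altF (us ++ [:: u]) u vs ws.
  rewrite -!catA /= H => /esym/eqP; rewrite mulf_eq0 signr_eq0 /= => /eqP.
  by [].
have /eqP := altF us u u vs'; rewrite -subr_eq0 opprK -mulr2n mulrn_eq0 /=.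
by move=> /eqP.
Qed.

Lemma det_seq_basis_dup (F : seq 'rV[K]_N -> K) (s : seq 'I_N) :
  alternating F -> ~~ uniq s -> F (map e s) = 0.
Proof.
move=> altF; suff H us : ~~ uniq s -> F (us ++ map e s) = 0 by exact: (H [::]).
elim: s us => //= k s IH us; rewrite negb_and negbK => /orP[ks|/IH ns].
  by case/splitPr: ks => s1 s2; rewrite map_cat /= alternating_dup.
by rewrite -cat_rcons ns.
Qed.

(** Testing with all indices other than [k] isolates [u k], since any other first index is repeated.
    This is the nondegeneracy hypothesis of [multi_eval_integrable] for real points. *)
Lemma det_seq_nondegenerate (u : 'I_N -> K) :
  (forall s, (size s).+1 = N -> \sum_k u k * det_seq (e k :: map e s) = 0) ->
  forall k, u k = 0.
Proof.
move=> H k; pose s := rem k (enum 'I_N).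
have sz : (size s).+1 = N.
  by rewrite size_rem ?mem_enum // size_enum_ord prednK // (leq_trans _ (ltn_ord k)).
have us : uniq (k :: s) by rewrite /= rem_uniq ?enum_uniq // mem_rem_uniq ?enum_uniq // inE eqxx.
have := H s sz; rewrite (bigD1 k) //= big1 => [|j ne]; last first.
  rewrite -(map_cons e) det_seq_basis_dup ?mulr0 //; first exact: det_seq_alternating.
  rewrite /= negb_and negbK mem_rem_uniq ?enum_uniq // inE mem_enum.
  by rewrite ne.
move/eqP; rewrite addr0 mulf_eq0 -(map_cons e) (negPf (det_seq_basis_uniq _ us)) //.
by rewrite orbF => /eqP.
Qed.

(** The index set of a basis of 2-vectors. Minors indexed by all ordered pairs would be linearly
    dependent, and the integrability argument needs independent functions. *)
Definition ltn_pairs := {p in [pred p : 'I_N * 'I_N | (p.1 < p.2)%N]}.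

Lemma sum_ltn_pairs (a b : 'I_N -> K) (X : 'I_N -> 'I_N -> K) :
  (forall j k, X j k = - X k j) ->
  \sum_j \sum_k a j * b k * X j k =
  \sum_(i : ltn_pairs) (a (val i).1 * b (val i).2 - b (val i).1 * a (val i).2) *
     X (val i).1 (val i).2.
Proof.
move=> antiX; rewrite pair_bigA /=.
have X0 j : X j j = 0.
  by have /eqP := antiX j j; rewrite -subr_eq0 opprK -mulr2n mulrn_eq0 /= => /eqP.
rewrite (bigID (fun p : 'I_N * 'I_N => (p.1 < p.2)%N)) /=.
rewrite [X in _ + X](bigID (fun p : 'I_N * 'I_N => (p.2 < p.1)%N)) /=.
rewrite [X in _ + (_ + X)]big1 ?addr0; last first.
  move=> [j k] /= /andP[]; rewrite -!leqNgt => le1 le2.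
  by have -> : j = k; [apply: val_inj; apply/eqP; rewrite eqn_leq le1 le2|rewrite X0 mulr0].
rewrite [X in _ + X](reindex_inj (h := fun p : 'I_N * 'I_N => (p.2, p.1))) /=; last first.
  by move=> [a1 b1] [a2 b2] [-> ->].
rewrite [X in _ + X](eq_bigl (fun p : 'I_N * 'I_N => (p.1 < p.2)%N)); last first.
  by move=> [j k] /=; case: ltngtP.
rewrite -big_split /= -(big_sub [pred p : 'I_N * 'I_N | (p.1 < p.2)%N]
  (fun p => (a p.1 * b p.2 - b p.1 * a p.2) * X p.1 p.2)).
by apply: eq_bigr => -[j k] _ /=; rewrite (antiX k j); ring.
Qed.

End BasisDeterminant.

Section ComplexPolynomials.
Context d (T : measurableType d) (R : realType).
Notation C := R[i].

Lemma cmeasurable_exp (f : T -> C) n : cmeasurable f -> cmeasurable (fun t => f t ^+ n).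
Proof.
move=> mf; elim: n => [|n IH].
  by under eq_fun => t do rewrite expr0; exact: cmeasurable_cst.
by under eq_fun => t do rewrite exprS; exact: cmeasurableM.
Qed.

Lemma cmeasurable_horner (P : {poly C}) (f : T -> C) :
  cmeasurable f -> cmeasurable (fun t => P.[f t]).
Proof.
move=> mf; under eq_fun => t do rewrite horner_coef.
apply: cmeasurable_sum => i; apply: cmeasurableM; first exact: cmeasurable_cst.
exact: cmeasurable_exp.
Qed.

Lemma cmeasurable_conjc (f : T -> C) : cmeasurable f -> cmeasurable (fun t => conjc (f t)).
Proof.
move=> [rf jf]; split.
  by rewrite (_ : (fun t => _) = (fun t => complex.Re (f t))) //; apply/funext => t; case: (f t).
rewrite (_ : (fun t => _) = (fun t => - complex.Im (f t))).
  exact: measurableT_comp.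
by apply/funext => t; case: (f t).
Qed.

End ComplexPolynomials.

(** * Zeros of polynomials in the plane *)

Section PolynomialZeros.
Variable R : realType.
Notation C := R[i].

Lemma finite_real_roots (P : {poly C}) : P != 0 ->
  finite_set [set y : R | P.[y%:C] = 0].
Proof.
move=> P0; have [r Pr] := closed_field_poly_normal P.
apply: (@sub_finite_set _ _ [set` [seq complex.Re z | z <- r]]); last exact: finite_seq.
move=> y /= /eqP; rewrite Pr hornerZ mulf_eq0 lead_coef_eq0 (negPf P0) /=.
by rewrite -/(root _ _) root_prod_XsubC => yr; apply/mapP; exists y%:C.
Qed.

Lemma ae_polynomial_neq0 (P : {poly C}) : P != 0 ->
  {ae @lebesgue_measure R, forall y, P.[y%:C] != 0}.
Proof.
move=> P0; have fin := finite_real_roots P0.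
exists [set y : R | P.[y%:C] = 0]; split.
- by apply: countable_measurable; [exact: measurable_set1|exact: finite_set_countable].
- exact/countable_lebesgue_measure0/finite_set_countable.
- by move=> y /= /negP; rewrite negbK => /eqP.
Qed.

Variables (N : nat) (q : 'I_N -> {poly R}).
Hypotheses (q_monic : forall n, q n \is monic) (q_size : forall n : 'I_N, size (q n) = n.+1).

Definition cpoly k : {poly C} := map_poly (real_complex R) (q k).

Lemma cpoly_free (c : 'I_N -> C) : \sum_k c k *: cpoly k = 0 -> forall k, c k = 0.
Proof.
move=> s0 k0; apply/eqP; apply: contraT => ck0.
case: (@arg_maxnP _ k0 (fun k => c k != 0) (fun k => nat_of_ord k) ck0) => k ck maxk.
have /(congr1 (fun P : {poly C} => P`_k)) := s0.
rewrite coef0 coef_sum (bigD1 k) //= big1 ?addr0 => [|j ne].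
  rewrite coefZ coef_map; have /monicP := q_monic k; rewrite lead_coefE q_size /= => ->.
  by rewrite rmorph1 mulr1 => /eqP; rewrite (negPf ck).
rewrite coefZ coef_map; have [lt_kj|le_jk] := ltnP k j.
  have -> : c j = 0; last by rewrite mul0r.
  by apply/eqP; apply: contraTT lt_kj => /maxk; rewrite -leqNgt.
by rewrite nth_default ?rmorph0 ?mulr0 // q_size ltn_neqAle le_jk andbT.
Qed.

Definition cform (c : ltn_pairs N -> C) (a b : C) : C :=
  \sum_i ((cpoly (val i).1).[a] * (cpoly (val i).2).[b] -
          (cpoly (val i).1).[b] * (cpoly (val i).2).[a]) * c i.

(** The coefficients are extended by 0 and antisymmetrized to a full matrix [X]. The independence of
    the polynomials then applies in each variable separately. *)
Lemma cform_free c : (forall a b, cform c a b = 0) -> forall i, c i = 0.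
Proof.
move=> c0.
pose X j k : C := (if insub (j, k) is Some i then c i else 0) - (if insub (k, j) is Some i then c i else 0).
have Xval (i : ltn_pairs N) : X (val i).1 (val i).2 = c i.
  rewrite /X -surjective_pairing valK insubF ?subr0 //.
  by apply/negbTE; rewrite inE /= -leqNgt ltnW //; exact: (valP i).
have antiX j k : X j k = - X k j by rewrite /X opprB.
have X0 (a b : C) : \sum_j \sum_k (cpoly j).[a] * (cpoly k).[b] * X j k = 0.
  rewrite (sum_ltn_pairs (fun j => (cpoly j).[a]) (fun k => (cpoly k).[b]) antiX).
  by rewrite -[RHS](c0 a b); apply: eq_bigr => i _; rewrite Xval.
have inj0 (P : {poly C}) : (forall a : C, P.[a] = 0) -> P = 0.
  move=> P0; apply/eqP; apply: contraT => nP0.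
  have := @max_poly_roots _ P [seq i%:R | i <- iota 0 (size P)] nP0.
  rewrite size_map size_iota ltnn => -> //.
    by apply/allP => x _; apply/eqP/P0.
  by rewrite map_inj_uniq ?iota_uniq // => i j /eqP; rewrite eqr_nat => /eqP.
move=> i; rewrite -Xval.
have row j : \sum_k X j k *: cpoly k = 0.
  apply: (inj0 _) => b; move: j; apply: cpoly_free; apply: (inj0 _) => a.
  rewrite -[RHS](X0 a b) horner_sum; apply: eq_bigr => j _.
  rewrite hornerZ horner_sum mulr_suml; apply: eq_bigr => k _.
  by rewrite hornerZ; ring.
exact: (cpoly_free (row _)).
Qed.

End PolynomialZeros.

Section PlaneZeros.
Variable R : realType.
Notation C := R[i].
Variables (N : nat) (q : 'I_N -> {poly R}).
Hypotheses (q_monic : forall n, q n \is monic) (q_size : forall n : 'I_N, size (q n) = n.+1).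

Lemma cmeasurable_toC : cmeasurable (@toC R).
Proof. by split => /=; [exact: measurable_fst|exact: measurable_snd]. Qed.

Let line (a b : C) : {poly C} := a%:P + b *: 'X.

Let line_eval a b y : (line a b).[y] = a + b * y.
Proof. by rewrite hornerD hornerC hornerZ hornerX. Qed.

Let cpoly_line (c : ltn_pairs N -> C) a b a' b' : {poly C} := \sum_i
  ((cpoly q (val i).1 \Po line a b) * (cpoly q (val i).2 \Po line a' b') -
   (cpoly q (val i).1 \Po line a' b') * (cpoly q (val i).2 \Po line a b)) * (c i)%:P.

Let cpoly_line_eval c a b a' b' y :
  (cpoly_line c a b a' b').[y] = cform q c (a + b * y) (a' + b' * y).
Proof.
rewrite horner_sum; apply: eq_bigr => i _.
by rewrite hornerM hornerC hornerD hornerN !hornerM !horner_comp !line_eval.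
Qed.

(** With [z = x + i y] the form is a polynomial in [x] and [y]. Some complex [y0] makes it a nonzero
    polynomial in [x]; for all real [x] but finitely many it is then nonzero at [(x, y0)], hence a
    nonzero polynomial in [y] with finitely many real roots. So almost every vertical section of the
    zero set is finite, and the set is null. *)
Lemma ae_cform_neq0 (c : ltn_pairs N -> C) i : c i != 0 ->
  {ae (@lebesgue_measure R \x @lebesgue_measure R)%E,
     forall p : R * R, cform q c (toC p) (conjc (toC p)) != 0}.
Proof.
move=> ci.
have [y0 r0] : exists y0, cpoly_line c ('i * y0) 1 (- ('i * y0)) 1 != 0.
  apply: contrapT => H; move/negP: ci; apply; apply/eqP.
  apply: (cform_free q_monic q_size) => a b.
  have i2 : ('i : C) * 2 != 0 by rewrite mulf_neq0 ?pnatr_eq0 // neq0Ci.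
  (* Over the complex numbers every pair [(a, b)] has the form [(x + i y, x - i y)]; hence vanishing
     for all complex [y] would make the form vanish identically. *)
  pose y := (a - b) / ('i * 2); pose x := (a + b) / 2.
  have -> : a = 'i * y + 1 * x by rewrite /y /x; field; rewrite neq0Ci.
  have -> : b = - ('i * y) + 1 * x by rewrite /y /x; field; rewrite neq0Ci.
  rewrite -cpoly_line_eval.
  suff -> : cpoly_line c ('i * y) 1 (- ('i * y)) 1 = 0 by rewrite horner0.
  by apply/eqP/negP => /negP ne; apply: H; exists y.
have toCE (p : R * R) : toC p = p.1%:C + 'i * p.2%:C.
  by rewrite /toC -complexiE; apply/eqP; rewrite eq_complex /=; apply/andP; split; apply/eqP; ring.
have toCJ (p : R * R) : conjc (toC p) = p.1%:C + - 'i * p.2%:C.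
  by rewrite /toC -complexiE; apply/eqP; rewrite eq_complex /=; apply/andP; split; apply/eqP; ring.
pose Z := [set p : R * R | cform q c (toC p) (conjc (toC p)) = 0].
have mZ : measurable Z.
  have [mr mi] : cmeasurable (fun p : R * R => cform q c (toC p) (conjc (toC p))).
    have mt := cmeasurable_toC; have mj := cmeasurable_conjc mt.
    apply: cmeasurable_sum => k; apply: cmeasurableM; last exact: cmeasurable_cst.
    apply: cmeasurableD; first by apply: cmeasurableM; exact: cmeasurable_horner.
    under eq_fun => p do rewrite -mulN1r.
    apply: cmeasurableM; first exact: cmeasurable_cst.
    by apply: cmeasurableM; exact: cmeasurable_horner.
  rewrite (_ : Z = (setT `&` (fun p : R * R => complex.Re (cform q c (toC p) (conjc (toC p)))) @^-1` [set 0]) `&`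
    (setT `&` (fun p : R * R => complex.Im (cform q c (toC p) (conjc (toC p)))) @^-1` [set 0])).
    by apply: measurableI; [apply: mr|apply: mi] => //; exact: measurable_set1.
  apply/seteqP; split => p; rewrite /Z /preimage /=.
    by move=> ->.
  by move=> [[_ e1] [_ e2]]; apply: Re_Im_inj.
have Z0 : (@lebesgue_measure R \x @lebesgue_measure R)%E Z = 0%E.
  rewrite /product_measure1 -[RHS](@integral0 _ _ _ (@lebesgue_measure R) setT).
  apply: ge0_ae_eq_integral => //.
  - exact: measurable_fun_xsection.
  - have [A [mA A0 sA]] := ae_polynomial_neq0 r0.
    exists A; split => // x nx; apply: sA => rx; apply: nx => _ /=.
    pose P := cpoly_line c x%:C 'i x%:C (- 'i).
    have P0 : P != 0.
      apply: contraNneq rx => P0; have := cpoly_line_eval c x%:C 'i x%:C (- 'i) y0.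
      rewrite -/P P0 horner0 cpoly_line_eval mulNr !mul1r => e.
      by rewrite e -!(addrC x%:C).
    apply: countable_lebesgue_measure0; apply: finite_set_countable.
    apply: sub_finite_set (finite_real_roots P0) => y.
    rewrite /xsection /mkset inE /Z /mkset toCJ toCE => zy.
    by rewrite /P cpoly_line_eval.
exists Z; split => //.
by move=> p /= /negP; rewrite negbK => /eqP.
Qed.

End PlaneZeros.

(* [lebesgue_measure] lives on the generated sigma-algebra type [measurableTypeR R];
   the definitions integrate over [R] with its default measurable structure, which
   has the same measurable sets. *)
Section LineAndPlane.
Variable R : realType.

Definition line_measure : set R -> \bar R := @leb1 R.

Let line_measure0 : line_measure set0 = 0%E.
Proof. exact: (measure0 (@lebesgue_measure R)). Qed.
Let line_measure_ge0 A : (0 <= line_measure A)%E.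
Proof. exact: (measure_ge0 (@lebesgue_measure R)). Qed.
Let line_measure_sigma_additive : semi_sigma_additive line_measure.
Proof. exact: (@measure_semi_sigma_additive _ _ _ (@lebesgue_measure R)). Qed.

HB.instance Definition _ := isMeasure.Build _ _ _ line_measure
  line_measure0 line_measure_ge0 line_measure_sigma_additive.

Let line_measure_sigma_finite : sigma_finite setT line_measure.
Proof. exact: (@sigma_finiteT _ _ _ (@lebesgue_measure R)). Qed.

HB.instance Definition _ := Measure_isSigmaFinite.Build _ _ _ line_measure
  line_measure_sigma_finite.

Definition plane_measure : set (R * R) -> \bar R := @leb2 R.

Let product_measure := (@lebesgue_measure R \x @lebesgue_measure R)%E.
Let plane_measure0 : plane_measure set0 = 0%E.
Proof. exact: (measure0 product_measure). Qed.
Let plane_measure_ge0 A : (0 <= plane_measure A)%E.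
Proof. exact: (measure_ge0 product_measure). Qed.
Let plane_measure_sigma_additive : semi_sigma_additive plane_measure.
Proof. exact: (@measure_semi_sigma_additive _ _ _ product_measure). Qed.

HB.instance Definition _ := isMeasure.Build _ _ _ plane_measure
  plane_measure0 plane_measure_ge0 plane_measure_sigma_additive.

Let plane_measure_sigma_finite : sigma_finite setT plane_measure.
Proof. exact: (sigma_finite_product (@lebesgue_measure R) (@lebesgue_measure R)). Qed.

HB.instance Definition _ := Measure_isSigmaFinite.Build _ _ _ plane_measure
  plane_measure_sigma_finite.

Lemma tuple_line_measure n : tuple_measure (@leb1 R) n = tmeasure line_measure n.
Proof. exact: (tmeasureE line_measure). Qed.

Lemma tuple_plane_measure n : tuple_measure (@leb2 R) n = tmeasure plane_measure n.
Proof. exact: (tmeasureE plane_measure). Qed.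

End LineAndPlane.

(** A zero sign means that two real points coincide, and then [F] has two equal arguments. *)
Lemma alternating_sg_vandermonde0 (R : realType) N (v : R -> 'rV[R[i]]_N)
    (F : seq 'rV[R[i]]_N -> R[i]) (X : seq R) st : alternating F ->
  sg_vandermonde X = 0 -> F (map v X ++ st) = 0.
Proof.
move=> altF; suff H us : sg_vandermonde X = 0 -> F (us ++ map v X ++ st) = 0.
  exact: (H [::]).
elim: X us => [us /eqP|x X IH us /= /eqP]; first by rewrite oner_eq0.
rewrite mulf_eq0 => /orP[|/eqP x0]; last by rewrite -cat_rcons IH.
rewrite prodf_seq_eq0 => /hasP[y yX]; rewrite /= sgr_eq0 subr_eq0 => /eqP yx.
rewrite {}yx in yX; case/splitPr: yX => s1 s2.
by rewrite map_cat -catA /= alternating_dup.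
Qed.

Lemma sg_vandermondeE (R : realDomainType) (X : seq R) :
  sg_vandermonde X = Num.sg (diff_prod X).
Proof.
elim: X => [|x X IH] /=; first by rewrite sgr1.
rewrite sgrM -IH; congr (_ * _).
by elim: X {IH} => [|y X IH]; rewrite ?big_nil ?sgr1 // !big_cons sgrM IH.
Qed.

(** * The joint densities as determinants *)

Section Model.
Variables (R : realType) (N : nat) (w : R[i] -> R) (q : 'I_N -> {poly R}).
Notation C := R[i].
Notation V := 'rV[C]_N.
Hypotheses (q_monic : forall n, q n \is monic) (q_size : forall n : 'I_N, size (q n) = n.+1).
Notation e := (@basis_row C N).

Definition poly_row (c : C) : V := \row_k poly_fun (q k) c.

Definition real_row (x : R) : V := (w x%:C)%:C *: poly_row x%:C.

Definition conj_rows (b : seq C) : seq V :=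
  flatten [seq [:: poly_row z; poly_row z^*] | z <- b].

Definition pair_weight (z : C) : C := pair_sign z * (w z)%:C.

(** A weighted 2-by-2 minor of the rows at [z] and its conjugate. It is also the integrand of the
    non-real part of the skew form, weight included. *)
Definition pair_form (j k : 'I_N) (z : C) : C :=
  pair_weight z * (poly_fun (q j) z * poly_fun (q k) z^* - poly_fun (q j) z^* * poly_fun (q k) z).

(** As the polynomials are monic with [deg q_n = n], the change of basis from the monomials is
    triangular with ones on the diagonal. *)
Lemma vandermonde_det_seq (s : seq C) : size s = N ->
  vandermonde_det s = det_seq (map poly_row s).
Proof.
move=> es; rewrite /det_seq size_map es eqxx.
pose W := \matrix_(i < N, j < N) s`_i ^+ j.
have -> : vandermonde_det s = \det W by rewrite /vandermonde_det /W es.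
pose T : 'M[C]_N := \matrix_(j, k) (cpoly q k)`_j.
have -> : \matrix_(i < N) nth 0 (map poly_row s) i = W *m T.
  apply/matrixP => i k; rewrite !mxE (nth_map 0) ?es // mxE /poly_fun -/(cpoly q k).
  rewrite (@horner_coef_wide _ N); last by rewrite size_map_poly q_size.
  by apply: eq_bigr => j _; rewrite !mxE mulrC.
have trigT : is_trig_mx T^T.
  apply/is_trig_mxP => j k lt_jk; rewrite !mxE coef_map nth_default ?rmorph0 //.
  by rewrite q_size.
rewrite det_mulmx -[\det T]det_tr (det_trig trigT) big1 ?mulr1 // => k _.
rewrite !mxE coef_map; have /monicP := q_monic k.
by rewrite lead_coefE q_size /= => ->; rewrite rmorph1.
Qed.

Lemma det_seq_real_row (F : seq V -> C) (a : seq R) st : multilinear F ->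
  F (map real_row a ++ st) =
  (\prod_(t <- a) w t%:C)%:C * F (map poly_row [seq t%:C | t <- a] ++ st).
Proof.
elim: a F => [|t a IH] F linF /=; first by rewrite big_nil mul1r.
rewrite big_cons rmorphM -[real_row t :: _]cat0s multilinearZ //= -mulrA; congr (_ * _).
exact: (IH _ (multilinear_cat linF [:: poly_row t%:C])).
Qed.

Definition weighted_det (a : seq R) (st : seq V) (b : seq C) : C :=
  (\prod_(z <- b) pair_weight z) * det_seq (map real_row a ++ st ++ conj_rows b).

Lemma size_conj_points (a : seq R) (b : seq C) :
  size (conj_points a b) = (size a + 2 * size b)%N.
Proof.
rewrite /conj_points size_cat size_map; congr (_ + _)%N.
by elim: b => //= z b IH; rewrite IH mulnS.
Qed.

Lemma OmegaE (a : seq R) (b : seq C) : (size a + 2 * size b = N)%N ->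
  (Omega w a b)%:C = 2 ^+ size b * ((sg_vandermonde a)%:C * weighted_det a [::] b).
Proof.
move=> eN.
rewrite /Omega 3!rmorphM rmorphXn /= rmorph_nat normc_conj_points vandermonde_det_seq ?size_conj_points //.
rewrite /weighted_det det_seq_real_row; last exact: det_seq_multilinear.
have -> : \prod_(z <- b) pair_weight z = (\prod_(z <- b) pair_sign z) * (\prod_(z <- b) w z)%:C.
  by rewrite rmorph_prod -big_split.
have -> : map poly_row (conj_points a b) = map poly_row [seq t%:C | t <- a] ++ conj_rows b.
  rewrite /conj_points map_cat; congr (_ ++ _).
  by elim: b {eN} => //= z b ->.
by ring.
Qed.

Lemma normc_weighted_det (a : seq R) (b : seq C) : (forall c, 0 <= w c) ->
  (size a + 2 * size b = N)%N ->
  2 ^+ size b * Normc.normc (weighted_det a [::] b) = Omega w a b.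
Proof.
move=> w0 eN; have Om0 : 0 <= Omega w a b.
  by rewrite /Omega !mulr_ge0 ?exprn_ge0 ?normc_ge0 ?prodr_ge0.
apply: complexI; rewrite -[RHS]ger0_norm ?lecR // OmegaE //.
rewrite 2!normrM normrX normr_nat rmorphM rmorphXn /= rmorph_nat; congr (_ * _).
have nsg : `|(sg_vandermonde a)%:C| = `|sg_vandermonde a|%:C :> C.
  by rewrite normc_def /= expr0n /= addr0 sqrtr_sqr.
rewrite nsg sg_vandermondeE normr_sg -sgr_eq0 -sg_vandermondeE.
(* The sign has modulus 1 unless real points coincide; in that case the determinant vanishes too. *)
have [a0|_] := eqVneq (sg_vandermonde a) 0; last by rewrite mul1r.
have -> : weighted_det a [::] b = 0; last by rewrite normr0 mulr0 Normc.normc0.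
rewrite /weighted_det /=.
by rewrite (alternating_sg_vandermonde0 _ _ (@det_seq_alternating _ N) a0) mulr0.
Qed.

Lemma pair_expansion (F : seq V -> C) us ws z : multilinear F -> alternating F ->
  pair_weight z * F (us ++ [:: poly_row z, poly_row z^* & ws]) =
  \sum_(i : ltn_pairs N) pair_form (val i).1 (val i).2 z *
     F (us ++ [:: e (val i).1, e (val i).2 & ws]).
Proof.
move=> linF altF; rewrite multilinear_basis // mulr_sumr.
transitivity (pair_weight z * \sum_j \sum_k poly_row z 0 j * poly_row z^* 0 k *
   F (us ++ [:: e j, e k & ws])).
  rewrite mulr_sumr; apply: eq_bigr => j _; congr (_ * _).
  rewrite -cat_rcons multilinear_basis // mulr_sumr; apply: eq_bigr => k _.
  by rewrite cat_rcons mulrA.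
rewrite (sum_ltn_pairs _ _ (fun j k => altF us (e j) (e k) ws)) mulr_sumr.
by apply: eq_bigr => i _; rewrite /pair_form !mxE; ring.
Qed.

Definition pair_rows (s : seq (ltn_pairs N)) : seq V :=
  flatten [seq [:: e (val i).1; e (val i).2] | i <- s].

Lemma conj_rows_expansion (F : seq V -> C) us (b : seq (R * R)) :
  multilinear F -> alternating F ->
  (\prod_(p <- b) pair_weight (toC p)) * F (us ++ conj_rows [seq toC p | p <- b]) =
  multi_eval (fun i p => pair_form (val i).1 (val i).2 (toC p))
    (fun s => F (us ++ pair_rows s)) b.
Proof.
move=> linF altF; elim: b us => [|p b IH] us; first by rewrite big_nil mul1r.
rewrite big_cons /= -/(conj_rows _) mulrAC.
rewrite (pair_expansion us (conj_rows [seq toC p | p <- b]) _ linF altF).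
rewrite mulr_suml; apply: eq_bigr => i _; rewrite -mulrA [X in _ * X]mulrC.
congr (_ * _); have := IH (us ++ [:: e (val i).1; e (val i).2]).
rewrite -catA /= => ->; congr (multi_eval _ _ _); apply/funext => s.
by rewrite -catA.
Qed.

End Model.

(** If some [phi_i] were not integrable, the slices in the other points would satisfy a linear
    relation with coefficients [u], almost everywhere. Freeness of the [phi_i] transfers it to the
    tensor [B], where nondegeneracy forces [u = 0]. *)
Lemma multi_eval_integrable d (T : measurableType d) (R : realType)
    (mu : {sigma_finite_measure set T -> \bar R}) (I : finType) (phi : I -> T -> R[i])
    (h : nat) (B : seq I -> R[i]) :
  (forall i, cmeasurable (phi i)) ->
  (forall c : I -> R[i], {ae mu, forall t, \sum_i phi i t * c i = 0} -> forall i, c i = 0) ->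
  (forall u : I -> R[i], (forall s, size s = h -> \sum_i u i * B (i :: s) = 0) ->
     forall i, u i = 0) ->
  (\int[tmeasure mu h.+1]_t (Normc.normc (multi_eval phi B t))%:E < +oo)%E ->
  forall i, cintegrable mu (phi i).
Proof.
move=> mphi free nondeg fin.
have mg i := cmeasurable_multi_eval mphi h (fun s => B (i :: s)).
have [] // := @cintegrable_or_dependent _ _ _ _ _ mu (tmeasure mu h) I phi
  (fun i t => multi_eval phi (fun s => B (i :: s)) t) mphi mg.
  move: fin; rewrite tonelli_tmeasure_swap //.
  - exact/measurable_EFinP/measurable_normc/cmeasurable_multi_eval.
  - by move=> t; rewrite lee_fin normc_ge0.
move=> [u [[i ui]]] dep; case/negP: ui; apply/eqP; apply: nondeg => s es.
apply: (multi_eval_ae0 mphi free (B := fun s => \sum_i u i * B (i :: s)) _ es).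
apply: filterS dep => t; rewrite multi_eval_sum => e; rewrite -[RHS]e.
by apply: eq_bigr => j _; rewrite mulrC.
Qed.

Section PairNondegenerate.
Variables (R : realType) (N : nat).
Notation C := R[i].
Notation e := (@basis_row C N).

Definition pair_indices (s : seq (ltn_pairs N)) : seq 'I_N :=
  flatten [seq [:: (val i).1; (val i).2] | i <- s].

Lemma pair_rowsE s : pair_rows R s = map e (pair_indices s).
Proof. by rewrite /pair_rows /pair_indices map_flatten -map_comp. Qed.

Lemma sorted_pair_indices (r : seq 'I_N) : sorted (fun j k : 'I_N => j < k)%N r -> ~~ odd (size r) ->
  exists2 s, r = pair_indices s & size r = (2 * size s)%N.
Proof.
have [n] := ubnP (size r); elim: n r => // n IH [|j [|k r]] //; first by exists [::].
rewrite /= !ltnS negbK => lt_n /andP[lt_jk sr] ev.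
have [|||s -> ->] := IH r; [by lia|exact: path_sorted sr|by []|].
by exists (exist _ (j, k) lt_jk :: s) => //=; lia.
Qed.

(** The indices outside the pair [i] are listed in increasing order and grouped two by two. Any pair
    [j] other than [i] then meets one of the listed indices, and its determinant vanishes by
    repetition. *)
Lemma det_pair_rows_nondegenerate h (u : ltn_pairs N -> C) : (2 * h.+1)%N = N ->
  (forall s, size s = h -> \sum_i u i * det_seq (pair_rows R (i :: s)) = 0) ->
  forall i, u i = 0.
Proof.
move=> eN H i; pose r := [seq k <- enum 'I_N | k \notin [:: (val i).1; (val i).2]].
have ur : uniq ([:: (val i).1; (val i).2] ++ r).
  rewrite cat_uniq filter_uniq ?enum_uniq // andbT /= inE andbT; apply/andP; split.
    by rewrite neq_ltn; apply/orP; left; exact: (valP i).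
  by apply/hasPn => k; rewrite mem_filter => /andP[].
have sr : size ([:: (val i).1; (val i).2] ++ r) = N.
  rewrite -[RHS](size_enum_ord N); apply/eqP.
  rewrite -(uniq_size_uniq (enum_uniq _)) ?ur // => k.
  by rewrite mem_enum mem_cat mem_filter mem_enum andbT orbN.
have [||s es sz] := @sorted_pair_indices r.
- apply: sorted_filter; first by move=> a b c; exact: ltn_trans.
  rewrite -(@sorted_map _ _ val ltn) val_enum_ord; exact: iota_ltn_sorted.
- by have /esym := congr1 odd sr; rewrite -[X in odd X]eN mul2n odd_double size_cat /= negbK => <-.
have sh : size s = h.
  move: sr; rewrite size_cat sz [size [:: _; _]]/=; move: (size s) => a; move: eN.
  by clear; lia.
have := H s sh; rewrite (bigD1 i) //= big1 => [|j ne]; last first.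
  rewrite pair_rowsE det_seq_basis_dup ?mulr0 //; first exact: det_seq_alternating.
  rewrite /= -/(pair_indices s) -es; apply: contraNN ne => uj.
  have in_i k : k \in [:: (val j).1; (val j).2] -> k \in [:: (val i).1; (val i).2].
    have : uniq ([:: (val j).1; (val j).2] ++ r) by [].
    rewrite cat_uniq => /and3P[_ /hasPn nr _].
    by move=> kj; apply: contraT => ki; have := nr k; rewrite mem_filter ki mem_enum kj => /(_ isT).
  have := in_i (val j).1; have := in_i (val j).2; rewrite !inE !eqxx orbT => /(_ isT) j2 /(_ isT) j1.
  have lt_j : ((val j).1 < (val j).2)%N := valP j.
  have lt_i : ((val i).1 < (val i).2)%N := valP i.
  apply/eqP/val_inj; rewrite [RHS]surjective_pairing [LHS]surjective_pairing.
  by case/orP: j1 j2 lt_j lt_i => /eqP -> /orP[] /eqP -> //; rewrite ?ltnn // => /ltn_trans h1 /h1; rewrite ltnn.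
have ei : [:: (val i).1; (val i).2] ++ r = pair_indices (i :: s) by rewrite es.
rewrite ei in ur sr.
by move/eqP; rewrite addr0 pair_rowsE mulf_eq0 (negPf (det_seq_basis_uniq _ sr ur)) orbF => /eqP.
Qed.

End PairNondegenerate.

Lemma cintegrable_ae0 d (T : measurableType d) (R : realType)
    (mu : {measure set T -> \bar R}) (f : T -> R[i]) : cmeasurable f ->
  {ae mu, forall t, f t = 0} -> cintegrable mu f.
Proof.
move=> mf f0; apply: cintegrable_normc => //.
rewrite (ae_eq_integral (fun=> 0%E)) ?integral0 ?ltry //.
- exact/measurable_EFinP/measurable_normc.
- by apply: filterS f0 => t /= -> _; rewrite Normc.normc0.
Qed.

Lemma multi_evalZ d (T : measurableType d) (R : realType) (I : finType)
    (phi : I -> T -> R[i]) a (B : seq I -> R[i]) t :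
  multi_eval phi (fun s => a * B s) t = a * multi_eval phi B t.
Proof.
elim: t B => //= y t IH B; rewrite mulr_sumr.
by apply: eq_bigr => i _; rewrite (IH (fun s => B (i :: s))) mulrCA.
Qed.

Lemma ae_plane_nonreal (R : realType) : {ae @plane_measure R, forall p : R * R, p.2 != 0}.
Proof.
have m0 : measurable ([set 0] : set R) by exact: measurable_set1.
exists ([set: R] `*` [set 0]); split.
- exact: measurableX.
- rewrite /plane_measure /leb2.
  have -> := product_measure1E (@lebesgue_measure R) (@lebesgue_measure R)
    (@measurableT _ R) m0.
  apply: etrans (mule0 _); congr (_ * _)%E; exact: lebesgue_measure_set1.
- by move=> [x y] /= /negP; rewrite negbK => /eqP ->.
Qed.

(** * Integrability of the moments *)

Section Integrability.
Variables (R : realType) (N : nat) (w : R[i] -> R) (q : 'I_N -> {poly R}).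
Notation C := R[i].
Notation V := 'rV[C]_N.
Hypotheses (w_ge0 : forall c : R[i], 0 <= w c)
  (w_measurable : measurable_fun [set: R * R] (fun p : R * R => w (toC p)))
  (Z_fin : (partition_function N w < +oo)%E)
  (q_monic : forall n, q n \is monic) (q_size : forall n : 'I_N, size (q n) = n.+1)
  (N_even : ~~ odd N).

Local Notation line := (@line_measure R).
Local Notation plane := (@plane_measure R).

Lemma measurable_w_real : measurable_fun setT (fun x : R => w x%:C).
Proof.
have mp : measurable_fun setT (fun x : R => (x, 0 : R)) by exact: measurable_fun_pair.
exact: (measurableT_comp w_measurable mp).
Qed.

Lemma cmeasurable_real_row k : cmeasurable (fun x => real_row w q x 0 k).
Proof.
under eq_fun => x do rewrite !mxE.
apply: cmeasurableM; first exact: (cmeasurable_real measurable_w_real).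
apply: (@cmeasurable_horner _ R R); apply: (cmeasurable_real (u := id)).
exact: measurable_id.
Qed.

Lemma cmeasurable_pair_form j k : cmeasurable (fun p : R * R => pair_form w q j k (toC p)).
Proof.
have mt := @cmeasurable_toC R; have mj := cmeasurable_conjc mt.
apply: cmeasurableM.
  apply: cmeasurableM; last exact: cmeasurable_real.
  apply: cmeasurableM; first exact: cmeasurable_cst.
  apply: cmeasurable_real; apply: (measurableT_comp (@measurable_sg R)).
  exact: measurable_snd.
apply: cmeasurableD; first by apply: cmeasurableM; exact: cmeasurable_horner.
under eq_fun => p do rewrite -mulN1r.
apply: cmeasurableM; first exact: cmeasurable_cst.
by apply: cmeasurableM; exact: cmeasurable_horner.
Qed.

Lemma partition_term_fin n p : (n + 2 * p = N)%N ->
  (\int[tmeasure line n]_a \int[tmeasure plane p]_b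
     (Omega w a [seq toC t | t <- b])%:E < +oo)%E.
Proof.
move=> e; have ltn : (n < N.+1)%N by lia.
have ltp : (p < N.+1)%N by lia.
have I0 a b : (0 <= \int[tmeasure line a]_x \int[tmeasure plane b]_y
     (Omega w x [seq toC t | t <- y])%:E)%E.
  apply: integral_ge0 => x _; apply: integral_ge0 => y _.
  by rewrite lee_fin /Omega !mulr_ge0 ?exprn_ge0 ?normc_ge0 ?prodr_ge0.
move: Z_fin; rewrite /partition_function.
rewrite (bigD1 (Ordinal ltn, Ordinal ltp)) /=; last exact/eqP.
rewrite !tuple_line_measure !tuple_plane_measure => Zf.
have {Zf}: ((((n`! * p`! * 2 ^ p)%:R)^-1)%:E *
   \int[tmeasure line n]_a \int[tmeasure plane p]_b
     (Omega w a [seq toC t | t <- b])%:E < +oo)%E.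
  apply: le_lt_trans Zf; rewrite leeDl //; apply: sume_ge0 => i _.
  rewrite tuple_line_measure tuple_plane_measure; apply: mule_ge0; last exact: I0.
  by rewrite lee_fin invr_ge0 ler0n.
have c0 : 0 < ((n`! * p`! * 2 ^ p)%:R)^-1 :> R.
  by rewrite invr_gt0 ltr0n !muln_gt0 !fact_gt0 expn_gt0.
by rewrite !ltey; apply: contraNN => /eqP ->; rewrite gt0_muley.
Qed.

Lemma OmegaE_normc (a : seq R) (b : seq C) : (size a + 2 * size b)%N = N ->
  Omega w a b = Normc.normc (2 ^+ size b * weighted_det w q a [::] b).
Proof.
move=> e; rewrite -(normc_weighted_det q_monic q_size w_ge0 e) [RHS]Normc.normcM; congr (_ * _).
apply: complexI; rewrite -[RHS]/`|2 ^+ size b : C| normrX normr_nat.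
by rewrite rmorphXn /= rmorph_nat.
Qed.

(** Only the term with [N] real points is used. The functions are free unless [w] vanishes almost
    everywhere on the line, since a nonzero polynomial has finitely many real roots; in the
    exceptional case they are null. *)
Lemma real_row_integrable k : cintegrable line (fun x => real_row w q x 0 k).
Proof.
have [w0|wN0] := pselect {ae line, forall x, w x%:C = 0}.
  apply: cintegrable_ae0; first exact: cmeasurable_real_row.
  by apply: filterS w0 => x wx; rewrite mxE wx mul0r.
have [h eN] : exists h, N = h.+1.
  by exists N.-1; rewrite prednK // (leq_trans _ (ltn_ord k)).
move: k; apply: (@multi_eval_integrable _ _ _ line 'I_N _ h
  (fun s => det_seq (map (@basis_row C N) s ++ [::]))).
- exact: cmeasurable_real_row.
- move=> c ce; apply: (cpoly_free q_monic q_size (c := c)); apply/eqP.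
  apply: contraT => P0; case: wN0.
  have Pae : {ae line, forall y, (\sum_k c k *: cpoly q k).[y%:C] != 0} by exact: ae_polynomial_neq0.
  apply: filterS2 Pae ce => x Px.
  rewrite (eq_bigr (fun k => (w x%:C)%:C * (c k *: cpoly q k).[x%:C])) => [|k _]; last first.
    by rewrite !mxE hornerZ /poly_fun -/(cpoly q k); ring.
  rewrite -mulr_sumr -horner_sum => /eqP.
  by rewrite mulf_eq0 (negPf Px) orbF => /eqP [].
- move=> u Hu; apply: det_seq_nondegenerate => s es.
  have es' : size s = h by have /succn_inj := etrans es eN.
  rewrite -[RHS](Hu s es').
  by apply: eq_bigr => k _; rewrite cats0.
- have eN0 : (h.+1 + 2 * 0 = N)%N by rewrite muln0 addn0.
  apply: le_lt_trans (partition_term_fin eN0).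
  under [X in (_ <= X)%E]eq_integral => a _ do rewrite integral_tmeasure0 /= OmegaE_normc ?size_tuple ?muln0 ?addn0 //.
  rewrite le_eqVlt; apply/orP; left; apply/eqP; apply: eq_integral => a _.
  congr (_%:E); congr Normc.normc; rewrite mul1r /weighted_det big_nil mul1r.
  by rewrite (multi_eval_multilinear _ _ _ (@det_seq_multilinear _ N)).
Qed.

(** Only the term with [N / 2] complex pairs is used. Freeness comes from [ae_cform_neq0] and fails
    only if [w] vanishes almost everywhere on the plane, when the functions are null. *)
Lemma pair_form_integrable (i : ltn_pairs N) :
  cintegrable plane (fun p => pair_form w q (val i).1 (val i).2 (toC p)).
Proof.
have [w0|wN0] := pselect {ae plane, forall p, w (toC p) = 0}.
  apply: cintegrable_ae0; first exact: cmeasurable_pair_form.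
  by apply: filterS w0 => p wp; rewrite /pair_form /pair_weight wp mulr0 mul0r.
have [h eN] : exists h, (2 * h.+1)%N = N.
  exists (N./2).-1; have lt_i : ((val i).1 < (val i).2)%N := valP i.
  have N2 : (1 < N)%N by apply: leq_ltn_trans (ltn_ord (val i).2); apply: leq_ltn_trans lt_i.
  by rewrite prednK ?half_gt0 // mul2n -[RHS]odd_double_half (negPf N_even).
move: i; apply: (@multi_eval_integrable _ _ _ plane (ltn_pairs N) _ h
  (fun s => 2 ^+ h.+1 * det_seq (pair_rows R s))).
- by move=> i; exact: cmeasurable_pair_form.
- move=> c ce i; apply/eqP; apply: contraT => ci; case: wN0.
  have Pae : {ae plane, forall p : R * R, cform q c (toC p) (conjc (toC p)) != 0}.
    exact: (ae_cform_neq0 q_monic q_size ci).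
  have ae2 : {ae plane, forall p : R * R, p.2 != 0} by exact: ae_plane_nonreal.
  move: Pae ae2 ce; apply: filterS3 => p Pp p2.
  rewrite (_ : \sum__ _ = pair_weight w (toC p) * cform q c (toC p) (conjc (toC p))); last first.
    by rewrite mulr_sumr; apply: eq_bigr => j _; rewrite /pair_form mulrA.
  move/eqP; rewrite mulf_eq0 (negPf Pp) orbF /pair_weight /pair_sign !mulf_eq0.
  rewrite (negPf (neq0Ci _)) fmorph_eq0 sgr_eq0 (negPf p2) /= fmorph_eq0.
  by move/eqP.
- move=> u Hu; apply: (det_pair_rows_nondegenerate eN) => s es.
  have := Hu s es; under eq_bigr => j _ do rewrite mulrCA.
  rewrite -mulr_sumr => /eqP; rewrite mulf_eq0 expf_eq0 pnatr_eq0 /= => /eqP.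
  by [].
- apply: le_lt_trans (@partition_term_fin 0%N h.+1 eN).
  rewrite integral_tmeasure0.
  rewrite le_eqVlt; apply/orP; left; apply/eqP; apply: eq_integral => b _.
  rewrite OmegaE_normc ?size_map ?size_tuple //; congr (Normc.normc _)%:E.
  rewrite /weighted_det /= big_map.
  rewrite (conj_rows_expansion w q [::] b (@det_seq_multilinear _ N) (@det_seq_alternating _ N)).
  by rewrite ?size_map size_tuple multi_evalZ.
Qed.
End Integrability.

(** * Integrating the joint densities *)

Section Correlations.
Variables (R : realType) (N : nat) (w : R[i] -> R) (q : 'I_N -> {poly R}).
Notation C := R[i].
Notation V := 'rV[C]_N.
Notation e := (@basis_row C N).
Hypotheses (w_ge0 : forall c : R[i], 0 <= w c)
  (w_measurable : measurable_fun [set: R * R] (fun p : R * R => w (toC p)))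
  (Z_fin : (partition_function N w < +oo)%E)
  (q_monic : forall n, q n \is monic) (q_size : forall n : 'I_N, size (q n) = n.+1)
  (N_even : ~~ odd N).

Local Notation line := (@line_measure R).
Local Notation plane := (@plane_measure R).
Local Notation CI m := (complex_integral m setT).

Lemma pair_form_integrable_all j k : cintegrable plane (fun p => pair_form w q j k (toC p)).
Proof.
have [lt_jk|lt_kj|eq_jk] := ltngtP j k.
- exact: (pair_form_integrable w_ge0 w_measurable Z_fin q_monic q_size N_even
    (exist _ (j, k) lt_jk)).
- have := cintegrableZ (-1) (pair_form_integrable w_ge0 w_measurable Z_fin q_monic q_size N_even
    (exist _ (k, j) lt_kj)); congr cintegrable.
  by apply/funext => p; rewrite /pair_form /=; ring.
- have -> : j = k by exact: val_inj.
  rewrite (_ : (fun p => _) = fun=> 0); first exact: cintegrable0.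
  by apply/funext => p; rewrite /pair_form; ring.
Qed.

(** The half compensates for summing over all ordered pairs of indices where [pair_expansion] sums
    over increasing ones. It makes [conj_mx - conj_mx^T] the non-real part of the Gram matrix. *)
Definition conj_mx : 'M[C]_N :=
  \matrix_(j, k) CI plane (fun p => 2^-1 * pair_form w q j k (toC p)).

Lemma pair_expansion2 (F : seq V -> C) us ws z : multilinear F -> alternating F ->
  pair_weight w z * F (us ++ [:: poly_row q z, poly_row q (conjc z) & ws]) =
  \sum_j \sum_k (2^-1 * pair_form w q j k z) * F (us ++ [:: e j, e k & ws]).
Proof.
move=> linF altF; rewrite multilinear_basis //.
pose X j k := F (us ++ [:: e j, e k & ws]).
pose a k := poly_fun (q k) z; pose b k := poly_fun (q k) (conjc z).
have -> : \sum_j poly_row q z 0 j * F (us ++ [:: e j, poly_row q (conjc z) & ws]) =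
    \sum_j \sum_k a j * b k * X j k.
  apply: eq_bigr => j _; rewrite mxE -cat_rcons multilinear_basis // mulr_sumr.
  by apply: eq_bigr => k _; rewrite mxE cat_rcons mulrA.
have anti : \sum_j \sum_k a j * b k * X j k = - \sum_j \sum_k b j * a k * X j k.
  rewrite exchange_big -sumrN; apply: eq_bigr => k _; rewrite -sumrN.
  by apply: eq_bigr => j _; rewrite /X altF; ring.
transitivity (pair_weight w z * (2^-1 * (\sum_j \sum_k a j * b k * X j k
    - \sum_j \sum_k b j * a k * X j k))).
  by rewrite -[- _]anti; field.
rewrite -sumrB !mulr_sumr; apply: eq_bigr => j _; rewrite -sumrB !mulr_sumr.
by apply: eq_bigr => k _; rewrite /pair_form -/(a j) -/(b j) -/(a k) -/(b k) -/(X j k); ring.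
Qed.

Lemma cintegral_conj_rows (F : seq V -> C) p us : multilinear F -> alternating F ->
  let f (b : seq (R * R)) := (\prod_(t <- b) pair_weight w (toC t)) *
    F (us ++ conj_rows q [seq toC t | t <- b]) in
  cintegrable (tmeasure plane p) (fun b => f b) /\
  CI (tmeasure plane p) (fun b => f b) = iter p (insert_pair conj_mx) F us.
Proof.
move=> linF altF; elim: p us => [|p IH] us f.
  split; first exact: cintegrable_tuple0.
  rewrite /complex_integral !integral_tmeasure0 /= /f big_nil /= mul1r cats0.
  by case: (F us).
pose f2 j k (b : seq (R * R)) := (\prod_(t <- b) pair_weight w (toC t)) *
    F ((us ++ [:: e j; e k]) ++ conj_rows q [seq toC t | t <- b]).
have fE : (fun b : p.+1.-tuple (R * R) => f b) = (fun b => \sum_j \sum_k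
    (2^-1 * pair_form w q j k (toC (thead b))) * f2 j k (tdel ord0 b)).
  apply/funext => b; case: (tupleP b) => t b'; rewrite theadE.
  have -> : tdel ord0 [tuple of t :: b'] = b' by exact: tdel0.
  rewrite /f /= big_cons -/(conj_rows _ _) mulrAC.
  rewrite (pair_expansion2 us (conj_rows q [seq toC t | t <- b']) _ linF altF).
  rewrite mulr_suml; apply: eq_bigr => j _; rewrite mulr_suml; apply: eq_bigr => k _.
  by rewrite /f2 -catA /=; ring.
have jg j k : cintegrable plane (fun t => 2^-1 * pair_form w q j k (toC t)).
  exact/cintegrableZ/pair_form_integrable_all.
have J j k := cintegral_tcons (jg j k) (IH (us ++ [:: e j; e k])).1.
rewrite fE; split.
  by apply: cintegrable_sum => j _; apply: cintegrable_sum => k _; exact: (J j k).1.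
rewrite cintegral_sum; last by move=> j _; apply: cintegrable_sum => k _; exact: (J j k).1.
rewrite iterS; apply: eq_bigr => j _.
rewrite cintegral_sum; last by move=> k _; exact: (J j k).1.
by apply: eq_bigr => k _; rewrite (J j k).2 (IH _).2 mxE.
Qed.

Variable phi : C -> C.
Hypothesis w_phi : point_factor w phi.

Definition qtilde_row (c : C) : V := \row_k qtilde phi q k c.

Definition epsilon_row (c : C) : V := \row_k epsilon (@leb1 R) (qtilde phi q k) c.

Definition pair_vectors (z : seq C) : seq V :=
  flatten [seq [:: qtilde_row c; epsilon_row c] | c <- z].

Lemma real_rowE x : real_row w q x = qtilde_row x%:C.
Proof. by apply/rowP => k; rewrite !mxE /qtilde w_phi.1 mulrC. Qed.

Lemma epsilon_row_real x : epsilon_row x%:C = sg_transform line (real_row w q) x.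
Proof.
apply/rowP => k; rewrite !mxE /epsilon /= eqxx; congr (_ * complex_integral _ _ _).
by apply/funext => y; rewrite real_rowE mxE.
Qed.

Lemma det_pair_vectors (F : seq V -> C) us z ws : multilinear F ->
  all (fun c => complex.Im c != 0) z ->
  (\prod_(c <- z) pair_weight w c) * F (us ++ conj_rows q z ++ ws) =
  F (us ++ pair_vectors z ++ ws).
Proof.
move=> linF; elim: z us => [|c z IH] us /=; first by rewrite big_nil mul1r.
move=> /andP[c0 /IH{}IH]; rewrite big_cons -/(conj_rows q z) -/(pair_vectors z).
have -> : qtilde_row c = phi c *: poly_row q c.
  by apply/rowP => k; rewrite !mxE /qtilde mulrC.
have -> : epsilon_row c = (pair_sign c * phi (conjc c)) *: poly_row q (conjc c).
  apply/rowP => k; rewrite !mxE /epsilon (negPf c0) /qtilde /pair_sign complexiE; ring.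
rewrite (multilinearZ linF us).
have := multilinearZ linF (rcons us (poly_row q c)) (pair_sign c * phi (conjc c)) (poly_row q (conjc c)) (pair_vectors z ++ ws).
rewrite !cat_rcons => ->.
have := IH (us ++ [:: poly_row q c; poly_row q (conjc c)]).
rewrite -!catA /= => <-; rewrite /pair_weight -(w_phi.2 c c0); ring.
Qed.

Lemma size_pair_vectors z : size (pair_vectors z) = (2 * size z)%N.
Proof. by elim: z => //= c z IH; rewrite -/(pair_vectors z) IH mulnS. Qed.

(** The density integrates to an extended real number, whereas the determinantal expression is
    complex; a real witness [r] links the two and records finiteness. *)
Lemma integral_Omega n p (x : seq R) (z : seq C) :
  all (fun c => complex.Im c != 0) z ->
  (size x + n + 2 * (size z + p) = N)%N ->
  exists2 r : R,
    (\int[tmeasure line n]_a \int[tmeasure plane p]_b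
       (Omega w (x ++ a) (z ++ [seq toC t | t <- b]))%:E = r%:E)%E &
    r%:C = 2 ^+ (size z + p) * sg_integral line (real_row w q) conj_mx n p x (pair_vectors z).
Proof.
move=> nr eN; pose c : C := 2 ^+ (size z + p).
have OmE (a : n.-tuple R) (b : p.-tuple (R * R)) :
    (Omega w (x ++ a) (z ++ [seq toC t | t <- b]))%:C =
    c * (sg_vandermonde (x ++ a))%:C * ((\prod_(t <- b) pair_weight w (toC t)) *
    det_seq ((map (real_row w q) (x ++ a) ++ pair_vectors z) ++ conj_rows q [seq toC t | t <- b])).
  rewrite (OmegaE w q_monic q_size); last by rewrite !size_cat size_map !size_tuple.
  rewrite size_cat size_map size_tuple -/c -mulrA; congr (_ * (_ * _)).
  rewrite /weighted_det big_cat /= big_map mulrAC mulrC; congr (_ * _).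
  have -> b' : conj_rows q (z ++ b') = conj_rows q z ++ conj_rows q b'.
    by rewrite /conj_rows map_cat flatten_cat.
  rewrite -catA.
  exact: (det_pair_vectors _ _ (@det_seq_multilinear _ N) nr).
pose g (a : n.-tuple R) := fine (\int[tmeasure plane p]_b
       (Omega w (x ++ a) (z ++ [seq toC t | t <- b]))%:E)%E.
have J us := cintegral_conj_rows p us (@det_seq_multilinear _ N) (@det_seq_alternating _ N).
have jO (a : n.-tuple R) : cintegrable (tmeasure plane p)
    (fun b => (Omega w (x ++ a) (z ++ [seq toC t | t <- b]))%:C).
  by under eq_fun => b do rewrite OmE; apply: cintegrableZ; exact: (J _).1.
have gE (a : n.-tuple R) : (g a)%:C =
    c * sg_integrand (real_row w q) (det_pairs conj_mx p) x (pair_vectors z) a.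
  rewrite -cintegral_real; last exact: (cintegrable_realE (jO a)).
  under eq_fun => b do rewrite OmE.
  by rewrite cintegralZ ?(J _).2 -?mulrA //; exact: (J _).1.
have jI : cintegrable (tmeasure line n)
    (fun a => sg_integrand (real_row w q) (det_pairs conj_mx p) x (pair_vectors z) a).
  apply: cintegrable_sg_integrand.
  - exact: (real_row_integrable w_ge0 w_measurable Z_fin q_monic q_size).
  - exact: det_pairs_multilinear.
  - exact: det_pairs_alternating.
  - move=> us ous; apply: det_pairs_size; apply: contraNneq N_even => <-.
    by rewrite oddD oddM ous.
  - by rewrite size_pair_vectors oddM.
have jg : cintegrable (tmeasure line n) (fun a => (g a)%:C).
  by under eq_fun => a do rewrite gE; exact: cintegrableZ.
exists (fine (\int[tmeasure line n]_a (g a)%:E)%E).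
  under eq_integral => a _ do rewrite (cintegral_ereal (jO a)).
  rewrite fineK; last exact: integrable_fin_num (cintegrable_realE jg).
  by apply: eq_integral => a _; rewrite /g (cintegral_ereal (jO a)).
rewrite -cintegral_real; last exact: (cintegrable_realE jg).
by under eq_fun => a do rewrite gE; rewrite cintegralZ.
Qed.

End Correlations.

(** * Reindexing the correlation numerators *)

Lemma sum_shift_pairs (K : nmodType) N l m (G : nat -> nat -> K) :
  (forall n p, (l + n + 2 * (m + p) != N)%N -> G n p = 0) ->
  \sum_(p : 'I_N.+1 * 'I_N.+1 | [&& (p.1 + 2 * p.2 == N)%N, (l <= p.1)%N & (m <= p.2)%N])
     G (p.1 - l)%N (p.2 - m)%N = \sum_(n < N.+1) \sum_(p < N.+1) G n p.
Proof.
move=> G0; rewrite pair_bigA /= [RHS](bigID (fun p : 'I_N.+1 * 'I_N.+1 => (l + p.1 + 2 * (m + p.2) == N)%N)).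
rewrite /= [X in _ = _ + X]big1 ?addr0; last by move=> p /G0.
(* Outside its range [inord] returns a default, but the count [l + n + 2 (m + p) = N] keeps both
   indices at most [N]. *)
rewrite (reindex_onto (fun p : 'I_N.+1 * 'I_N.+1 => (inord (l + p.1), inord (m + p.2)) : 'I_N.+1 * 'I_N.+1)
  (fun p : 'I_N.+1 * 'I_N.+1 => (inord (p.1 - l), inord (p.2 - m)))) /=; last first.
  move=> [a b] /= /and3P[_ la mb]; have lta := ltn_ord a; have ltb := ltn_ord b.
  congr pair; apply: val_inj; rewrite /= inordK ?inordK ?subnKC //; lia.
have inordE a b : (l + a + 2 * (m + b) == N)%N ->
    (inord (l + a) : 'I_N.+1) = (l + a)%N :> nat /\ (inord (m + b) : 'I_N.+1) = (m + b)%N :> nat.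
  by move=> /eqP e; split; rewrite inordK //; lia.
have condE (a b : 'I_N.+1) :
  [&& ((inord (l + a) : 'I_N.+1) + 2 * (inord (m + b) : 'I_N.+1) == N)%N,
      (l <= (inord (l + a) : 'I_N.+1))%N & (m <= (inord (m + b) : 'I_N.+1))%N] &&
  ((inord ((inord (l + a) : 'I_N.+1) - l), inord ((inord (m + b) : 'I_N.+1) - m)) == (a, b)) =
  (l + a + 2 * (m + b) == N)%N.
  apply/idP/idP => [/andP[/and3P[e la mb] /eqP[ea eb]]|e]; last first.
    have [-> ->] := inordE _ _ e; rewrite e !leq_addr !addKn /= !inord_val.
    by rewrite eqxx.
  move: (inord (l + a)) (inord (m + b)) e la mb ea eb => c d e lc md.
  move=> /(congr1 val) /= ea /(congr1 val) /= eb.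
  have ltc := ltn_ord c; have ltd := ltn_ord d.
  by rewrite inordK in ea; last lia; rewrite inordK in eb; lia.
apply: eq_big => [[a b]|[a b]] /=; rewrite condE //.
by move=> /inordE[-> ->]; rewrite !addKn.
Qed.

Section Numerator.
Variables (R : realType) (N : nat) (w : R[i] -> R) (q : 'I_N -> {poly R}).
Notation C := R[i].
Hypotheses (w_ge0 : forall c : R[i], 0 <= w c)
  (w_measurable : measurable_fun [set: R * R] (fun p : R * R => w (toC p)))
  (Z_fin : (partition_function N w < +oo)%E)
  (q_monic : forall n, q n \is monic) (q_size : forall n : 'I_N, size (q n) = n.+1)
  (N_even : ~~ odd N).
Variable phi : C -> C.
Hypothesis w_phi : point_factor w phi.

Let cs := corr_sum (@line_measure R) (real_row w q) (conj_mx w q).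

(** The density carries [2^M] and the normalization [1 / 2^(M-m)], so [2^m] comes out of the sum. *)
Lemma correlation_numerator l m (x : l.-tuple R) (z : m.-tuple C) :
  all (fun c => complex.Im c != 0) z ->
  exists2 r : R,
  (\sum_(p : 'I_N.+1 * 'I_N.+1 |
         [&& (p.1 + 2 * p.2 == N)%N, (l <= p.1)%N & (m <= p.2)%N])
    (((p.1 - l)`! * (p.2 - m)`! * 2 ^ (p.2 - m))%:R^-1)%:E *
    \int[tuple_measure (@leb1 R) (p.1 - l)]_a
      \int[tuple_measure (@leb2 R) (p.2 - m)]_b
        (Omega w (x ++ a) (z ++ [seq toC t | t <- b]))%:E = r%:E)%E &
  r%:C = 2 ^+ m * cs x (pair_vectors q phi z).
Proof.
move=> nr; pose J n p := (\int[tuple_measure (@leb1 R) n]_a \int[tuple_measure (@leb2 R) p]_b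
        (Omega w (x ++ a) (z ++ [seq toC t | t <- b]))%:E)%E.
pose SI n p := sg_integral (@line_measure R) (real_row w q) (conj_mx w q) n p x (pair_vectors q phi z).
have JE n p : (l + n + 2 * (m + p) = N)%N ->
    (J n p = (fine (J n p))%:E)%E /\ (fine (J n p))%:C = 2 ^+ (m + p) * SI n p.
  move=> e; have [|r Jr rE] := @integral_Omega R N w q w_ge0 w_measurable Z_fin q_monic q_size
    N_even phi w_phi n p x z nr _; first by rewrite !size_tuple.
  rewrite /J tuple_line_measure tuple_plane_measure Jr /=; split=> //.
  by rewrite rE size_tuple.
pose c n p : R := ((n`! * p`! * 2 ^ p)%:R)^-1.
exists (\sum_(p : 'I_N.+1 * 'I_N.+1 |
         [&& (p.1 + 2 * p.2 == N)%N, (l <= p.1)%N & (m <= p.2)%N])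
    c (p.1 - l)%N (p.2 - m)%N * fine (J (p.1 - l)%N (p.2 - m)%N)).
  rewrite -sumEFin; apply: eq_bigr => p /and3P[/eqP e lp mp].
  rewrite EFinM; congr (_ * _)%E; rewrite -/(J _ _).
  by apply: (JE _ _ _).1; lia.
rewrite rmorph_sum /=.
rewrite (eq_bigr (fun p : 'I_N.+1 * 'I_N.+1 => 2 ^+ m * ((((p.1 - l)`! * (p.2 - m)`!)%:R)^-1 *
   SI (p.1 - l)%N (p.2 - m)%N))) => [|p /and3P[/eqP e lp mp]]; last first.
  rewrite rmorphM /= (JE _ _ _).2; last by lia.
  rewrite /c fmorphV /= rmorph_nat !natrM natrX exprD !invfM.
  have two0 : (2 : C) ^+ (p.2 - m) != 0 by rewrite expf_neq0 // pnatr_eq0.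
  move: (2 ^+ (p.2 - m)) two0 => t t0.
  by rewrite [RHS]mulrCA mulrA; field; rewrite t0 !pnatr_eq0 -!lt0n !fact_gt0.
rewrite (sum_shift_pairs (G := fun n p => 2 ^+ m * (((n`! * p`!)%:R)^-1 * SI n p))); last first.
  move=> n p ne; rewrite /SI sg_integral_size ?mulr0 // size_tuple size_pair_vectors size_tuple.
  by apply: contraNN ne => /eqP <-; apply/eqP; lia.
rewrite /cs /corr_sum mulr_sumr; apply: eq_bigr => n _.
by rewrite mulr_sumr; apply: eq_bigr => p _.
Qed.

(** The partition function is the numerator with no prescribed points. *)
Lemma partition_function_corr_sum :
  (partition_function N w = (fine (partition_function N w))%:E)%E /\
  (fine (partition_function N w))%:C = cs [::] [::].
Proof.
have [//|r Nr rE] := @correlation_numerator 0 0 [tuple] [tuple] _.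
suff -> : partition_function N w = r%:E by rewrite rE expr0 mul1r.
rewrite -Nr; apply: eq_big => [p|[a b] _ /=]; first by rewrite andbT.
by rewrite !subn0.
Qed.

End Numerator.

(** * The Gram matrix *)

Section DensityMeasure.
Context d (T : measurableType d) (R : realType) (mu : {measure set T -> \bar R}).
Variable f : T -> R.
Hypotheses (mf : measurable_fun setT f) (f0 : forall t, 0 <= f t).

Definition density : set T -> \bar R := density_measure mu f.

Let density0 : density set0 = 0%E.
Proof. exact: integral_set0. Qed.
Let density_ge0 A : (0 <= density A)%E.
Proof. by apply: integral_ge0 => t _; rewrite lee_fin. Qed.
Let density_sigma_additive : semi_sigma_additive density.
Proof.
apply: semi_sigma_additive_nng_induced; first exact/measurable_EFinP.
by move=> t; rewrite lee_fin.
Qed.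

HB.instance Definition _ := isMeasure.Build _ _ _ density
  density0 density_ge0 density_sigma_additive.

Import HBNNSimple.

Let density_indic A : measurable A ->
  (\int[density]_t (\1_A t)%:E = \int[mu]_t ((\1_A t)%:E * (f t)%:E))%E.
Proof.
move=> mA; rewrite integral_indic // setIT.
transitivity (\int[mu]_(t in A) (f t)%:E)%E; first by [].
rewrite integral_mkcond.
apply: eq_integral => t _; rewrite patchE indicE.
by case: (t \in A); rewrite ?mul1e ?mul0e.
Qed.

Let mfE : measurable_fun setT (EFin \o f).
Proof. exact/measurable_EFinP. Qed.

Let density_nnsfun (h : {nnsfun T >-> R}) :
  (\int[density]_t (h t)%:E = \int[mu]_t ((h t)%:E * (f t)%:E))%E.
Proof.
have mr r : measurable_fun setT (fun t => (r * \1_(h @^-1` [set r]) t)%:E).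
  exact/measurable_EFinP/measurableT_comp.
under [LHS]eq_integral do rewrite fimfunE -fsumEFin//.
rewrite [LHS]ge0_integral_fsum//; last by move=> n x _; rewrite EFinM nnfun_muleindic_ge0.
under [RHS]eq_integral.
  move=> x _; rewrite fimfunE -fsumEFin// muleC ge0_mule_fsumr; last first.
    by move=> r; rewrite EFinM nnfun_muleindic_ge0.
  over.
rewrite [RHS]ge0_integral_fsum//; last 2 first.
  - by move=> r; apply: emeasurable_funM.
  - by move=> n x _; rewrite EFinM mule_ge0 ?nnfun_muleindic_ge0 // lee_fin.
apply: eq_fsbigr => r /[!inE] -[t _ htr]; have r0 : 0 <= r by rewrite -htr.
under [LHS]eq_integral do rewrite EFinM.
rewrite ge0_integralZl //; last by apply/measurable_EFinP.
rewrite density_indic // -ge0_integralZl //.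
- by apply: eq_integral => x _; rewrite EFinM muleA [RHS]muleC.
- apply: emeasurable_funM => //; exact/measurable_EFinP.
- by move=> x _; rewrite mule_ge0 // lee_fin.
Qed.

(** Simple functions first, then monotone convergence along an increasing approximation of [g]. *)
Lemma ge0_integral_density (g : T -> \bar R) :
  measurable_fun setT g -> (forall t, 0 <= g t)%E ->
  (\int[density]_t g t = \int[mu]_t (g t * (f t)%:E))%E.
Proof.
move=> mg g0; pose g_ := nnsfun_approx measurableT mg.
transitivity (limn (fun n => \int[density]_t (g_ n t)%:E)%E).
  rewrite -monotone_convergence//=.
  - apply: eq_integral => x _; apply/esym/cvg_lim => //=.
    exact: cvg_nnsfun_approx.
  - by move=> n; exact/measurable_EFinP.
  - by move=> n x _; rewrite lee_fin.
  - by move=> x _ a b ab; rewrite lee_fin//; exact/lefP/nd_nnsfun_approx.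
under eq_fun => n do rewrite density_nnsfun.
rewrite -monotone_convergence//=.
- apply: eq_integral => x _; apply/cvg_lim => //=.
  apply: cvgeZr => //.
  exact: cvg_nnsfun_approx.
- by move=> n; apply: emeasurable_funM => //; exact/measurable_EFinP.
- by move=> n x _; rewrite mule_ge0 // lee_fin.
- by move=> x _ a b ab; rewrite lee_wpmul2r ?lee_fin //; exact/lefP/nd_nnsfun_approx.
Qed.

Lemma integral_density (D : set T) (g : T -> R) : measurable D ->
  measurable_fun setT g ->
  (\int[density_measure mu f]_(t in D) (g t)%:E = \int[mu]_(t in D) (g t * f t)%:E)%E.
Proof.
move=> mD mg; rewrite -/density.
rewrite [LHS]integral_mkcond [RHS]integral_mkcond.
have H (h : T -> R) : (fun t => (h t)%:E) \_ D = fun t => (h t * \1_D t)%:E.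
  apply/funext => t; rewrite patchE indicE.
  by case: (t \in D); rewrite ?mulr1 ?mulr0.
rewrite !H; set k := fun t => g t * \1_D t.
have mk : measurable_fun setT (fun t => (k t)%:E).
  by apply/measurable_EFinP; apply: measurable_funM => //; exact: measurable_indic.
rewrite [LHS]integralE [RHS]integralE !ge0_integral_density.
- congr (_ - _)%E; apply: eq_integral => t _.
  + rewrite !funeposE -!EFin_max -EFinM; congr EFin.
    by rewrite maxr_pMl // mul0r mulrAC.
  + rewrite !funenegE -!EFinN -!EFin_max -EFinM; congr EFin.
    by rewrite maxr_pMl // mul0r mulNr mulrAC.
- exact: measurable_funeneg.
- by [].
- exact: measurable_funepos.
- by [].
Qed.

Lemma complex_integral_density (D : set T) (F : T -> R[i]) : measurable D ->
  cmeasurable F ->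
  complex_integral (density_measure mu f) D F =
  complex_integral mu D (fun t => F t * (f t)%:C).
Proof.
move=> mD [mr mi]; rewrite /complex_integral !integral_density //.
apply: Re_Im_inj => /=; congr fine; apply: eq_integral => t _; congr EFin.
- by rewrite Re_mul /=; ring.
- by rewrite Im_mul /=; ring.
Qed.

End DensityMeasure.

Lemma cmeasurable_parameter_integral d1 d2 (T1 : measurableType d1) (T2 : measurableType d2)
    (R : realType) (mu : {sigma_finite_measure set T2 -> \bar R}) (f : T1 * T2 -> R[i]) :
  cmeasurable f -> cmeasurable (fun x => complex_integral mu setT (fun y => f (x, y))).
Proof.
have H (g : T1 * T2 -> R) : measurable_fun setT g ->
    measurable_fun setT (fun x => fine (\int[mu]_y (g (x, y))%:E)%E).
  move=> mg; have mgE : measurable_fun setT (EFin \o g) by exact/measurable_EFinP.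
  apply: (measurableT_comp (f := fine)) => //.
  under eq_fun => x do rewrite integralE.
  apply: emeasurable_funB.
  - have mp : measurable_fun setT ((EFin \o g)^\+)%E by exact: measurable_funepos.
    have := measurable_fun_fubini_tonelli_F (m2 := mu) _ mp (funepos_ge0 _).
    by congr measurable_fun; apply/funext => x; apply: eq_integral => y _; rewrite !funeposE.
  - have mn : measurable_fun setT ((EFin \o g)^\-)%E by exact: measurable_funeneg.
    have := measurable_fun_fubini_tonelli_F (m2 := mu) _ mn (funeneg_ge0 _).
    by congr measurable_fun; apply/funext => x; apply: eq_integral => y _; rewrite !funenegE.
by move=> [rf jf]; split; [exact: (H _ rf)|exact: (H _ jf)].
Qed.

Section Gram.
Variables (R : realType) (N : nat) (w : R[i] -> R) (q : 'I_N -> {poly R}).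
Notation C := R[i].
Hypotheses (w_ge0 : forall c : R[i], 0 <= w c)
  (w_measurable : measurable_fun [set: R * R] (fun p : R * R => w (toC p)))
  (Z_fin : (partition_function N w < +oo)%E)
  (q_monic : forall n, q n \is monic) (q_size : forall n : 'I_N, size (q n) = n.+1)
  (N_even : ~~ odd N).
Local Notation line := (@line_measure R).
Local Notation plane := (@plane_measure R).
Local Notation CI m := (complex_integral m setT).
Local Notation v := (real_row w q).
Local Notation Bc := (conj_mx w q).

Let mw := measurable_w_real w_measurable.

Let cmeasurable_poly_real k : cmeasurable (fun x : R => poly_fun (q k) x%:C).
Proof.
apply: (@cmeasurable_horner _ R R); apply: (cmeasurable_real (u := id)).
exact: measurable_id.
Qed.

(** The weight passes from the measure to the integrated row: the transform for [w lambda] of a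
    polynomial is the Lebesgue transform of the weighted polynomial. *)
Let epsilon_density k y :
  epsilon (density_measure (@leb1 R) (fun t => w t%:C)) (poly_fun (q k)) y%:C =
  sg_transform line v y 0 k.
Proof.
rewrite /epsilon /= eqxx mxE; congr (_ * _).
rewrite (complex_integral_density line mw (fun t => w_ge0 t%:C)) //; last first.
  apply: cmeasurableM => //; apply: cmeasurable_real.
  by apply: (measurableT_comp (@measurable_sg R)); exact: measurable_funB.
by congr (complex_integral _ _ _); apply/funext => t; rewrite !mxE; ring.
Qed.

Let cmeasurable_sg_transform k : cmeasurable (fun y => sg_transform line v y 0 k).
Proof.
under eq_fun => y do rewrite mxE.
apply: cmeasurableM; first exact: cmeasurable_cst.
apply: (cmeasurable_parameter_integral line (f := fun p : R * R =>
  v p.2 0 k * (Num.sg (p.2 - p.1))%:C)).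
apply: cmeasurableM.
  by apply: (cmeasurable_comp (cmeasurable_real_row q w_measurable k)); exact: measurable_snd.
apply: cmeasurable_real; apply: (measurableT_comp (@measurable_sg R)).
by apply: measurable_funB; [exact: measurable_snd|exact: measurable_fst].
Qed.

Let v_int := real_row_integrable w_ge0 w_measurable Z_fin q_monic q_size N_even.

Let gram_line j k :
  CI (density_measure (@leb1 R) (fun t => w t%:C)) (fun y : R =>
    poly_fun (q j) y%:C * epsilon (density_measure (@leb1 R) (fun t => w t%:C)) (poly_fun (q k)) y%:C
    - epsilon (density_measure (@leb1 R) (fun t => w t%:C)) (poly_fun (q j)) y%:C * poly_fun (q k) y%:C) =
  2^-1 * sg_gram line v j k - 2^-1 * sg_gram line v k j.
Proof.
under [X in complex_integral _ _ X]eq_fun => y do rewrite !epsilon_density.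
rewrite (complex_integral_density line mw (fun t => w_ge0 t%:C)) //; last first.
  apply: cmeasurableD; first exact: cmeasurableM.
  under eq_fun => y do rewrite -mulN1r.
  by apply: cmeasurableM; [exact: cmeasurable_cst|exact: cmeasurableM].
rewrite !(sg_gramE v_int) !mulKf ?pnatr_eq0 //.
have J a b := sg_transform_integrable v_int a b.
transitivity (CI line (fun y => (-1) * (v y 0 k * sg_transform line v y 0 j)
    + v y 0 j * sg_transform line v y 0 k)).
  by congr (complex_integral _ _ _); apply/funext => y; rewrite [v y 0 k]mxE [v y 0 j]mxE !mxE; ring.
by rewrite cintegral_lin //; ring.
Qed.

Let pair_form0 j k (p : R * R) : p.2 = 0 -> pair_form w q j k (toC p) = 0.
Proof. by move=> p0; rewrite /pair_form /pair_weight /pair_sign /= p0 sgr0; ring. Qed.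

Let gram_plane j k (nu1 : set R -> \bar R) :
  complex_integral (density_measure (@leb2 R) (fun p => w (toC p))) [set p : R * R | p.2 != 0]
    (fun p => poly_fun (q j) (toC p) * epsilon nu1 (poly_fun (q k)) (toC p)
      - epsilon nu1 (poly_fun (q j)) (toC p) * poly_fun (q k) (toC p)) =
  Bc j k - Bc k j.
Proof.
pose D := [set p : R * R | p.2 != 0].
have mD : measurable D.
  have -> : D = ~` ([set: R] `*` [set 0]).
    by apply/seteqP; split => -[a b] /=; [move=> /eqP nb [_ /nb]|move=> nb; apply/eqP => b0; exact: nb].
  by apply: measurableC; apply: measurableX => //; exact: measurable_set1.
have eq_CI (nu : set (R * R) -> \bar R) f g : {in D, f =1 g} ->
    complex_integral nu D f = complex_integral nu D g.
  have H (a b : R * R -> R) : {in D, a =1 b} ->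
      (\int[nu]_(p in D) (a p)%:E = \int[nu]_(p in D) (b p)%:E)%E.
    move=> fg; rewrite /integral (_ : (fun p => (a p)%:E) \_ D = (fun p => (b p)%:E) \_ D) //.
    by apply/funext => p; rewrite !patchE; case: ifPn => // /fg ->.
  by move=> fg; apply: Re_Im_inj => /=; congr fine; apply: (H _ _ _) => p /fg ->.
pose G (p : R * R) := pair_sign (toC p) *
  (poly_fun (q j) (toC p) * poly_fun (q k) (conjc (toC p))
   - poly_fun (q j) (conjc (toC p)) * poly_fun (q k) (toC p)).
rewrite (eq_CI _ _ G); last first.
  move=> p; rewrite inE /D /= => p0; rewrite /epsilon /= (negPf p0) /G /pair_sign complexiE /=.
  by ring.
have mG : cmeasurable G.
  have mt := @cmeasurable_toC R; have mj := cmeasurable_conjc mt.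
  apply: cmeasurableM.
    apply: cmeasurableM; first exact: cmeasurable_cst.
    apply: cmeasurable_real; apply: (measurableT_comp (@measurable_sg R)).
    exact: measurable_snd.
  apply: cmeasurableD; first by apply: cmeasurableM; exact: cmeasurable_horner.
  under eq_fun => p do rewrite -mulN1r.
  apply: cmeasurableM; first exact: cmeasurable_cst.
  by apply: cmeasurableM; exact: cmeasurable_horner.
rewrite (complex_integral_density plane w_measurable (fun p => w_ge0 (toC p))) //.
have jP a b : cintegrable plane (fun p => pair_form w q a b (toC p)).
  exact: (pair_form_integrable_all w_ge0 w_measurable Z_fin q_monic q_size N_even).
transitivity (CI plane (fun p => pair_form w q j k (toC p))).
  have E (f : R[i] -> R) : f 0 = 0 ->
      (\int[plane]_(p in D) (f (G p * (w (toC p))%:C))%:E =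
       \int[plane]_p (f (pair_form w q j k (toC p)))%:E)%E.
    move=> f0; rewrite integral_mkcond; apply: eq_integral => p _; rewrite patchE.
    case: ifPn => [_|]; first by congr (f _)%:E; rewrite /G /pair_form /pair_weight; ring.
    rewrite notin_setE /D /= => /negP; rewrite negbK => /eqP p0.
    by rewrite pair_form0 // f0.
  by apply: Re_Im_inj; rewrite /= E.
(* By antisymmetry the difference of the two entries is [2 * Bc j k], and the half in [conj_mx]
   cancels. *)
have Banti : Bc k j = - Bc j k.
  rewrite !mxE -mulN1r -cintegralZ; last exact: cintegrableZ.
  by congr (complex_integral _ _ _); apply/funext => p; rewrite /pair_form; ring.
rewrite Banti opprK mxE cintegralZ //.
by move: (CI plane _) => c; field.
Qed.

(** This identifies the matrix [U] of Wick's theorem with the Gram matrix, so that [inv_form] is the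
    bilinear form with matrix [mu_mx]. *)
Lemma gramE : gram w q = pair_mx line v Bc - (pair_mx line v Bc)^T.
Proof.
have pE j k : pair_mx line v Bc j k = 2^-1 * sg_gram line v j k + Bc j k.
  by rewrite [LHS]mxE [X in X + _]mxE.
apply/matrixP => j k; rewrite [LHS]mxE /skew_form gram_plane gram_line.
have aE (P : 'M[C]_N) : (P - P^T) j k = P j k - P k j by rewrite !mxE.
by rewrite aE !pE; ring.
Qed.

End Gram.

Lemma nth_flatten_pairs (S T : Type) (f g : S -> T) x0 s0 (s : seq S) i :
  (i < (size s).*2)%N ->
  nth x0 (flatten [seq [:: f c; g c] | c <- s]) i =
  if odd i then g (nth s0 s i./2) else f (nth s0 s i./2).
Proof.
elim: s i => // c s IH [|[|i]] //=.
by rewrite doubleS !ltnS => /IH ->; rewrite negbK.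
Qed.

(** * The kernel *)

Section KernelPfaffian.
Variables (R : realType) (N : nat) (w : R[i] -> R) (q : 'I_N -> {poly R}).
Variable phi : R[i] -> R[i].
Notation C := R[i].
Variable P : 'M[C]_N.
Hypothesis gramP : gram w q = P - P^T.
Local Notation qrow := (qtilde_row q phi).
Local Notation erow := (epsilon_row q phi).

Lemma inv_formE (u v : 'rV[C]_N) :
  inv_form P u v = \sum_(n < N) \sum_(n' < N) mu_mx w q n n' * u 0 n * v 0 n'.
Proof.
rewrite /inv_form -gramP -/(mu_mx w q) mxE exchange_big; apply: eq_bigr => n' _.
rewrite !mxE mulr_suml; apply: eq_bigr => n _.
by rewrite [u 0 n * _]mulrC.
Qed.

Definition point_pair (c : C) : seq ('rV[C]_N * option R) :=
  [:: untagged R (qrow c);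
      (erow c, if complex.Im c == 0 then Some (complex.Re c) else None)].

Lemma pf_seq_point_pairs n (pts : n.-tuple C) :
  pf_seq (untagged R 0) (tagged_form (real_complex R) P) (flatten (map point_pair pts)) =
  pfaffian (block2_mx (fun i j => K_kernel w phi q (tnth pts i) (tnth pts j))).
Proof.
rewrite (@pf_seqE _ _ _ _ _ n); last first.
  by rewrite -[in RHS](size_tuple pts); elim: (tval pts) => //= c s ->.
congr pfaffian; apply/matrixP => i j; rewrite !mxE.
have nthE (k : 'I_n.*2) : nth (untagged R 0) (flatten (map point_pair pts)) k =
    if odd k then (erow (tnth pts (half_ord k)),
      if complex.Im (tnth pts (half_ord k)) == 0 then Some (complex.Re (tnth pts (half_ord k))) else None)
    else untagged R (qrow (tnth pts (half_ord k))).
  rewrite (nth_flatten_pairs _ _ _ 0) ?size_tuple // !(tnth_nth 0).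
  by [].
rewrite !nthE; set c := tnth pts _; set c' := tnth pts _.
have inord0 (b : bool) : (inord b == 0 :> 'I_2) = ~~ b.
  by rewrite -val_eqE /= inordK; case: b.
rewrite !inord0 /tagged_form; case: (odd i); case: (odd j) => /=.
- rewrite inv_formE /IS_kernel /E_kernel; congr (_ + _).
    congr (_ * _); apply: eq_bigr => a _; apply: eq_bigr => b _.
    by rewrite !mxE.
  by case: (complex.Im c == 0); case: (complex.Im c' == 0).
- rewrite [X in _ + X](_ : _ = 0) ?addr0; last by case: (complex.Im c == 0).
  (* Antisymmetry moves the epsilon vector to the second argument, which is how [- S_N] with
     exchanged points arises. *)
  rewrite inv_form_anti inv_formE mulrN /S_kernel; congr (- (_ * _)).
  by apply: eq_bigr => a _; apply: eq_bigr => b _; rewrite !mxE.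
- rewrite inv_formE addr0 /S_kernel; congr (_ * _).
  by apply: eq_bigr => a _; apply: eq_bigr => b _; rewrite !mxE.
- rewrite inv_formE addr0 /DS_kernel; congr (_ * _).
  by apply: eq_bigr => a _; apply: eq_bigr => b _; rewrite !mxE.
Qed.

End KernelPfaffian.

(** * Assembly of the Pfaffian formula *)

Theorem theorem4 (R : realType) (N : nat) (w : R[i] -> R) (phi : R[i] -> R[i])
    (q : 'I_N -> {poly R}) (l m : nat) (x : l.-tuple R) (z : m.-tuple R[i])
    (N_even : ~~ odd N)
    (w_ge0 : forall c : R[i], 0 <= w c)
    (w_measurable : measurable_fun [set: R * R] (fun p : R * R => w (toC p)))
    (w_phi : point_factor w phi)
    (Z_gt0 : (0 < partition_function N w)%E)
    (Z_fin : (partition_function N w < +oo)%E)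
    (q_monic : forall n : 'I_N, q n \is monic)
    (q_size : forall n : 'I_N, size (q n) = n.+1)
    (lm_le : (l + 2 * m <= N)%N)
    (lm_neq0 : (l, m) != (0%N, 0%N))
    (z_nonreal : forall k : 'I_m, complex.Im (tnth z k) != 0) :
  let pts : (l + m).-tuple R[i] := [tuple of [seq t%:C | t <- x] ++ z] in
  correlation N w x z \is a fin_num /\
  (fine (correlation N w x z))%:C =
    pfaffian (block2_mx (fun i j => K_kernel w phi q (tnth pts i) (tnth pts j))).
Proof.
move=> pts; have nr : all (fun c => complex.Im c != 0) z.
  by apply/allP => c /tnthP[k ->].
have [r numE rE] := correlation_numerator w_ge0 w_measurable Z_fin q_monic q_size N_even w_phi x nr.
have [ZE ZC] := partition_function_corr_sum w_ge0 w_measurable Z_fin q_monic q_size N_even w_phi.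
rewrite /correlation numE -EFinM; split; first by [].
have v_int := real_row_integrable w_ge0 w_measurable Z_fin q_monic q_size N_even.
have gP := gramE w_ge0 w_measurable Z_fin q_monic q_size N_even.
set P := pair_mx _ _ _ in gP.
have nilE := corr_sum_nil (conj_mx w q) v_int N_even.
(* On the empty list the functional equals the partition function, which is positive. *)
have wick0 : wick P [::] != 0.
  rewrite -nilE // -ZC fmorph_eq0; apply: contraTneq Z_gt0 => Z0.
  by rewrite ZE Z0 ltxx.
have stE := @size_pair_vectors R N q phi z.
have T := @correlation_tagged_pf R[i] R (real_complex R) N P (real_row w q)
  (sg_transform (@line_measure R) (real_row w q)) N_even (wick_nil_unitmx wick0)
  (corr_sum (@line_measure R) (real_row w q) (conj_mx w q)) nilE
  (corr_sum_cons (conj_mx w q) v_int N_even) x (pair_vectors q phi z).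
rewrite [fine _]/= rmorphM fmorphV /= ZC rE nilE // -(pf_seq_point_pairs phi gP).
have -> : flatten (map (point_pair q phi) pts) =
    real_pairs (real_row w q) (sg_transform (@line_measure R) (real_row w q)) x ++
    map (@untagged R[i] R N) (pair_vectors q phi z).
  rewrite /pts map_cat flatten_cat; congr (_ ++ _).
    rewrite /real_pairs -map_comp; congr flatten; apply: eq_map => t /=.
    by rewrite /point_pair /real_pair /= eqxx -(real_rowE q w_phi) (epsilon_row_real q w_phi).
  elim: {stE T numE rE pts} (tval z) nr => //= c s IH /andP[c0 /IH ->].
  by rewrite (negPf c0).
(* The non-real points contribute [2 m] vectors, so the [2^m] of the numerator is the power of 2
   that [correlation_tagged_pf] expects; afterwards [wick P [::]] cancels against the partition
   function. *)
rewrite -[X in 2 ^+ X](_ : (size (pair_vectors q phi z))./2 = m); last first.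
  by rewrite stE size_tuple mul2n doubleK.
by rewrite /P -/P T ?stE ?oddM //= mulKf.
Qed.
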